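(* Let $d\ge2$ and $\lambda\in\mathbb{C}$. The Schwartz kernel $K_\lambda(x,y)$ of $\mathcal{E}_a(\lambda)\mathcal{E}_a(\overline\lambda)^*$ satisfies $$|K_\lambda(x,y)|\lesssim e^{|\mathrm{Im}\lambda||x-y|}(1+|\lambda||x-y|)^{-\frac{d-1}{2}},\quad x,y\in\mathbb{R}^d.$$ Moreover, the Schwartz kernel $\widetilde K_\lambda(x,y)$ of $\mathcal{E}_a(\lambda)\mathcal{E}_a(\lambda)^*$ satisfies $$|\widetilde K_\lambda(x,y)|\lesssim e^{|\mathrm{Im}\lambda||x+y|}\big(1+|\mathrm{Re}\lambda||x-y|+|\mathrm{Im}\lambda||x+y|\big)^{-\frac{d-1}{2}},\quad x,y\in\mathbb{R}^d.$$ Both bounds are uniform over $a$ in the unit ball of $L^\infty(\mathbb{R}^d_x;C^N(\mathbb{S}^{d-1}_\xi))$.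
   Context: For $a=a(x,\xi)$ on $\mathbb{R}^d\times\mathbb{S}^{d-1}$, bounded and smooth in $\xi$, define $$\mathcal{E}_a(\lambda)g(x):=\int_{\mathbb{S}^{d-1}}e^{i\lambda x\cdot\xi}a(x,\xi)g(\xi)\,dS(\xi),\quad x\in\mathbb{R}^d,\ \lambda\in\mathbb{C}.$$ The adjoint $\mathcal{E}_a(\mu)^*$ is taken with respect to the $L^2$ inner products, i.e. $\mathcal{E}_a(\mu)^*f(\xi)=\int_{\mathbb{R}^d}\overline{e^{i\mu y\cdot\xi}a(y,\xi)}f(y)\,dy$. $N$ is a fixed, sufficiently large integer depending only on $d$. Implicit constants depend only on $d$ (not on $\lambda,x,y,a$). *)

(* Defs.v *)
From HB Require Import structures.
From mathcomp Require Import all_boot all_order all_algebra.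
From mathcomp Require Import all_classical all_reals all_analysis.
From mathcomp Require Import measurable_realfun ess_sup_inf.
From mathcomp Require Import complex.
Set Implicit Arguments.
Unset Strict Implicit.
Unset Printing Implicit Defensive.
Import Order.TTheory GRing.Theory Num.Theory.
Import numFieldNormedType.Exports ComplexField.Normc.
Local Open Scope classical_set_scope.
Local Open Scope ring_scope.

Definition measure_rV_display : measure_display.
Proof. exact. Qed.

(* 'rV[R]_n carries the sigma-algebra generated by the coordinates, which is
   the Borel one. *)
Section measurable_rV.
Variables (R : realType) (n : nat).

Definition rV_coord (i : 'I_n) (x : 'rV[R]_n) : measurableTypeR R := x ord0 i.

Let rV_set0 : g_sigma_preimage rV_coord set0.
Proof. exact: sigma_algebra0. Qed.

Let rV_setC A : g_sigma_preimage rV_coord A -> g_sigma_preimage rV_coord (~` A).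
Proof. exact: sigma_algebraC. Qed.

Let rV_bigcup (F : (set 'rV[R]_n)^nat) :
  (forall i, g_sigma_preimage rV_coord (F i)) ->
  g_sigma_preimage rV_coord (\bigcup_i (F i)).
Proof. exact: sigma_algebra_bigcup. Qed.

HB.instance Definition _ := @isMeasurable.Build measure_rV_display
  'rV[R]_n (g_sigma_preimage rV_coord) rV_set0 rV_setC rV_bigcup.

End measurable_rV.

Section measurable_fun_rV.
Variables (R : realType).

Lemma measurable_rV_coord n (i : 'I_n) :
  measurable_fun [set: 'rV[R]_n] (@rV_coord R n i).
Proof.
move=> _ Y mY; rewrite setTI; apply: sub_sigma_algebra => /=.
rewrite -bigcup_seq/=; exists i => /=; first by rewrite mem_index_enum.
by exists Y => //; rewrite setTI.
Qed.

Lemma measurable_fun_rVP d1 (T1 : measurableType d1) n (f : T1 -> 'rV[R]_n) :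
  (forall i, measurable_fun [set: T1] (@rV_coord R n i \o f)) ->
  measurable_fun [set: T1] f.
Proof.
move=> mf.
suff prefS : g_sigma_preimage (fun i => @rV_coord R n i \o f) `<=` measurable.
  move=> _ A mA; apply: prefS; rewrite g_sigma_preimage_comp.
  by exists A.
apply: smallest_sub; first exact: sigma_algebra_measurable.
case: n => [|n] in f mf *; first by rewrite big_ord0.
rewrite -bigcup_mkord_ord; apply: bigcup_sub => i Ii.
by move=> A [B mB <-]; exact: mf.
Qed.
End measurable_fun_rV.

Section lebesgue_rV.
Variable R : realType.

Definition cons_rV n (p : measurableTypeR R * 'rV[R]_n) : 'rV[R]_n.+1 :=
  row_mx (p.1)%:M p.2.

Definition uncons_rV n (x : 'rV[R]_n.+1) : measurableTypeR R * 'rV[R]_n :=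
  (x ord0 ord0, \row_i x ord0 (lift ord0 i)).

Fixpoint lebesgue_rV n : set 'rV[R]_n -> \bar R :=
  match n with
  | 0 => \d_ (0 : 'rV[R]_0)
  | n'.+1 => pushforward (product_measure1 (@lebesgue_measure R)
                            (lebesgue_rV (n := n')))
                         (@cons_rV n')
  end.

Lemma measurable_cons_rV n : measurable_fun setT (@cons_rV n).
Proof.
apply: measurable_fun_rVP => i.
have [->|] := eqVneq i ord0.
  rewrite (_ : _ \o _ = fst) //.
  apply/funext => -[t v] /=; rewrite /rV_coord /cons_rV /=.
  rewrite (_ : ord0 = lshift n (ord0 : 'I_1)); last exact/val_inj.
  by rewrite (row_mxEl (t%:M : 'M[R]_1) v) mxE eqxx mulr1n.
rewrite eq_sym => /unlift_some[j ij _].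
rewrite (_ : _ \o _ = @rV_coord R n j \o snd).
  apply: measurableT_comp => //; exact: measurable_rV_coord.
apply/funext => -[t v] /=; rewrite /rV_coord /cons_rV /=.
rewrite (_ : i = rshift 1 j); first by rewrite (row_mxEr (t%:M : 'M[R]_1) v).
by rewrite ij; exact/val_inj.
Qed.

Lemma measurable_uncons_rV n : measurable_fun setT (@uncons_rV n).
Proof.
apply/measurable_fun_pairP; split.
  exact: (@measurable_rV_coord R n.+1 ord0).
apply: measurable_fun_rVP => i.
rewrite (_ : _ \o _ = @rV_coord R n.+1 (lift ord0 i)).
  exact: measurable_rV_coord.
by apply/funext => x; rewrite /rV_coord /= mxE.
Qed.

Lemma cons_rVK n : cancel (@cons_rV n) (@uncons_rV n).
Proof.
case=> t v; rewrite /uncons_rV /cons_rV; congr pair.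
  rewrite (_ : ord0 = lshift n (ord0 : 'I_1)); last exact/val_inj.
  by rewrite (row_mxEl (t%:M : 'M[R]_1) v) mxE eqxx mulr1n.
apply/rowP => i; rewrite mxE (_ : lift ord0 i = rshift 1 i); last exact/val_inj.
by rewrite (row_mxEr (t%:M : 'M[R]_1) v).
Qed.

End lebesgue_rV.

Section ex_sigma_finite_measure.
Context d (T : measurableType d) (R : realType) (q : set T -> \bar R).
Hypotheses (q0 : q set0 = 0%E) (q_ge0 : forall A, (0 <= q A)%E)
  (q_add : semi_sigma_additive q) (q_fin : sigma_finite setT q).

Definition measure_wrap : set T -> \bar R := q.
HB.instance Definition _ := isMeasure.Build _ _ _ measure_wrap q0 q_ge0 q_add.
HB.instance Definition _ := Measure_isSigmaFinite.Build _ _ _ measure_wrap q_fin.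

Lemma ex_sigma_finite_measure :
  exists m : {sigma_finite_measure set T -> \bar R}, q = m.
Proof. by exists measure_wrap. Qed.

End ex_sigma_finite_measure.

Section lebesgue_rV_measure.
Variable R : realType.

Lemma lebesgue_rV_spec n :
  exists m : {sigma_finite_measure set 'rV[R]_n -> \bar R},
    @lebesgue_rV R n = m.
Proof.
elim: n => [|n [m mE]].
  by exists (\d_ (0 : 'rV[R]_0) : {sigma_finite_measure set _ -> \bar R}).
have {mE}-> : @lebesgue_rV R n.+1 =
    pushforward (@lebesgue_measure R \x m)%E (@cons_rV R n).
  by rewrite -mE.
pose p : {measure set (measurableTypeR R * 'rV[R]_n)%type -> \bar R} :=
  (@lebesgue_measure R \x m)%E.
rewrite -[X in pushforward X]/(p : set _ -> \bar R).
pose q := pushforward p (@cons_rV R n).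
have q0 : q set0 = 0%E by rewrite /q /pushforward preimage_set0 measure0.
have q_ge0 A : (0 <= q A)%E by apply: (measure_ge0 p).
have q_add : semi_sigma_additive q.
  move=> F mF tF mUF; rewrite /q /pushforward preimage_bigcup.
  have mcons A : measurable A -> measurable (@cons_rV R n @^-1` A).
    by move=> mA; rewrite -[X in measurable X]setTI; exact: measurable_cons_rV.
  apply: measure_semi_sigma_additive.
  - by move=> k; exact: mcons.
  - apply/trivIsetP => /= i j _ _ ij; rewrite -preimage_setI.
    by move/trivIsetP : tF => /(_ _ _ _ _ ij) ->//; rewrite preimage_set0.
  - by rewrite -preimage_bigcup; exact: mcons.
have q_fin : sigma_finite setT q.
  have /sigma_finiteP[F [FT ndF mF]] := sigma_finiteT (@lebesgue_measure R).
  have /sigma_finiteP[G [GT ndG mG]] := sigma_finiteT m.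
  have FGT : \bigcup_k (F k `*` G k) = setT.
    apply/seteqP; split=> // -[x y] _.
    have [i _ Fx] : (\bigcup_i F i) x by rewrite -FT.
    have [j _ Gy] : (\bigcup_j G j) y by rewrite -GT.
    exists (maxn i j) => //; split=> /=.
    - by move: x Fx; exact/subsetPset/ndF/leq_maxl.
    - by move: y Gy; exact/subsetPset/ndG/leq_maxr.
  exists (fun k => @uncons_rV R n @^-1` (F k `*` G k)).
    by rewrite -preimage_bigcup FGT preimage_setT.
  move=> k; have [mFk Fk] := mF k; have [mGk Gk] := mG k; split.
    rewrite -[X in measurable X]setTI; apply: measurable_uncons_rV => //.
    exact: measurableX.
  rewrite /q /pushforward -comp_preimage.
  rewrite (_ : _ \o _ = id); last by apply/funext => t; exact: cons_rVK.
  rewrite preimage_id [ltLHS](product_measure1E _ m)//.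
  by rewrite lte_mul_pinfty// ge0_fin_numE.
exact: ex_sigma_finite_measure.
Qed.

Lemma lebesgue_rV0 n : @lebesgue_rV R n set0 = 0%E.
Proof. by have [m ->] := lebesgue_rV_spec n; exact: measure0. Qed.

Lemma lebesgue_rV_ge0 n A : (0 <= @lebesgue_rV R n A)%E.
Proof. by have [m ->] := lebesgue_rV_spec n; exact: measure_ge0. Qed.

Lemma lebesgue_rV_semi_sigma_additive n :
  semi_sigma_additive (@lebesgue_rV R n).
Proof.
by have [m ->] := lebesgue_rV_spec n; exact: measure_semi_sigma_additive.
Qed.

Lemma lebesgue_rV_sigma_finite n : sigma_finite setT (@lebesgue_rV R n).
Proof. by have [m ->] := lebesgue_rV_spec n; exact: sigma_finiteT. Qed.

HB.instance Definition _ n := isMeasure.Build _ _ _ (@lebesgue_rV R n)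
  (@lebesgue_rV0 n) (@lebesgue_rV_ge0 n) (@lebesgue_rV_semi_sigma_additive n).

HB.instance Definition _ n := Measure_isSigmaFinite.Build _ _ _
  (@lebesgue_rV R n) (@lebesgue_rV_sigma_finite n).

End lebesgue_rV_measure.

Section sphere.
Variables (R : realType) (d : nat).
Implicit Types x y : 'rV[R]_d.

Definition dot x y : R := \sum_(i < d) x ord0 i * y ord0 i.

(* the library norm on 'rV[R]_d is the sup norm *)
Definition enorm x : R := Num.sqrt (dot x x).

Definition sphere : set 'rV[R]_d := [set x | enorm x = 1].

Definition unit_dir x : 'rV[R]_d := (enorm x)^-1 *: x.

(* dS is obtained from polar coordinates: the cone
   {t xi | 0 < t <= 1, xi in A} has volume S(A) / d. *)
Definition surface_measure (A : set 'rV[R]_d) : \bar R :=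
  (d%:R%:E *
   lebesgue_rV [set x | (0 < enorm x <= 1)%R /\ A (unit_dir x)])%E.

Lemma measurable_enorm : measurable_fun setT enorm.
Proof.
apply: (measurableT_comp (continuous_measurable_fun (@sqrt_continuous R))).
by apply: measurable_sum => i; apply: measurable_funM;
  exact: measurable_rV_coord.
Qed.

Lemma measurable_unit_dir : measurable_fun setT unit_dir.
Proof.
apply: measurable_fun_rVP => i.
rewrite (_ : _ \o _ = fun x => (enorm x `^ (-1)) * rV_coord i x); last first.
  apply/funext => x; rewrite /rV_coord /unit_dir /= mxE powR_inv1//.
  exact: sqrtr_ge0.
apply: measurable_funM; last exact: measurable_rV_coord.
exact: (measurableT_comp (measurable_powR _)) measurable_enorm.
Qed.

Let mball : measurable [set x : 'rV[R]_d | 0 < enorm x <= 1].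
Proof.
rewrite (_ : mkset _ = enorm @^-1` `]0, 1]%classic); last first.
  by apply/seteqP; split=> x /=; rewrite in_itv.
by rewrite -[X in measurable X]setTI; exact: measurable_enorm.
Qed.

Lemma surface_measure_spec :
  exists m : {measure set 'rV[R]_d -> \bar R}, surface_measure = m.
Proof.
pose m1 : {measure set 'rV[R]_d -> \bar R} := mrestr (@lebesgue_rV R d) mball.
pose m2 : {measure set 'rV[R]_d -> \bar R} :=
  pushforward m1 unit_dir.
exists (mscale (NngNum (ler0n R d)) (m2 measurable_unit_dir)).
apply/funext => A; rewrite /surface_measure /mscale /= /pushforward /mrestr.
by congr (_ * lebesgue_rV _)%E; apply/seteqP; split=> x [].
Qed.

Lemma surface_measure0 : surface_measure set0 = 0%E.
Proof. by have [m ->] := surface_measure_spec; exact: measure0. Qed.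

Lemma surface_measure_ge0 A : (0 <= surface_measure A)%E.
Proof. by have [m ->] := surface_measure_spec; exact: measure_ge0. Qed.

Lemma surface_measure_semi_sigma_additive :
  semi_sigma_additive surface_measure.
Proof.
have [m ->] := surface_measure_spec; exact: measure_semi_sigma_additive.
Qed.

HB.instance Definition _ := isMeasure.Build _ _ _ surface_measure
  surface_measure0 surface_measure_ge0 surface_measure_semi_sigma_additive.

End sphere.

Section complex_valued.
Local Open Scope complex_scope.
Variable R : realType.
Local Notation C := R[i].

(* In ring_scope 'i would be the imaginary unit chosen abstractly in a
   numClosedFieldType; we want the standard one. *)
Definition imag_unit : C := 0 +i* 1.

Definition cexp (z : C) : C :=
  (expR (complex.Re z))%:C * (cos (complex.Im z) +i* sin (complex.Im z)).

Section integration.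
Context d (T : measurableType d).
Variable mu : {measure set T -> \bar R}.
Implicit Types (D : set T) (f : T -> C).

Definition cmeasurable_fun D f :=
  measurable_fun D (fun x => complex.Re (f x)) /\
  measurable_fun D (fun x => complex.Im (f x)).

Definition cintegrable D f :=
  mu.-integrable D (EFin \o (fun x => complex.Re (f x))) /\
  mu.-integrable D (EFin \o (fun x => complex.Im (f x))).

Definition cintegral D f : C :=
  (\int[mu]_(x in D) complex.Re (f x)) +i*
  (\int[mu]_(x in D) complex.Im (f x)).

End integration.

Section differentiation.
Variable d : nat.
Implicit Types (s : seq 'I_d) (U : set 'rV[R]_d).

Fixpoint partial s (u : 'rV[R]_d -> R) : 'rV[R]_d -> R :=
  if s is i :: s' then
    fun x => derive (partial s' u) x (delta_mx ord0 i)
  else u.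

Definition Ck_on k U (u : 'rV[R]_d -> R) := forall s, (size s <= k)%N ->
  (forall x, U x -> {for x, continuous (partial s u)}) /\
  ((size s < k)%N -> forall i x, U x ->
    derivable (partial s u) x (delta_mx ord0 i)).

Definition cCk_on k U (f : 'rV[R]_d -> C) :=
  Ck_on k U (fun x => complex.Re (f x)) /\
  Ck_on k U (fun x => complex.Im (f x)).

Definition cpartial s (f : 'rV[R]_d -> C) (x : 'rV[R]_d) : C :=
  partial s (fun y => complex.Re (f y)) x +i*
  partial s (fun y => complex.Im (f y)) x.

(* A function g on the sphere is C^N iff its extension to R^d \ {0},
   homogeneous of degree 0, is C^N there; the C^N(S^(d-1)) norm is taken to be
   the largest sup norm over the sphere of the partial derivatives of order at
   most N of that extension.  Only the values of g on the sphere matter. *)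
Definition CN_sphere N (g : 'rV[R]_d -> C) :=
  cCk_on N [set x | x != 0] (g \o @unit_dir R d).

Definition CN_norm N (g : 'rV[R]_d -> C) : \bar R :=
  ereal_sup [set (normc (cpartial p.1 (g \o @unit_dir R d) p.2))%:E |
    p in [set p : seq 'I_d * 'rV[R]_d | (size p.1 <= N)%N /\ sphere p.2]].

Definition Linfty_CN_unit_ball N (a : 'rV[R]_d -> 'rV[R]_d -> C) :=
  [/\ cmeasurable_fun (setT `*` @sphere R d) (fun p => a p.1 p.2),
      (\forall x \ae (@lebesgue_rV R d), CN_sphere N (a x)) &
      (ess_sup (@lebesgue_rV R d) (fun x => CN_norm N (a x)) <= 1)%E].

Definition test_function (phi : 'rV[R]_d -> C) :=
  (forall k, cCk_on k setT phi) /\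
  exists r : R, forall x, r < enorm x -> phi x = 0.

Definition clocally_integrable (f : 'rV[R]_d -> C) :=
  forall r : R, cintegrable (@lebesgue_rV R d) [set x | enorm x <= r] f.

Definition clocally_integrable2 (K : 'rV[R]_d -> 'rV[R]_d -> C) :=
  forall r : R, cintegrable (@lebesgue_rV R d \x @lebesgue_rV R d)%E
    [set p | enorm p.1 <= r /\ enorm p.2 <= r] (fun p => K p.1 p.2).

(* The distribution kernel of T is (the regular distribution defined by) the
   locally integrable function K.  Integrals of non-integrable functions have
   junk values, hence the explicit local integrability of T phi. *)
Definition is_schwartz_kernel (T : ('rV[R]_d -> C) -> 'rV[R]_d -> C)
    (K : 'rV[R]_d -> 'rV[R]_d -> C) :=
  clocally_integrable2 K /\
  forall phi, test_function phi ->
    clocally_integrable (T phi) /\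
    forall psi, test_function psi ->
      cintegral (@lebesgue_rV R d) setT (fun x => T phi x * psi x) =
      cintegral (@lebesgue_rV R d \x @lebesgue_rV R d)%E setT
        (fun p => K p.1 p.2 * phi p.2 * psi p.1).

End differentiation.

Section extension_operator.
Variables (d : nat) (a : 'rV[R]_d -> 'rV[R]_d -> C).

Definition extension_op (lambda : C) (g : 'rV[R]_d -> C) (x : 'rV[R]_d) : C :=
  cintegral (@surface_measure R d) (@sphere R d)
    (fun xi => cexp (imag_unit * lambda * (dot x xi)%:C) * a x xi * g xi).

Definition extension_op_adj (mu : C) (f : 'rV[R]_d -> C) (xi : 'rV[R]_d) : C :=
  cintegral (@lebesgue_rV R d) setT
    (fun y => conjc (cexp (imag_unit * mu * (dot y xi)%:C) * a y xi) * f y).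

End extension_operator.

End complex_valued.

(* Main.v *)
(**
   The kernel at [(x, y)] is an integral [int_S exp (v . xi) b(xi) dS] with [v] a
   complex vector and [b] a product of two amplitudes.  Write [v = M (conj c)] with
   [c] a unit vector, [z = c . xi], so that the phase is [M (conj z)].  The tangential
   field [Y] given by [c - z xi] (the projection of [c]) satisfies
   [Y (conj z) = 1 - |z|^2], hence [(1 + Y) e^phase = w^-1 e^phase] for the weight
   [w = (1 + M (1 - |z|^2))^-1].  Each integration by parts along [Y] therefore gains a
   factor [w], and costs only a bounded factor because [Y] maps [z], [conj z], [w] and
   [M w (sum c_i^2 - z^2)] to polynomials in these same bounded functions.  After [d - 1]
   steps it remains to integrate [w^(d-1)], and [1 - |z|^2] controls
   [(xi_j - k_j xi_i)^2] for some [i] and all [j != i], so a shear reduces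
   the integral to a product of one-dimensional integrals of [(1 + M u^2)^-1], giving
   [M^(-(d-1)/2)].  The real and imaginary parts of [v] need not be parallel, so both
   kernels are covered at once.

   Integration by parts on the sphere follows from the rotation invariance of the surface
   measure, by dominated convergence of difference quotients along rotations.
*)
Require Import Defs.
From HB Require Import structures.
From mathcomp Require Import all_boot all_order all_algebra.
From mathcomp Require Import all_classical all_reals all_analysis.
From mathcomp Require Import measurable_realfun ess_sup_inf.
From mathcomp Require Import complex ring lra.
Set Implicit Arguments.
Unset Strict Implicit.
Unset Printing Implicit Defensive.
Import Order.TTheory GRing.Theory Num.Theory.
Import numFieldNormedType.Exports ComplexField.Normc.
Local Open Scope classical_set_scope.
Local Open Scope ring_scope.
Local Open Scope complex_scope.

(** * Lebesgue measure on row vectors and the surface measure *)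

(** The phase is [lin v] for an arbitrary complex [v]. On the sphere it has two antipodal critical
    points when the real and imaginary parts of [v] are parallel and none otherwise, so an argument
    localised at critical points would have to interpolate between these cases. The complex
    coefficients of Y avoid this: Y applied to the phase is M times the squared Hermitian length of
    the projected vector c - z xi, hence real and nonnegative, and 1 + M (1 - |z|^2) never vanishes.
    The danger is that differentiating w releases factors M. They are absorbed by M w (1 - |z|^2) <=
    1; the other quantity that occurs, M w Y(z), obeys the same bound because Y(z) is the bilinear
    square of the projected vector, dominated by its Hermitian square. The modulus of the
    exponential is only bounded by its maximum on the sphere, which gives the factor [expR]; all
    decay comes from the weights, and M sees both parts of [v]. The amplitude is controlled only for
    x outside a null set. The kernel is set to zero there, which makes the bounds hold at every
    point. Rotation invariance comes from shears because Lebesgue measure is built one coordinate at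
    a time. *)

Section one_dim.
Variable R : realType.
Local Notation mu := (@lebesgue_measure R).

Lemma lebesgue_measure_shift (c : R) (A : set R) : measurable A ->
  pushforward mu (fun x : measurableTypeR R => x + c : measurableTypeR R) A = mu A.
Proof.
move=> mA; have mc : measurable_fun setT (fun x : measurableTypeR R => x + c : measurableTypeR R).
  exact: measurable_funD.
apply/esym; apply: (@lebesgue_measure_unique _ (pushforward mu _)) => // _ [[a b]] _ <-.
transitivity (mu `]a - c, b - c]%classic); last first.
  congr (mu _); apply/seteqP.
  by split=> x /=; rewrite !in_itv/= ltrBlDr lerBrDr.
rewrite !lebesgue_measure_itv/= !lte_fin ltrD2r -!EFinB.
by rewrite opprB addrA subrK.
Qed.

Lemma ge0_integral_shift (c : R) (f : R -> \bar R) :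
  measurable_fun setT f -> (forall x, 0 <= f x)%E ->
  (\int[mu]_x f (x + c)%R = \int[mu]_x f x)%E.
Proof.
move=> mf f0.
pose sh : measurableTypeR R -> measurableTypeR R := fun x => x + c.
have mc : measurable_fun setT sh by exact: measurable_funD.
transitivity (\int[pushforward mu sh]_x f x)%E.
  by rewrite (@ge0_integral_pushforward _ _ _ _ _ _ mc).
apply: eq_measure_integral => A mA _; exact: lebesgue_measure_shift.
Qed.

Lemma integral_oneDsqr_scale (c : R) : 0 < c ->
  (\int[mu]_x ((1 + (c * x) ^+ 2)^-1)%:E = (pi / c)%:E)%E.
Proof.
move=> c0.
have G0 (x : R) : 0 <= (oneDsqr x)^-1 by rewrite invr_ge0 addr_ge0// sqr_ge0.
have cG : continuous (fun x : R => (oneDsqr x)^-1) by exact: continuous_oneDsqrV.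
have mG : measurable_fun setT (fun x : R => (oneDsqr x)^-1) by exact: continuous_measurable_fun.
(* The half-line [[0, +oo[] contributes pi / 2; the negative half-line contributes the same by the
   reflection x -> - x. *)
have total : (\int[mu]_x ((oneDsqr x)^-1)%:E = (pi)%:E)%E.
  rewrite -(setUv `[0%R, +oo[%classic) ge0_integral_setU//=; last 3 first.
  - exact: measurableC.
  - by rewrite setUv; apply/measurable_EFinP.
  - exact/disj_setPCl.
  rewrite integral0y_oneDsqr.
  rewrite (_ : ~` `[0%R, +oo[%classic = `]-oo, 0%R[%classic); last first.
    by apply/seteqP; split=> x /=; rewrite !in_itv/= andbT ltNge => /negP.
  have -> : (\int[mu]_(x in `]-oo, 0%R[) ((oneDsqr x)^-1)%:E =
     \int[mu]_(x in `[0%R, +oo[) ((oneDsqr x)^-1)%:E)%E.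
    rewrite [RHS](@ge0_integration_by_substitution0 _ (fun x => ((oneDsqr x)^-1)%:E)) => [|//|r]; last first.
    - by rewrite lee_fin.
    - exact/measurable_EFinP.
    under [RHS]eq_integral do rewrite /oneDsqr sqrrN.
    rewrite [LHS]integral_itv_bndo_bndc//; apply/measurable_EFinP.
    exact: measurable_funTS.
  by rewrite integral0y_oneDsqr -EFinD -splitr.
have dF (x : R) : is_derive x 1 (fun x => c * x) c.
  by have := @is_deriveZ _ _ _ id c x 1 1 _; rewrite /GRing.scale/= mulr1; apply.
have F' : derive1 (fun x : R => c * x) = cst c.
  by apply/funext => x; rewrite derive1E derive_val.
have FN : (c * x) @[x --> -oo] --> -oo by apply/gt0_cvgMrNy => //; exact: cvg_id.
have FP : (c * x) @[x --> +oo] --> +oo by apply/gt0_cvgMry => //; exact: cvg_id.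
have := @increasing_ge0_integration_by_substitutionT R (fun x => c * x) (fun x => (oneDsqr x)^-1).
rewrite F' total => /(_ _ _ _ _ _ FN FP cG G0) E.
rewrite mulrC EFinM [X in (_ * X)%E]E.
- rewrite -ge0_integralZl//=; last 3 first.
  + apply/measurable_EFinP; apply: measurable_funM => //.
    by apply: (measurableT_comp mG); exact: measurable_funM.
  + by move=> x _; rewrite lee_fin; apply: mulr_ge0; [exact: G0|exact: ltW].
  + by rewrite lee_fin invr_ge0 ltW.
  apply: eq_integral => x _; rewrite -EFinM mulrC; congr EFin.
  rewrite mulrC -[RHS]/(c^-1 * ((oneDsqr (c * x))^-1 * c)).
  by rewrite mulrCA mulVf ?gt_eqF// mulr1.
- by move=> x y; rewrite ltr_pM2l.
- by move=> x; exact: cvg_cst.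
- exact: is_cvg_cst.
- exact: is_cvg_cst.
- by move=> x.
Qed.
End one_dim.

Section rV.
Variable R : realType.
Local Notation mu := (@lebesgue_measure R).

Lemma measurable_addZ_rV n (j : 'I_n) (tau : 'rV[R]_n -> R) :
  measurable_fun setT tau ->
  measurable_fun setT (fun x : 'rV[R]_n => x + tau x *: delta_mx ord0 j).
Proof.
move=> mt; apply: measurable_fun_rVP => i.
rewrite (_ : _ \o _ = fun x => (x : 'rV[R]_n) ord0 i + tau x * (i == j)%:R); last first.
  by apply/funext => x; rewrite /rV_coord /= !mxE eqxx.
apply: measurable_funD; first exact: (measurable_rV_coord i).
exact: measurable_funM.
Qed.

Lemma ge0_integral_rVS n (f : 'rV[R]_n.+1 -> \bar R) :
  measurable_fun setT f -> (forall x, 0 <= f x)%E ->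
  (\int[@lebesgue_rV R n.+1]_x f x =
   \int[mu]_t \int[@lebesgue_rV R n]_v f (cons_rV (t, v)))%E.
Proof.
move=> mf f0.
transitivity (\int[pushforward (mu \x @lebesgue_rV R n)%E (@cons_rV R n)]_x f x)%E.
  apply: (@eq_measure_integral _ _ _ _ (pushforward (mu \x @lebesgue_rV R n)%E (@cons_rV R n))
    (@lebesgue_rV R n.+1)) => [|? A _ _].
    exact: measurable_cons_rV.
  exact: erefl.
rewrite (@ge0_integral_pushforward _ _ _ _ _ _ (@measurable_cons_rV R n))//.
rewrite preimage_setT fubini_tonelli1//.
  exact: (measurableT_comp mf (@measurable_cons_rV R n)).
by move=> x; exact: f0.
Qed.

(* Conversion problems mentioning the recursive [lebesgue_rV] would unfold it. *)
Opaque lebesgue_rV.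

Lemma cons_rV_ord0 n (p : measurableTypeR R * 'rV[R]_n) : cons_rV p ord0 ord0 = p.1.
Proof.
case: p => t v; rewrite /cons_rV (_ : ord0 = lshift n (ord0 : 'I_1)); last exact/val_inj.
by rewrite (row_mxEl (t%:M : 'M[R]_1) v) mxE eqxx mulr1n.
Qed.

Lemma cons_rV_lift n (p : measurableTypeR R * 'rV[R]_n) i :
  cons_rV p ord0 (lift ord0 i) = p.2 ord0 i.
Proof.
case: p => t v; rewrite /cons_rV (_ : lift ord0 i = rshift 1 i); last exact/val_inj.
by rewrite (row_mxEr (t%:M : 'M[R]_1) v).
Qed.

Lemma cons_rV_add0 n (t s : R) (v : 'rV[R]_n) :
  cons_rV (t, v) + s *: delta_mx ord0 ord0 = cons_rV (t + s, v).
Proof.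
apply/rowP => i; rewrite mxE [X in _ + X]mxE [delta_mx _ _ _ _]mxE; case: (unliftP ord0 i) => [k|] ->.
  by rewrite !cons_rV_lift eqxx/= mulr0 addr0.
by rewrite !cons_rV_ord0 !eqxx mulr1.
Qed.

Lemma cons_rV_addS n (t s : R) (v : 'rV[R]_n) (j : 'I_n) :
  cons_rV (t, v) + s *: delta_mx ord0 (lift ord0 j) = cons_rV (t, v + s *: delta_mx ord0 j).
Proof.
apply/rowP => i; rewrite mxE [X in _ + X]mxE [delta_mx _ _ _ _]mxE; case: (unliftP ord0 i) => [k|] ->.
  by rewrite !cons_rV_lift /= !mxE (inj_eq lift_inj).
by rewrite !cons_rV_ord0 /= mulr0 addr0.
Qed.

(** Once the other coordinates are frozen, [tau] is a constant and the map is a one-dimensional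
    translation. The induction on [n] descends into the tail until [j] is the first coordinate;
    there Tonelli makes that coordinate the inner variable of integration. *)
Lemma ge0_integral_addZ_rV n (j : 'I_n) (tau : 'rV[R]_n -> R) (f : 'rV[R]_n -> \bar R) :
  measurable_fun setT tau -> (forall x t, tau (x + t *: delta_mx ord0 j) = tau x) ->
  measurable_fun setT f -> (forall x, 0 <= f x)%E ->
  (\int[@lebesgue_rV R n]_x f (x + tau x *: delta_mx ord0 j)%R =
   \int[@lebesgue_rV R n]_x f x)%E.
Proof.
elim: n => [|n IH] in j tau f *; first by case: j.
move=> mt tE mf f0.
have mF := measurableT_comp mf (measurable_addZ_rV j mt).
rewrite (ge0_integral_rVS mf f0) (ge0_integral_rVS mF); last by move=> x; exact: f0.
rewrite /=.
have mc t : measurable_fun setT (fun v : 'rV[R]_n => @cons_rV R n (t, v)).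
  exact: (measurableT_comp (@measurable_cons_rV R n) (pair1_measurable t)).
have mc' v : measurable_fun setT (fun t : measurableTypeR R => @cons_rV R n (t, v)).
  exact: (measurableT_comp (@measurable_cons_rV R n) (pair2_measurable v)).
case: (unliftP ord0 j) => [k|] jE; rewrite {j}jE in tE mF *.
  apply: eq_integral => t _.
  under eq_integral do rewrite cons_rV_addS.
  apply: (IH k (fun v => tau (cons_rV (t, v))) (fun v => f (cons_rV (t, v)))).
  - exact: (measurableT_comp mt (mc t)).
  - by move=> v s; rewrite -cons_rV_addS tE.
  - exact: (measurableT_comp mf (mc t)).
  - by move=> v; exact: f0.
have tau0 t v : tau (cons_rV (t, v)) = tau (cons_rV (0, v)).
  by rewrite -[in LHS](add0r t) -cons_rV_add0 tE.
under eq_integral do under eq_integral do rewrite cons_rV_add0 tau0.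
pose F (p : measurableTypeR R * 'rV[R]_n) := f (cons_rV ((p.1 : R) + tau (cons_rV (0, p.2)), p.2)).
pose F0 (p : measurableTypeR R * 'rV[R]_n) := f (cons_rV p).
have mF0 : measurable_fun setT F0 by exact: (measurableT_comp mf (@measurable_cons_rV R n)).
transitivity (\int[@lebesgue_rV R n]_v \int[mu]_t F (t, v))%E; last first.
  transitivity (\int[@lebesgue_rV R n]_v \int[mu]_t F0 (t, v))%E; last first.
    by symmetry; apply: (@fubini_tonelli _ _ _ _ R mu (@lebesgue_rV R n) F0) => // x; exact: f0.
  apply: eq_integral => v _; rewrite /F /F0 /=.
  have := @ge0_integral_shift R (tau (cons_rV (0, v))) (fun t : R => f (cons_rV (t, v)))
    (measurableT_comp mf (mc' v)) (fun t => f0 _).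
  exact.
apply: (@fubini_tonelli _ _ _ _ R mu (@lebesgue_rV R n) F).
- rewrite (_ : F = (fun x => f (x + tau x *: delta_mx ord0 ord0)) \o @cons_rV R n).
    exact: (measurableT_comp mF (@measurable_cons_rV R n)).
  by apply/funext => -[t v] /=; rewrite cons_rV_add0 tau0.
- by move=> x; exact: f0.
Qed.

Lemma ge0_integral_prod_rV n (g : 'I_n -> R -> R) :
  (forall i, measurable_fun setT (g i)) -> (forall i x, 0 <= g i x) ->
  (\int[@lebesgue_rV R n]_x (\prod_i g i (x ord0 i))%:E =
   \prod_i \int[mu]_t (g i t)%:E)%E.
Proof.
elim: n => [|n IH] in g *.
  move=> _ _; rewrite big_ord0 (_ : (fun _ => _) = cst 1%:E); last first.
    by apply/funext => x; rewrite big_ord0.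
  by rewrite integral_cst// mul1e [LHS]diracT.
move=> mg g0.
have mG m (h : 'I_m -> R -> R) : (forall i, measurable_fun setT (h i)) ->
    measurable_fun setT (fun x : 'rV[R]_m => (\prod_i h i (x ord0 i))%:E).
  move=> mh; apply/measurable_EFinP; apply: measurable_prod => i _.
  exact: (measurableT_comp (mh i) (measurable_rV_coord i)).
rewrite ge0_integral_rVS; last 2 first.
- exact: mG.
- by move=> x; rewrite lee_fin prodr_ge0.
rewrite big_ord_recl -IH//.
transitivity (\int[mu]_t ((g ord0 t)%:E * \int[@lebesgue_rV R n]_v
    (\prod_i g (lift ord0 i) (v ord0 i))%:E)%E)%E.
  apply: eq_integral => t _; rewrite -ge0_integralZl//=.
  - apply: eq_integral => v _; rewrite big_ord_recl cons_rV_ord0 EFinM.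
    by congr (_ * _%:E)%E; apply: eq_bigr => i _; rewrite cons_rV_lift.
  - exact: (mG _ (fun i => g (lift ord0 i))).
  - by move=> x _; rewrite lee_fin prodr_ge0.
  - by rewrite lee_fin.
rewrite ge0_integralZr//.
- by apply/measurable_EFinP; exact: mg.
- by move=> x _; rewrite lee_fin.
- by apply: integral_ge0 => v _; rewrite lee_fin prodr_ge0.
Qed.

End rV.

(** * Open sets and continuous functions are measurable for the coordinate sigma-algebra *)

Section borel_rV.
Variables (R : realType) (n : nat).

(** The norm of ['rV[R]_n] is the sup norm, so its balls are boxes, that is finite intersections of
    coordinate preimages. An open set is the union of the countably many boxes with rational centre
    and radius that it contains. *)
Lemma open_measurable_rV (A : set 'rV[R]_n) : open A -> measurable A.
Proof.
move=> oA.
pose box (p : 'rV[rat]_n * rat) :=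
  [set x : 'rV[R]_n | forall i, `|x ord0 i - ratr (p.1 ord0 i)| < ratr p.2].
have mbox p : measurable (box p).
  have -> : box p = \bigcap_i (@rV_coord R n i @^-1`
      [set t : R | `|t - ratr (p.1 ord0 i)| < ratr p.2]).
    apply/seteqP; split => [x bx i _|x bx i]; first exact: bx.
    exact: (bx i I).
  apply: fin_bigcap_measurable => // i _.
  rewrite -[X in measurable X]setTI; apply: measurable_rV_coord => //.
  have -> : [set t : R | `|t - ratr (p.1 ord0 i)| < ratr p.2] =
      ball (ratr (p.1 ord0 i) : R) (ratr p.2).
    by apply/seteqP; split=> x; rewrite /ball/= distrC.
  exact: measurable_ball.
have -> : A = \bigcup_p (if asbool (box p `<=` A) then box p else set0).
  apply/seteqP; split => [x Ax|x [p _]]; last first.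
    by case: asboolP => // h; exact: h.
  have /nbhs_ballP[e /= e0 xeA] : nbhs x A by exact: open_nbhs_nbhs.
  (* A radius below e / 2 leaves room for the triangle inequality: a box of radius r that contains x
     lies in the ball of radius e around x. *)
  have [r] : exists r : rat, ratr r \in `]0, e / 2[%R by apply: rat_in_itvoo; rewrite divr_gt0.
  rewrite in_itv/= => /andP[r0 re].
  have q_ (i : 'I_n) : exists q : rat, `|x ord0 i - ratr q| < ratr r.
    have [q] : exists q : rat, ratr q \in `](x ord0 i - ratr r), (x ord0 i + ratr r)[%R.
      by apply: rat_in_itvoo; rewrite ltrD2l (lt_trans _ r0)// oppr_lt0.
    by rewrite in_itv/= => /andP[q1 q2]; exists q; rewrite distrC ltr_distl q1 q2.
  have {q_}[q qP] := choice q_.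
  exists (\row_i q i, r) => //; case: asboolP => [_ i|].
    by rewrite /= mxE; exact: qP.
  case => y ybox; apply: xeA; split => // i j.
  rewrite (ord1 i) /ball/=.
  have := ybox j; rewrite /= mxE => yj.
  rewrite (_ : x ord0 j - y ord0 j = (x ord0 j - ratr (q j)) - (y ord0 j - ratr (q j))); last first.
    by rewrite opprB addrA subrK.
  rewrite (le_lt_trans (ler_normB _ _))// (splitr e) ltrD//.
    by rewrite (lt_trans (qP j)).
  exact: lt_trans yj re.
apply: countable_bigcupT_measurable => // p.
by case: asboolP.
Qed.

Lemma continuous_measurable_fun_rV (U : set 'rV[R]_n) (u : 'rV[R]_n -> R) :
  open U -> (forall x, U x -> {for x, continuous u}) -> measurable_fun U u.
Proof.
move=> oU cu.
apply: (measurability _ (RGenOInfty.measurableE R)) => // _ [_ [a ->] <-].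
apply: open_measurable_rV; rewrite openE => x [Ux] /=; rewrite in_itv/= andbT => ax.
apply: filterI; first by apply: open_nbhs_nbhs; split.
apply: (cu x Ux); apply: open_nbhs_nbhs; split; last by rewrite /= in_itv/= ax.
exact: interval_open.
Qed.

End borel_rV.

Section mrestr.
Local Open Scope ereal_scope.
Context d (T : measurableType d) (R : realType) (m : {measure set T -> \bar R})
  (D : set T) (mD : measurable D).

Lemma ge0_integral_mrestr (f : T -> \bar R) :
  measurable_fun setT f -> (forall x, 0 <= f x) ->
  \int[mrestr m mD]_x f x = \int[m]_(x in D) f x.
Proof.
move=> mf f0; rewrite -(setUv D) ge0_integral_setU//; last 3 first.
- exact: measurableC.
- by rewrite setUv.
- exact/disj_setPCl.
rewrite [X in _ + X](_ : _ = 0) ?adde0; last first.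
  rewrite -(@integral_measure_zero _ T R (~` D) f).
  apply: eq_measure_integral => A mA AD; rewrite /mrestr/= /mrestr.
  by rewrite (_ : A `&` D = set0) ?measure0//; apply/disjoints_subset.
apply: eq_measure_integral => A mA AD /=; rewrite /mrestr setIidl//.
Qed.

End mrestr.

Section bounded_rV.
Variables (R : realType).

Lemma coord_le_enorm n (x : 'rV[R]_n) i : `|x ord0 i| <= enorm x.
Proof.
rewrite /enorm /dot -sqrtr_sqr ler_wsqrtr// (bigD1 i)//= -expr2 lerDl.
by apply: sumr_ge0 => k _; rewrite -expr2 sqr_ge0.
Qed.

Lemma enorm_ge0 n (x : 'rV[R]_n) : 0 <= enorm x. Proof. exact: sqrtr_ge0. Qed.

Lemma dot_ge0 n (x : 'rV[R]_n) : 0 <= dot x x.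
Proof. by apply: sumr_ge0 => i _; rewrite -expr2 sqr_ge0. Qed.

Lemma enorm_sqr n (x : 'rV[R]_n) : enorm x ^+ 2 = dot x x.
Proof. by rewrite sqr_sqrtr// dot_ge0. Qed.

Lemma unit_dir_sphere n (x : 'rV[R]_n) : sphere x -> unit_dir x = x.
Proof. by rewrite /sphere/= /unit_dir => ->; rewrite invr1 scale1r. Qed.

Lemma measurable_enorm_le n (r : R) : measurable [set x : 'rV[R]_n | enorm x <= r].
Proof.
rewrite (_ : mkset _ = @enorm R n @^-1` `]-oo, r]%classic); last first.
  by apply/seteqP; split=> x /=; rewrite in_itv.
by rewrite -[X in measurable X]setTI; exact: measurable_enorm.
Qed.

Lemma measurable_sphere n : measurable (@sphere R n).
Proof.
rewrite (_ : @sphere R n = @enorm R n @^-1` [set 1]); last by [].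
by rewrite -[X in measurable X]setTI; exact: measurable_enorm.
Qed.

Lemma measurable_punctured_ball n : measurable [set x : 'rV[R]_n | 0 < enorm x <= 1].
Proof.
rewrite (_ : mkset _ = @enorm R n @^-1` `]0, 1]%classic); last first.
  by apply/seteqP; split=> x /=; rewrite in_itv.
by rewrite -[X in measurable X]setTI; exact: measurable_enorm.
Qed.

Lemma lebesgue_rV_enorm_le_lty n (r : R) :
  (@lebesgue_rV R n [set x | (enorm x <= r)%R] < +oo)%E.
Proof.
pose A : set R := `[- r, r]%classic.
have mA : measurable A by exact: measurable_itv.
apply: (@le_lt_trans _ _ (\int[@lebesgue_rV R n]_x (\prod_(i < n) (\1_A (x ord0 i) : R))%:E)%E).
  have mE : measurable [set x : 'rV[R]_n | (enorm x <= r)%R] by exact: measurable_enorm_le.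
  rewrite -[X in (lebesgue_rV X <= _)%E]setIT -(@integral_indic _ _ _ (@lebesgue_rV R n))//.
  apply: ge0_le_integral => //.
  - by apply/measurable_EFinP; apply: measurable_indic; exact: measurable_enorm_le.
  - apply/measurable_EFinP; apply: measurable_prod => i _.
    by apply: (measurableT_comp _ (measurable_rV_coord i)); exact: measurable_indic.
  move=> x _; rewrite lee_fin [leLHS]indicE; case: (boolP (x \in _)); last first.
    by move=> _; rewrite prodr_ge0.
  rewrite inE/= => xr; rewrite big1// => i _; rewrite indicE mem_set//.
  by rewrite /A/= in_itv/= -ler_norml (le_trans (coord_le_enorm x i)).
rewrite (ge0_integral_prod_rV (g := fun _ t => \1_A t)) //; last by move=> i; exact: measurable_indic.
rewrite big_const; elim: #|_| => [|k IH]/=; first exact: ltry.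
apply: lte_mul_pinfty => //.
- exact: integral_ge0.
- rewrite integral_indic// setIT.
  by rewrite [X in X \is a _]lebesgue_measure_itv/=; case: ifP.
Qed.

End bounded_rV.

(** * Rotations in coordinate planes preserve Lebesgue measure *)

Section rotation.
Variables (R : realType) (n : nat).
Implicit Types (j k : 'I_n) (x : 'rV[R]_n).

Definition plane_rot j k (c s : R) x : 'rV[R]_n :=
  \row_i (if i == j then c * x ord0 j - s * x ord0 k
          else if i == k then s * x ord0 j + c * x ord0 k else x ord0 i).

Lemma ge0_integral_shear j k (t : R) (f : 'rV[R]_n -> \bar R) : j != k ->
  measurable_fun setT f -> (forall x, 0 <= f x)%E ->
  (\int[@lebesgue_rV R n]_x f (x + (t * x ord0 k) *: delta_mx ord0 j)%R =
   \int[@lebesgue_rV R n]_x f x)%E.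
Proof.
move=> jk mf f0.
apply: (@ge0_integral_addZ_rV R n j (fun x => t * x ord0 k)) => //.
  by apply: measurable_funM => //; exact: (measurable_rV_coord k).
by move=> x s; rewrite !mxE eqxx (eq_sym k) (negbTE jk) mulr0 addr0.
Qed.

Lemma measurable_shear j k (t : R) :
  measurable_fun setT (fun x : 'rV[R]_n => x + (t * x ord0 k) *: delta_mx ord0 j).
Proof.
apply: (@measurable_addZ_rV R n j (fun x => t * x ord0 k)).
by apply: measurable_funM => //; exact: (measurable_rV_coord k).
Qed.

(* A rotation is a product of three shears, each of which translates one coordinate by a function of another. *)
Lemma plane_rot_shear j k (c s : R) x : j != k -> c ^+ 2 + s ^+ 2 = 1 -> c != -1 ->
  plane_rot j k c s x =
  let y := x + (- (s / (1 + c)) * x ord0 k) *: delta_mx ord0 j in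
  let z := y + (s * y ord0 j) *: delta_mx ord0 k in
  z + (- (s / (1 + c)) * z ord0 k) *: delta_mx ord0 j.
Proof.
move=> jk cs1 c1; have c10 : 1 + c != 0 by rewrite addrC addr_eq0.
have s2 : s ^+ 2 = (1 + c) * (1 - c).
  by transitivity (1 - c ^+ 2); [rewrite -cs1 addrC addKr|ring].
(* For the angle theta this is - tan (theta / 2), the parameter of the first and third shears; it
   exists unless theta is a half turn, which is why c = -1 is excluded. Only small angles occur
   later. *)
set t := - (s / (1 + c)).
have ts : t * s = c - 1 by rewrite /t mulNr mulrAC -expr2 s2 mulrAC mulfV// mul1r opprB.
have tc : t * c = - s - t by rewrite /t; field.
apply/rowP => i; rewrite !mxE !eqxx (eq_sym k j) (negbTE jk) /=.
have [->|ij] := eqVneq i j; rewrite ?(negbTE jk)/= ?mulr1 ?mulr0 ?addr0.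
  transitivity ((1 + t * s) * x ord0 j + (t + t + t * (t * s)) * x ord0 k); last by ring.
  by rewrite ts mulrBr tc; ring.
have [->|ik] := eqVneq i k; rewrite ?mulr1 ?mulr0 ?addr0//.
transitivity (s * x ord0 j + (1 + t * s) * x ord0 k); last by ring.
by rewrite ts; ring.
Qed.

Lemma measurable_plane_rot j k c s : measurable_fun setT (plane_rot j k c s).
Proof.
apply: measurable_fun_rVP => i.
have mc l : measurable_fun setT (fun x : 'rV[R]_n => x ord0 l) by exact: measurable_rV_coord.
rewrite (_ : _ \o _ = fun x => if i == j then c * x ord0 j - s * x ord0 k
          else if i == k then s * x ord0 j + c * x ord0 k else x ord0 i); last first.
  by apply/funext => x; rewrite /rV_coord /= mxE.
case: (i == j); last case: (i == k); last exact: mc.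
  by apply: measurable_funB; exact: measurable_funM.
by apply: measurable_funD; exact: measurable_funM.
Qed.

Lemma ge0_integral_plane_rot j k c s (f : 'rV[R]_n -> \bar R) :
  j != k -> c ^+ 2 + s ^+ 2 = 1 -> c != -1 ->
  measurable_fun setT f -> (forall x, 0 <= f x)%E ->
  (\int[@lebesgue_rV R n]_x f (plane_rot j k c s x) =
   \int[@lebesgue_rV R n]_x f x)%E.
Proof.
move=> jk cs1 c1 mf f0; have kj : k != j by rewrite eq_sym.
under eq_integral do rewrite plane_rot_shear//.
set t := - (s / (1 + c)).
rewrite -[RHS](@ge0_integral_shear j k t)//.
pose f1 x := f (x + (t * x ord0 k) *: delta_mx ord0 j).
have mf1 : measurable_fun setT f1 by exact: (measurableT_comp mf (measurable_shear j k t)).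
rewrite -[RHS](@ge0_integral_shear k j s f1)//; last by move=> x; exact: f0.
pose f2 x := f1 (x + (s * x ord0 j) *: delta_mx ord0 k).
have mf2 : measurable_fun setT f2 by exact: (measurableT_comp mf1 (measurable_shear k j s)).
by rewrite -[RHS](@ge0_integral_shear j k t f2)//; move=> x; exact: f0.
Qed.

Lemma dot_plane_rot j k c s x : j != k -> c ^+ 2 + s ^+ 2 = 1 ->
  dot (plane_rot j k c s x) (plane_rot j k c s x) = dot x x.
Proof.
move=> jk cs1; have kj : k != j by rewrite eq_sym.
rewrite /dot (bigD1 j)//= (bigD1 k)//= [RHS](bigD1 j)//= [in RHS](bigD1 k)//=.
rewrite !addrA; congr (_ + _); last first.
  by apply: eq_bigr => i /andP[/negbTE ij /negbTE ik]; rewrite !mxE ij ik.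
rewrite !mxE !eqxx (negbTE kj).
set a := x ord0 j; set b := x ord0 k.
transitivity ((c ^+ 2 + s ^+ 2) * (a * a + b * b)); last by rewrite cs1 mul1r.
ring.
Qed.

Lemma enorm_plane_rot j k c s x : j != k -> c ^+ 2 + s ^+ 2 = 1 ->
  enorm (plane_rot j k c s x) = enorm x.
Proof. by move=> jk cs1; rewrite /enorm dot_plane_rot. Qed.

Lemma plane_rotZ j k c s a x : plane_rot j k c s (a *: x) = a *: plane_rot j k c s x.
Proof.
apply/rowP => i; rewrite !mxE; case: ifP => _; last case: ifP => _ //.
  by ring.
by ring.
Qed.

Lemma unit_dir_plane_rot j k c s x : j != k -> c ^+ 2 + s ^+ 2 = 1 ->
  unit_dir (plane_rot j k c s x) = plane_rot j k c s (unit_dir x).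
Proof. by move=> jk cs1; rewrite /unit_dir enorm_plane_rot// plane_rotZ. Qed.

Lemma sphere_plane_rot j k c s x : j != k -> c ^+ 2 + s ^+ 2 = 1 ->
  sphere x -> sphere (plane_rot j k c s x).
Proof. by rewrite /sphere/= => jk cs1; rewrite enorm_plane_rot. Qed.

End rotation.

(** * The surface measure: polar formula, finiteness and rotation invariance *)

Section surface.
Variables (R : realType) (n : nat).
Local Notation sigma := (@surface_measure R n).
Local Notation leb := (@lebesgue_rV R n).

Lemma ge0_integral_surface (f : 'rV[R]_n -> \bar R) :
  measurable_fun setT f -> (forall x, 0 <= f x)%E ->
  (\int[sigma]_x f x = n%:R%:E *
    \int[leb]_(x in [set x | (0 < enorm x <= 1)%R]) f (unit_dir x))%E.
Proof.
move=> mf f0.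
pose m1 : {measure set 'rV[R]_n -> \bar R} := mrestr leb (@measurable_punctured_ball R n).
pose m2 : {measure set 'rV[R]_n -> \bar R} := pushforward m1 (@unit_dir R n).
transitivity (\int[mscale (NngNum (ler0n R n)) (m2 (@measurable_unit_dir R n))]_x f x)%E.
  apply: eq_measure_integral => A mA _.
  rewrite /= /surface_measure /mscale /= /pushforward /mrestr.
  by congr (_ * lebesgue_rV _)%E; apply/seteqP; split=> x [].
rewrite ge0_integral_mscale//; congr (_ * _)%E.
rewrite ge0_integral_pushforward//; last exact: measurable_unit_dir.
rewrite preimage_setT ge0_integral_mrestr//; last by move=> x; exact: f0.
exact: (measurableT_comp mf (@measurable_unit_dir R n)).
Qed.

Lemma surface_measure_fin : fin_num_fun sigma.
Proof.
move=> A mA; rewrite ge0_fin_numE ?measure_ge0//.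
rewrite /surface_measure lte_mul_pinfty//.
apply: le_lt_trans (lebesgue_rV_enorm_le_lty n 1).
apply: le_measure; rewrite ?inE.
- rewrite (_ : [set x | _] = [set x | (0 < enorm x <= 1)%R] `&` (@unit_dir R n @^-1` A)); last by [].
  apply: measurableI; first exact: measurable_punctured_ball.
  by rewrite -[X in measurable X]setTI; exact: measurable_unit_dir.
- exact: measurable_enorm_le.
- by move=> x [/andP[]].
Qed.

HB.instance Definition _ := @Measure_isFinite.Build _ _ _ sigma surface_measure_fin.

(** Invariance passes from Lebesgue measure to the surface measure through the polar formula, since
    rotations commute with [unit_dir] and preserve the punctured ball. *)
Lemma ge0_integral_surface_rot j k c s (f : 'rV[R]_n -> \bar R) :
  j != k -> c ^+ 2 + s ^+ 2 = 1 -> c != -1 ->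
  measurable_fun setT f -> (forall x, 0 <= f x)%E ->
  (\int[sigma]_x f (plane_rot j k c s x) = \int[sigma]_x f x)%E.
Proof.
move=> jk cs1 c1 mf f0.
rewrite !ge0_integral_surface//; last first.
  exact: (measurableT_comp mf (measurable_plane_rot j k c s)).
congr (_ * _)%E; rewrite integral_mkcond [RHS]integral_mkcond.
have mB := @measurable_punctured_ball R n.
rewrite -[RHS](@ge0_integral_plane_rot _ _ j k c s)//; last 2 first.
- apply/(measurable_restrictT _ _).1 => //; apply: measurable_funTS.
  exact: (measurableT_comp mf (@measurable_unit_dir R n)).
- by move=> x; rewrite patchE; case: ifP.
apply: eq_integral => x _; rewrite !patchE unit_dir_plane_rot//.
rewrite (_ : (plane_rot j k c s x \in [set x | 0 < enorm x <= 1]) =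
  (x \in [set x | 0 < enorm x <= 1]))//.
by apply/idP/idP; rewrite !inE/= enorm_plane_rot.
Qed.

End surface.

Section rotation_calculus.
Variables (R : realType) (n : nat).
Implicit Types (j k : 'I_n) (x : 'rV[R]_n).
Local Notation S := (@sphere R n).
Local Notation sigma := (@surface_measure R n).

Lemma ge0_integral_sphere_rot j k c s (f : 'rV[R]_n -> \bar R) :
  j != k -> c ^+ 2 + s ^+ 2 = 1 -> c != -1 ->
  measurable_fun S f -> (forall x, 0 <= f x)%E ->
  (\int[sigma]_(x in S) f (plane_rot j k c s x) = \int[sigma]_(x in S) f x)%E.
Proof.
move=> jk cs1 c1 mf f0; rewrite integral_mkcond [RHS]integral_mkcond.
rewrite -[RHS](@ge0_integral_surface_rot _ _ j k c s)//; last 2 first.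
- by apply/(measurable_restrictT _ _).1 => //; exact: measurable_sphere.
- by move=> x; rewrite patchE; case: ifP.
apply: eq_integral => x _; rewrite !patchE.
rewrite (_ : (plane_rot j k c s x \in S) = (x \in S))//.
by apply/idP/idP; rewrite !inE/= /sphere/= enorm_plane_rot.
Qed.

Lemma integral_sphere_rot j k c s (u : 'rV[R]_n -> R) :
  j != k -> c ^+ 2 + s ^+ 2 = 1 -> c != -1 -> measurable_fun S u ->
  (\int[sigma]_(x in S) (u (plane_rot j k c s x))%:E =
   \int[sigma]_(x in S) (u x)%:E)%E.
Proof.
move=> jk cs1 c1 mu.
have mu' : measurable_fun S (EFin \o u) by exact/measurable_EFinP.
rewrite integralE [RHS]integralE.
rewrite -(@ge0_integral_sphere_rot j k c s (EFin \o u)^\+%E)//; last first.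
  exact: measurable_funepos.
rewrite -(@ge0_integral_sphere_rot j k c s (EFin \o u)^\-%E)//; last first.
  exact: measurable_funeneg.
have pc := @funepos_comp _ _ R (EFin \o u) (plane_rot j k c s).
have nc := @funeneg_comp _ _ R (EFin \o u) (plane_rot j k c s).
by congr (_ - _)%E; apply: eq_integral => x _; [exact: (congr1 (fun f => f x) pc)|exact: (congr1 (fun f => f x) nc)].
Qed.

Definition arot j k (t : R) := plane_rot j k (cos t) (sin t).

Lemma arotD j k a b x : j != k -> arot j k (a + b) x = arot j k a (arot j k b x).
Proof.
move=> jk; have kj : k != j by rewrite eq_sym.
apply/rowP => i; rewrite !mxE !eqxx (negbTE kj) cosD sinD.
have [_|ij] := eqVneq i j; first by ring.
have [_|ik] := eqVneq i k; first by ring.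
by [].
Qed.

Lemma arot0 j k x : arot j k 0 x = x.
Proof.
apply/rowP => i; rewrite !mxE cos0 sin0.
have [->|ij] := eqVneq i j; first by ring.
have [->|ik] := eqVneq i k; first by ring.
by [].
Qed.

Lemma sphere_arot j k t x : j != k -> S x -> S (arot j k t x).
Proof. by move=> jk; apply: sphere_plane_rot => //; exact: cos2Dsin2. Qed.

Lemma measurable_sphere_arot j k t : j != k -> measurable_fun S (arot j k t).
Proof. by move=> jk; apply: measurable_funTS; exact: measurable_plane_rot. Qed.

Lemma measurable_comp_arot j k t (u : 'rV[R]_n -> R) : j != k ->
  measurable_fun S u -> measurable_fun S (fun x => u (arot j k t x)).
Proof.
move=> jk mu; apply: (measurable_comp _ _ mu (measurable_sphere_arot t jk)).
- exact: measurable_sphere.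
- by move=> _ [x Sx <-]; exact: sphere_arot.
Qed.

Lemma is_derive_shift (f : R -> R) (a l : R) :
  is_derive (0 : R) 1 (fun h => f (h + a)) l -> is_derive a 1 f l.
Proof.
move=> [d0 dE].
have E : (fun h : R => h^-1 *: ((f \o shift a) (h *: 1) - f a)) =
   (fun h : R => h^-1 *: (((fun h => f (h + a)) \o shift 0) (h *: 1) - f (0 + a))).
  by apply/funext => h /=; rewrite addr0 add0r.
by split; [rewrite /derivable E|rewrite /derive E].
Qed.

(** The rotations of one plane form a one-parameter group, so differentiability at angle 0 from
    every point of the sphere gives differentiability at every angle. This is what the mean value
    theorem needs along an orbit. *)
Lemma is_derive_arot j k (u L : 'rV[R]_n -> R) : j != k ->
  (forall x, S x -> is_derive (0 : R) 1 (fun t => u (arot j k t x)) (L x)) ->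
  forall x (a : R), S x -> is_derive a 1 (fun t => u (arot j k t x)) (L (arot j k a x)).
Proof.
move=> jk uL x a Sx; apply: is_derive_shift.
under eq_fun do rewrite arotD//.
exact/uL/sphere_arot.
Qed.

Lemma integrable_sphere (u : 'rV[R]_n -> R) (B : R) : measurable_fun S u ->
  (forall x, S x -> `|u x| <= B) -> sigma.-integrable S (EFin \o u).
Proof.
move=> mu uB; apply: measurable_bounded_integrable => //.
- exact: measurable_sphere.
- rewrite -ge0_fin_numE ?measure_ge0//; apply: surface_measure_fin.
  exact: measurable_sphere.
- exists B; split; first exact: num_real.
  by move=> M BM x Sx /=; rewrite (le_trans (uB x Sx))// ltW.
Qed.

(** Each difference quotient of [u] along the rotation integrates to zero by invariance. The mean
    value theorem bounds all of them by the bound [B] of the derivative, which is the dominating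
    constant. *)
Lemma Rintegral_arot_derive0 j k (u L : 'rV[R]_n -> R) (A B : R) : j != k ->
  measurable_fun S u -> (forall x, S x -> `|u x| <= A) ->
  measurable_fun S L -> (forall x, S x -> `|L x| <= B) ->
  (forall x, S x -> is_derive (0 : R) 1 (fun t => u (arot j k t x)) (L x)) ->
  \int[sigma]_(x in S) L x = 0.
Proof.
move=> jk mu uA mL LB uL.
have mS := @measurable_sphere R n.
(* Angles below 1 <= pi / 2 have positive cosine, so the condition c != -1 of the invariance lemma
   holds. *)
pose h (m : nat) : R := (m.+2%:R)^-1.
have h0 m : 0 < h m by rewrite invr_gt0.
have h1 m : h m < 1 by rewrite invf_lt1// ltr1n.
pose q m x : R := (h m)^-1 * (u (arot j k (h m) x) - u x).
have mq m : measurable_fun S (EFin \o q m).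
  apply/measurable_EFinP; apply: measurable_funM => //.
  by apply: measurable_funB => //; exact: measurable_comp_arot.
have uqB m x : S x -> (`|(q m x)%:E| <= B%:E)%E.
  move=> Sx; rewrite lee_fin.
  have := @MVT_segment R (fun t => u (arot j k t x)) (fun t => L (arot j k t x)) 0 (h m) (ltW (h0 m)).
  case.
  - by move=> t _; exact: is_derive_arot.
  - apply: continuous_subspaceT => t.
    apply: differentiable_continuous; apply/derivable1_diffP.
    by have [] := @is_derive_arot j k u L jk uL x t Sx.
  - move=> t _; rewrite arot0 subr0 /q => ->.
    rewrite mulrCA mulVf ?gt_eqF// mulr1; apply: LB; exact: sphere_arot.
have qL x : S x -> (q m x)%:E @[m --> \oo] --> (L x)%:E.
  move=> Sx; apply: cvg_EFin; first exact: nearW.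
  have [d0 dE] := uL x Sx.
  have /= c0 : ((fun t : R => t^-1 *:
      (((fun t => u (arot j k t x)) \o shift 0) (t *: 1) - u (arot j k 0 x))) @ 0^') --> L x.
    by rewrite -dE; exact: d0.
  have hc : h m @[m --> \oo] --> 0 by rewrite (cvg_shiftS (@harmonic R)); exact: cvg_harmonic.
  have hn0 m : h m != 0 by rewrite gt_eqF.
  have ch := (@cvgr_dnbhsP R _ _ (L x)).1 c0 h (conj hn0 hc).
  apply: cvg_trans ch.
  apply: near_eq_cvg; apply: nearW => m /=.
  by rewrite /q arot0 addr0 /GRing.scale/= mulr1.
have intq m : sigma.-integrable S (EFin \o q m).
  apply: (@integrable_sphere _ B); first exact/measurable_EFinP.
  by move=> x Sx; rewrite -lee_fin; exact: uqB.
have q0 m : (\int[sigma]_(x in S) (q m x)%:E = 0)%E.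
  have iu : sigma.-integrable S (EFin \o u) by exact: integrable_sphere uA.
  have iur : sigma.-integrable S (EFin \o (fun x => u (arot j k (h m) x))).
    apply: (@integrable_sphere _ A); first exact: measurable_comp_arot.
    by move=> x Sx; apply: uA; exact: sphere_arot.
  under eq_integral do rewrite EFinM.
  have iB := integrableB mS iur iu.
  rewrite (@integralZl _ _ _ sigma S mS (fun x => (u (arot j k (h m) x) - u x)%:E) iB).
  under eq_integral do rewrite EFinB.
  rewrite integralB_EFin// integral_sphere_rot//.
  - by rewrite subee ?mule0// integral_fune_fin_num.
  - exact: cos2Dsin2.
  - have : 0 < cos (h m).
      apply: cos_gt0_pihalf; rewrite (lt_le_trans (h1 m) (@pihalf_ge1 R)) andbT.
      by rewrite (lt_trans _ (h0 m))// oppr_lt0 (lt_le_trans ltr01 (@pihalf_ge1 R)).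
    by apply: contraTN => /eqP ->; rewrite -leNgt oppr_le0.
have qc : (\int[sigma]_(x in S) (q m x)%:E)%E @[m --> \oo] --> (\int[sigma]_(x in S) (L x)%:E)%E.
  apply: (@dominated_cvg _ _ _ sigma S mS (fun m => EFin \o q m) (EFin \o L) (cst B%:E)) => //.
  by apply: (@integrable_sphere (cst B) `|B|); [exact: measurable_cst|move=> x _].
have qc0 : (fun=> 0%E) @ \oo --> (\int[sigma]_(x in S) (L x)%:E)%E.
  by apply: cvg_trans qc; apply: near_eq_cvg; apply: nearW => m; rewrite q0.
rewrite /Rintegral -(cvg_lim _ qc0)//.
by rewrite lim_cst.
Qed.

End rotation_calculus.

(** * Complex-valued integration and differentiation *)

Section complex_facts.
Variable R : realType.
Local Notation C := R[i].
Implicit Types z : C.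

Lemma ReM (z1 z2 : C) : complex.Re (z1 * z2) = complex.Re z1 * complex.Re z2 - complex.Im z1 * complex.Im z2.
Proof. by case: z1; case: z2. Qed.

Lemma ImM (z1 z2 : C) : complex.Im (z1 * z2) = complex.Re z1 * complex.Im z2 + complex.Im z1 * complex.Re z2.
Proof. by case: z1; case: z2. Qed.

Lemma ReD (z1 z2 : C) : complex.Re (z1 + z2) = complex.Re z1 + complex.Re z2.
Proof. by case: z1; case: z2. Qed.

Lemma ImD (z1 z2 : C) : complex.Im (z1 + z2) = complex.Im z1 + complex.Im z2.
Proof. by case: z1; case: z2. Qed.

Lemma ReN z : complex.Re (- z) = - complex.Re z. Proof. by case: z. Qed.
Lemma ImN z : complex.Im (- z) = - complex.Im z. Proof. by case: z. Qed.

Lemma complex_eqP (z1 z2 : C) : complex.Re z1 = complex.Re z2 -> complex.Im z1 = complex.Im z2 -> z1 = z2.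
Proof. by case: z1; case: z2 => /= ? ? ? ? -> ->. Qed.

Lemma sqr_normcE z : normc z ^+ 2 = complex.Re z ^+ 2 + complex.Im z ^+ 2.
Proof. by case: z => a b /=; rewrite sqr_sqrtr// addr_ge0// sqr_ge0. Qed.

Lemma normc_ge0 z : 0 <= normc z.
Proof. by case: z => a b; exact: sqrtr_ge0. Qed.

Lemma normr_Re z : `|complex.Re z| <= normc z.
Proof. by case: z => a b /=; rewrite -sqrtr_sqr ler_wsqrtr// lerDl sqr_ge0. Qed.

Lemma normr_Im z : `|complex.Im z| <= normc z.
Proof. by case: z => a b /=; rewrite -sqrtr_sqr ler_wsqrtr// lerDr sqr_ge0. Qed.

Lemma normc_le_ReIm z : normc z <= `|complex.Re z| + `|complex.Im z|.
Proof.
rewrite -(@ler_pXn2r _ 2)// ?nnegrE ?normc_ge0 ?addr_ge0//.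
rewrite sqr_normcE sqrrD !real_normK ?num_real// lerD2r lerDl.
by rewrite mulrn_wge0// mulr_ge0.
Qed.

Lemma normcJ z : normc z^*%C = normc z.
Proof. by case: z => a b /=; rewrite sqrrN. Qed.

Lemma normcR (a : R) : normc a%:C = `|a|.
Proof. by rewrite /= expr0n/= addr0 sqrtr_sqr. Qed.

Lemma normc_nat k : normc (k%:R : C) = k%:R.
Proof. by rewrite -(rmorph_nat (real_complex R)) normcR ger0_norm. Qed.

Lemma le_normc_sum (I : Type) (r : seq I) (P : pred I) (F : I -> C) :
  normc (\sum_(i <- r | P i) F i) <= \sum_(i <- r | P i) normc (F i).
Proof.
elim/big_rec2: _ => [|i y z _ h]; first by rewrite normc0.
by rewrite (le_trans (le_normcD _ _))// lerD2l.
Qed.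

Lemma mulcJE z : z * z^*%C = (normc z ^+ 2)%:C.
Proof. by rewrite sqr_normcE; case: z => a b; apply: complex_eqP => /=; ring. Qed.

Lemma cexpD (z1 z2 : C) : cexp (z1 + z2) = cexp z1 * cexp z2.
Proof.
rewrite /cexp ReD ImD expRD cosD sinD.
by apply: complex_eqP; rewrite ?(ReM, ImM)/=; ring.
Qed.

Lemma cexpJ z : (cexp z)^*%C = cexp z^*%C.
Proof. by case: z => a b; rewrite /cexp/= cosN sinN; apply: complex_eqP => /=; ring. Qed.

Lemma normc_cexp z : normc (cexp z) = expR (complex.Re z).
Proof.
rewrite /cexp normcM normcR ger0_norm ?expR_ge0//=.
by rewrite cos2Dsin2 sqrtr1 mulr1.
Qed.

End complex_facts.

Section cmeasurable.
Context d (T : measurableType d) (R : realType).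
Variable D : set T.
Local Notation C := R[i].
Implicit Types f g : T -> C.
Local Notation cm := (cmeasurable_fun D).

Lemma cmeasurable_funM f g : cm f -> cm g -> cm (fun x => f x * g x).
Proof.
move=> [f1 f2] [g1 g2]; split.
  under eq_fun do rewrite ReM.
  by apply: measurable_funB; exact: measurable_funM.
under eq_fun do rewrite ImM.
by apply: measurable_funD; exact: measurable_funM.
Qed.

Lemma cmeasurable_funD f g : cm f -> cm g -> cm (fun x => f x + g x).
Proof.
move=> [f1 f2] [g1 g2]; split.
  by under eq_fun do rewrite ReD; exact: measurable_funD.
by under eq_fun do rewrite ImD; exact: measurable_funD.
Qed.

Lemma cmeasurable_cst (c : C) : cm (fun=> c).
Proof. by split; exact: measurable_cst. Qed.

Lemma cmeasurable_funN f : cm f -> cm (fun x => - f x).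
Proof.
move=> [f1 f2]; split.
  by under eq_fun do rewrite ReN; exact: (measurableT_comp (@oppr_measurable _ _)).
by under eq_fun do rewrite ImN; exact: (measurableT_comp (@oppr_measurable _ _)).
Qed.

Lemma cmeasurable_funJ f : cm f -> cm (fun x => (f x)^*%C).
Proof.
move=> [f1 f2]; split.
  by rewrite (_ : (fun _ => _) = fun x => complex.Re (f x))//; apply/funext => x; case: (f x).
rewrite (_ : (fun _ => _) = fun x => - complex.Im (f x)); last by apply/funext => x; case: (f x).
exact: (measurableT_comp (@oppr_measurable _ _)).
Qed.

Lemma cmeasurable_funR (u : T -> R) : measurable_fun D u -> cm (fun x => (u x)%:C).
Proof. by move=> mu; split => //=; exact: measurable_cst. Qed.

Lemma cmeasurable_cexp f : cm f -> cm (fun x => cexp (f x)).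
Proof.
move=> [f1 f2]; apply: cmeasurable_funM.
  by apply: cmeasurable_funR; apply: measurableT_comp f1; exact: measurable_expR.
split => /=; apply: measurableT_comp f2 => //; apply: continuous_measurable_fun.
  exact: continuous_cos.
exact: continuous_sin.
Qed.

End cmeasurable.

Section cintegral_theory.
Context d (T : measurableType d) (R : realType).
Variable mu : {measure set T -> \bar R}.
Variable D : set T.
Hypothesis mD : measurable D.
Local Notation C := R[i].
Implicit Types f g : T -> C.
Local Notation ci := (cintegrable mu D).

Lemma eq_cintegral f g : (forall x, D x -> f x = g x) -> cintegral mu D f = cintegral mu D g.
Proof.
move=> fg; rewrite /cintegral; congr (_ +i* _); apply: eq_Rintegral => x; rewrite inE => Dx; by rewrite fg.
Qed.

Lemma cintegrableD f g : ci f -> ci g -> ci (fun x => f x + g x).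
Proof.
move=> [f1 f2] [g1 g2]; split.
  by apply: eq_integrable (integrableD mD f1 g1) => // x _; rewrite /= ReD.
by apply: eq_integrable (integrableD mD f2 g2) => // x _; rewrite /= ImD.
Qed.

Lemma cintegralD f g : ci f -> ci g ->
  cintegral mu D (fun x => f x + g x) = cintegral mu D f + cintegral mu D g.
Proof.
move=> [f1 f2] [g1 g2]; rewrite /cintegral; apply: complex_eqP => /=.
  by rewrite -RintegralD//; apply: eq_Rintegral => x _; rewrite ReD.
by rewrite -RintegralD//; apply: eq_Rintegral => x _; rewrite ImD.
Qed.

Lemma cintegralZ (c : C) f : ci f -> cintegral mu D (fun x => c * f x) = c * cintegral mu D f.
Proof.
move=> [f1 f2]; rewrite /cintegral; apply: complex_eqP.
  rewrite ReM/= -!RintegralZl// -RintegralB//.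
  - by apply: eq_Rintegral => x _; rewrite ReM.
  - exact: (integrableZl mD (complex.Re c) f1).
  - exact: (integrableZl mD (complex.Im c) f2).
rewrite ImM/= -!RintegralZl// -RintegralD//.
- by apply: eq_Rintegral => x _; rewrite ImM.
- exact: (integrableZl mD (complex.Re c) f2).
- exact: (integrableZl mD (complex.Im c) f1).
Qed.

Lemma cintegrable_sum (I : Type) (r : seq I) (F : I -> T -> C) :
  (forall i, ci (F i)) -> ci (fun x => \sum_(i <- r) F i x).
Proof.
move=> mF; elim: r => [|i r IH].
  by under eq_fun do rewrite big_nil; split; exact: integrable0.
under eq_fun do rewrite big_cons; exact: cintegrableD.
Qed.

Lemma cintegral_sum (I : Type) (r : seq I) (F : I -> T -> C) :
  (forall i, ci (F i)) ->
  cintegral mu D (fun x => \sum_(i <- r) F i x) = \sum_(i <- r) cintegral mu D (F i).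
Proof.
move=> mF; elim: r => [|i r IH].
  under eq_fun do rewrite big_nil; rewrite big_nil /cintegral /=.
  by rewrite /Rintegral integral0.
under eq_fun do rewrite big_cons; rewrite big_cons cintegralD// ?IH//.
exact: cintegrable_sum.
Qed.

Lemma cintegrable_le f (h : T -> R) : cmeasurable_fun D f ->
  (forall x, D x -> normc (f x) <= h x) -> mu.-integrable D (EFin \o h) -> ci f.
Proof.
move=> [f1 f2] fh ih; split; apply: (le_integrable mD _ _ ih).
- exact/measurable_EFinP.
- move=> x Dx; rewrite /= lee_fin (le_trans (normr_Re _))//.
  by rewrite (le_trans (fh x Dx))// ler_norm.
- exact/measurable_EFinP.
- move=> x Dx; rewrite /= lee_fin (le_trans (normr_Im _))//.
  by rewrite (le_trans (fh x Dx))// ler_norm.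
Qed.

(** The factor 2 is the price of estimating the real and imaginary parts separately, since the
    complex integral is defined componentwise. *)
Lemma normc_cintegral_le f (h : T -> R) : ci f -> mu.-integrable D (EFin \o h) ->
  (forall x, D x -> normc (f x) <= h x) ->
  normc (cintegral mu D f) <= 2 * \int[mu]_(x in D) h x.
Proof.
move=> [f1 f2] ih fh; rewrite (le_trans (normc_le_ReIm _))// mulr_natl mulr2n.
apply: lerD; (apply: le_trans; first exact: le_normr_Rintegral).
  apply: le_Rintegral => //; first exact: integrable_norm.
  by move=> x Dx; rewrite (le_trans (normr_Re _))// fh.
apply: le_Rintegral => //; first exact: integrable_norm.
by move=> x Dx; rewrite (le_trans (normr_Im _))// fh.
Qed.

End cintegral_theory.

Section cderive.
Variable R : realType.
Local Notation C := R[i].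
Implicit Types f g : R -> C.

Definition is_cderive (a : R) f (l : C) :=
  is_derive a 1 (fun t => complex.Re (f t)) (complex.Re l) /\
  is_derive a 1 (fun t => complex.Im (f t)) (complex.Im l).

Lemma is_derive_to (a : R) (u : R -> R) (l l' : R) :
  is_derive a (1 : R) u l -> l = l' -> is_derive a (1 : R) u l'.
Proof. by move=> ? <-. Qed.

Lemma is_cderive_eq a f l l' : is_cderive a f l -> l = l' -> is_cderive a f l'.
Proof. by move=> ? <-. Qed.

Lemma is_cderiveD a f g l m : is_cderive a f l -> is_cderive a g m ->
  is_cderive a (fun t => f t + g t) (l + m).
Proof.
move=> [f1 f2] [g1 g2]; split; rewrite ?ReD ?ImD.
  by under eq_fun do rewrite ReD; exact: is_deriveD.
by under eq_fun do rewrite ImD; exact: is_deriveD.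
Qed.

Lemma is_cderiveM a f g l m : is_cderive a f l -> is_cderive a g m ->
  is_cderive a (fun t => f t * g t) (f a * m + l * g a).
Proof.
move=> [f1 f2] [g1 g2]; split.
  under eq_fun do rewrite ReM.
  apply: (is_derive_to (is_deriveB (is_deriveM f1 g1) (is_deriveM f2 g2))).
  by rewrite /GRing.scale/= ReD !ReM; ring.
under eq_fun do rewrite ImM.
apply: (is_derive_to (is_deriveD (is_deriveM f1 g2) (is_deriveM f2 g1))).
by rewrite /GRing.scale/= ImD !ImM; ring.
Qed.

Lemma is_cderive_cst a (c : C) : is_cderive a (fun=> c) 0.
Proof. by split; exact: is_derive_cst. Qed.

Lemma is_cderiveJ a f l : is_cderive a f l -> is_cderive a (fun t => (f t)^*%C) l^*%C.
Proof.
move=> [f1 f2]; split.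
  rewrite (_ : (fun _ => _) = fun t => complex.Re (f t)); last by apply/funext => t; case: (f t).
  by apply: (is_derive_to f1); case: (l).
rewrite (_ : (fun _ => _) = (fun t => - complex.Im (f t))); last by apply/funext => t; case: (f t).
apply: (is_derive_to (is_deriveN f2)).
by case: (l).
Qed.

Lemma is_cderiveR a (u : R -> R) (l : R) : is_derive a (1 : R) u l ->
  is_cderive a (fun t => (u t)%:C) l%:C.
Proof. by move=> ul; split => //=; exact: is_derive_cst. Qed.

Lemma is_cderive_cexp a f l : is_cderive a f l ->
  is_cderive a (fun t => cexp (f t)) (cexp (f a) * l).
Proof.
move=> [f1 f2].
have h1 : is_derive a 1 (expR \o (fun t => complex.Re (f t))) (expR (complex.Re (f a)) * complex.Re l).
  exact: (is_derive1_comp (is_derive_expR _) f1).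
have h2 : is_derive a 1 (cos \o (fun t => complex.Im (f t))) (- sin (complex.Im (f a)) * complex.Im l).
  exact: (is_derive1_comp (is_derive_cos _) f2).
have h3 : is_derive a 1 (sin \o (fun t => complex.Im (f t))) (cos (complex.Im (f a)) * complex.Im l).
  exact: (is_derive1_comp (is_derive_sin _) f2).
have h4 : is_cderive a (fun t => cos (complex.Im (f t)) +i* sin (complex.Im (f t)))
  ((- sin (complex.Im (f a)) * complex.Im l) +i* (cos (complex.Im (f a)) * complex.Im l)).
  by split.
apply: is_cderive_eq; first exact: (is_cderiveM (is_cderiveR h1) h4).
by rewrite /cexp; apply: complex_eqP; rewrite ?(ReD, ImD, ReM, ImM)/=; ring.
Qed.

Lemma is_cderive_Rinv a (u : R -> R) (l : C) : 0 < u a ->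
  is_cderive a (fun t => (u t)%:C) l -> is_cderive a (fun t => ((u t)^-1)%:C) (- (((u a)^-1) ^+ 2)%:C * l).
Proof.
move=> u0 [/= f1 f2].
have l2 : complex.Im l = 0.
  by have := @derive_val _ _ _ _ _ _ _ f2; rewrite derive_cst.
split => /=.
  apply: (is_derive_to (is_deriveV _ f1)); first by rewrite gt_eqF.
  by rewrite ReM ReN ImN /= exprVn oppr0 mul0r subr0 /GRing.scale/= mulNr.
apply: (is_derive_to (is_derive_cst _ _ _)).
by rewrite ImM ImN l2 /= oppr0 mulr0 mul0r addr0.
Qed.

End cderive.

(** * Tangential derivatives and integration by parts on the sphere *)

Section sgrad.
Variables (R : realType) (n : nat).
Local Notation C := R[i].
Local Notation S := (@sphere R n).
Local Notation sigma := (@surface_measure R n).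
Implicit Types (f g : 'rV[R]_n -> C) (G H : 'I_n -> 'rV[R]_n -> C).

(** [bmf] abbreviates bounded measurable function. The sphere has finite measure, so integrability
    follows from it, and the class is closed under all operations used below. *)
Definition bmf f := cmeasurable_fun S f /\ exists B : R, forall x, S x -> normc (f x) <= B.

Lemma bmfM f g : bmf f -> bmf g -> bmf (fun x => f x * g x).
Proof.
move=> [mf [A fA]] [mg [B gB]]; split; first exact: cmeasurable_funM.
exists (A * B) => x Sx; rewrite normcM ler_pM ?normc_ge0//; [exact: fA|exact: gB].
Qed.

Lemma bmfD f g : bmf f -> bmf g -> bmf (fun x => f x + g x).
Proof.
move=> [mf [A fA]] [mg [B gB]]; split; first exact: cmeasurable_funD.
exists (A + B) => x Sx; rewrite (le_trans (le_normcD _ _))// lerD//; [exact: fA|exact: gB].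
Qed.

Lemma bmf_cst (c : C) : bmf (fun=> c).
Proof. by split; [exact: cmeasurable_cst|exists (normc c)]. Qed.

Lemma bmfN f : bmf f -> bmf (fun x => - f x).
Proof.
move=> [mf [A fA]]; split; first exact: cmeasurable_funN.
by exists A => x Sx; rewrite normcN; exact: fA.
Qed.

Lemma bmfB f g : bmf f -> bmf g -> bmf (fun x => f x - g x).
Proof. by move=> bf bg; apply: bmfD => //; exact: bmfN. Qed.

Lemma bmfJ f : bmf f -> bmf (fun x => (f x)^*%C).
Proof.
move=> [mf [A fA]]; split; first exact: cmeasurable_funJ.
by exists A => x Sx; rewrite normcJ; exact: fA.
Qed.

Lemma bmf_sum (I : Type) (r : seq I) (P : pred I) (F : I -> 'rV[R]_n -> C) :
  (forall i, bmf (F i)) -> bmf (fun x => \sum_(i <- r | P i) F i x).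
Proof.
move=> mF; elim: r => [|i r IH].
  by under eq_fun do rewrite big_nil; exact: bmf_cst.
under eq_fun do rewrite big_cons; case: (P i) => //.
exact: bmfD.
Qed.

Lemma bmfX f k : bmf f -> bmf (fun x => f x ^+ k).
Proof.
move=> mf; elim: k => [|k IH]; first exact: bmf_cst.
by under eq_fun do rewrite exprS; exact: bmfM.
Qed.

Lemma bmf_coord i : bmf (fun x => (x ord0 i)%:C).
Proof.
split.
  by apply: cmeasurable_funR; apply: measurable_funTS; exact: (measurable_rV_coord i).
by exists 1 => x Sx; rewrite normcR (le_trans (coord_le_enorm x i))// Sx.
Qed.

Lemma eq_bmf f g : (forall x, S x -> f x = g x) -> bmf f -> bmf g.
Proof.
move=> fg [[f1 f2] [A fA]]; split.
  split.
    by apply: (eq_measurable_fun (fun x => complex.Re (f x))) => // x; rewrite inE => Sx; rewrite fg.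
  by apply: (eq_measurable_fun (fun x => complex.Im (f x))) => // x; rewrite inE => Sx; rewrite fg.
by exists A => x Sx; rewrite -fg//; exact: fA.
Qed.

Lemma bmf_cintegrable f : bmf f -> cintegrable sigma S f.
Proof.
move=> [[f1 f2] [A fA]]; split; apply: (@integrable_sphere _ _ _ A) => // x Sx.
  by rewrite (le_trans (normr_Re _))// fA.
by rewrite (le_trans (normr_Im _))// fA.
Qed.

(** For a gradient [G] this is the angular derivative x_j d_k - x_k d_j, which generates the
    rotations [arot j k]. It does not see the radial part of [G]. *)
Definition agrad G j k (x : 'rV[R]_n) : C := (x ord0 j)%:C * G k x - (x ord0 k)%:C * G j x.

(* [G] is, up to a radial component, the gradient of an extension of [f]. *)
Definition sgrad f G := forall j k x, j != k -> S x ->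
  is_cderive 0 (fun t => f (arot j k t x)) (agrad G j k x).

Lemma eq_sgrad f g G H : (forall x, S x -> f x = g x) ->
  (forall i x, S x -> G i x = H i x) -> sgrad f G -> sgrad g H.
Proof.
move=> fg GH fG j k x jk Sx; rewrite (_ : (fun _ => _) = fun t => f (arot j k t x)).
  by rewrite /agrad -!GH//; exact: fG.
by apply/funext => t; rewrite fg//; exact: sphere_arot.
Qed.

Lemma sgradD f g G H : sgrad f G -> sgrad g H ->
  sgrad (fun x => f x + g x) (fun i x => G i x + H i x).
Proof.
move=> fG gH j k x jk Sx; apply: is_cderive_eq.
  by apply: is_cderiveD; [exact: fG|exact: gH].
by rewrite /agrad; ring.
Qed.

Lemma sgradM f g G H : sgrad f G -> sgrad g H ->
  sgrad (fun x => f x * g x) (fun i x => f x * H i x + G i x * g x).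
Proof.
move=> fG gH j k x jk Sx; apply: is_cderive_eq.
  by apply: is_cderiveM; [exact: fG|exact: gH].
by rewrite /agrad arot0; ring.
Qed.

Lemma sgrad_cst (c : C) : sgrad (fun=> c) (fun _ _ => 0).
Proof.
move=> j k x jk Sx; apply: is_cderive_eq; first exact: is_cderive_cst.
by rewrite /agrad; ring.
Qed.

Lemma sgradZ (c : C) f G : sgrad f G -> sgrad (fun x => c * f x) (fun i x => c * G i x).
Proof.
move=> fG; apply: eq_sgrad (sgradM (sgrad_cst c) fG) => // i x _.
by rewrite mul0r addr0.
Qed.

Lemma sgradN f G : sgrad f G -> sgrad (fun x => - f x) (fun i x => - G i x).
Proof.
move=> fG; apply: eq_sgrad (sgradZ (-1) fG) => [x|i x] _; by rewrite mulN1r.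
Qed.

Lemma sgrad_sum m (F : 'I_m -> 'rV[R]_n -> C) (G : 'I_m -> 'I_n -> 'rV[R]_n -> C) :
  (forall i, sgrad (F i) (G i)) ->
  sgrad (fun x => \sum_i F i x) (fun l x => \sum_i G i l x).
Proof.
move=> FG; elim: (index_enum _) => [|i r IH].
  apply: eq_sgrad (sgrad_cst 0) => [x|i x] _; by rewrite big_nil.
apply: eq_sgrad (sgradD (FG i) IH) => [x|l x] _; by rewrite big_cons.
Qed.

Lemma sgradJ f G : sgrad f G -> sgrad (fun x => (f x)^*%C) (fun i x => (G i x)^*%C).
Proof.
move=> fG j k x jk Sx; apply: is_cderive_eq.
  by apply: is_cderiveJ; exact: fG.
by rewrite /agrad rmorphB !rmorphM /= !oppr0.
Qed.

Lemma sgrad_cexp f G : sgrad f G -> sgrad (fun x => cexp (f x)) (fun i x => cexp (f x) * G i x).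
Proof.
move=> fG j k x jk Sx; apply: is_cderive_eq.
  by apply: is_cderive_cexp; exact: fG.
by rewrite /agrad arot0; ring.
Qed.

Lemma sgrad_Rinv (u : 'rV[R]_n -> R) G : (forall x, S x -> 0 < u x) ->
  sgrad (fun x => (u x)%:C) G ->
  sgrad (fun x => ((u x)^-1)%:C) (fun i x => - (((u x)^-1) ^+ 2)%:C * G i x).
Proof.
move=> u0 fG j k x jk Sx; apply: is_cderive_eq.
  by apply: is_cderive_Rinv; [rewrite arot0; exact: u0|exact: fG].
by rewrite /agrad arot0; ring.
Qed.

Lemma is_derive_arot_coord (i j k : 'I_n) x : j != k ->
  is_derive (0 : R) 1 (fun t => arot j k t x ord0 i)
    (x ord0 j * (k == i)%:R - x ord0 k * (j == i)%:R).
Proof.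
move=> jk; rewrite /arot/plane_rot; under eq_fun do rewrite mxE.
rewrite [j == i]eq_sym [k == i]eq_sym.
have [->|ij] := eqVneq i j.
  rewrite (negbTE jk); apply: is_derive_eq.
  by rewrite /GRing.scale/= sin0 cos0; ring.
have [_|ik] := eqVneq i k.
  apply: is_derive_eq.
  by rewrite /GRing.scale/= sin0 cos0; ring.
by rewrite !mulr0 subr0; exact: is_derive_cst.
Qed.

Lemma sgrad_coord i : sgrad (fun x => (x ord0 i)%:C) (fun l _ => (l == i)%:R).
Proof.
move=> j k x jk Sx; apply: is_cderive_eq.
  by apply: is_cderiveR; exact: is_derive_arot_coord.
by rewrite /agrad rmorphB !rmorphM /= !rmorph_nat.
Qed.

Lemma cintegral_agrad0 f G j k : j != k -> bmf f -> (forall i, bmf (G i)) -> sgrad f G ->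
  cintegral sigma S (agrad G j k) = 0.
Proof.
move=> jk [[f1 f2] [A fA]] mG fG.
have [[l1 l2] [B lB]] : bmf (agrad G j k).
  by apply: bmfB; apply: bmfM => //; exact: bmf_coord.
apply: complex_eqP => /=.
  apply: (@Rintegral_arot_derive0 _ _ j k (fun x => complex.Re (f x)) _ A B) => //.
  - by move=> x Sx; rewrite (le_trans (normr_Re _))// fA.
  - by move=> x Sx; rewrite (le_trans (normr_Re _))// lB.
  - by move=> x Sx; have [] := fG j k x jk Sx.
apply: (@Rintegral_arot_derive0 _ _ j k (fun x => complex.Im (f x)) _ A B) => //.
- by move=> x Sx; rewrite (le_trans (normr_Im _))// fA.
- by move=> x Sx; rewrite (le_trans (normr_Im _))// lB.
- by move=> x Sx; have [] := fG j k x jk Sx.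
Qed.

Definition lin (c : 'I_n -> C) (x : 'rV[R]_n) : C := \sum_i c i * (x ord0 i)%:C.

(* Derivative along the projection of [c] to the tangent space. *)
Definition tanD (c : 'I_n -> C) G (x : 'rV[R]_n) : C :=
  \sum_i (c i - lin c x * (x ord0 i)%:C) * G i x.

Lemma bmf_lin c : bmf (lin c).
Proof. by apply: bmf_sum => i; apply: bmfM; [exact: bmf_cst|exact: bmf_coord]. Qed.

Lemma bmf_tanD c G : (forall i, bmf (G i)) -> bmf (tanD c G).
Proof.
move=> mG; apply: bmf_sum => i; apply: bmfM => //; apply: bmfB; first exact: bmf_cst.
by apply: bmfM; [exact: bmf_lin|exact: bmf_coord].
Qed.

Lemma sphere_sum_sqr x : S x -> \sum_i (x ord0 i)%:C * (x ord0 i)%:C = 1 :> C.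
Proof.
move=> Sx; transitivity ((dot x x)%:C : C); last by rewrite -enorm_sqr Sx expr1n.
by rewrite /dot rmorph_sum; apply: eq_bigr => i _; rewrite rmorphM.
Qed.

(** Angular derivatives integrate to zero; applying this to x_j f in each plane (j, k) and summing
    over j gives, because the x_j^2 sum to 1, the k-th tangential component of [G] minus (n - 1) x_k
    f. Contracting with [c] yields the formula. The term with n - 1 is the mean-curvature
    contribution of the sphere. *)
Lemma cintegral_tanD c f G : bmf f -> (forall i, bmf (G i)) -> sgrad f G ->
  cintegral sigma S (tanD c G) =
  (n%:R - 1) * cintegral sigma S (fun x => lin c x * f x).
Proof.
move=> mf mG fG; have mS := @measurable_sphere R n.
(* For j != k this is the angular derivative of x_j f in the plane (j, k). The Boolean factor makes
   it vanish on the diagonal, so that the sum over all j can be taken and exactly n - 1 copies of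
   x_k f remain. *)
pose E j k (x : 'rV[R]_n) : C := (x ord0 j)%:C * agrad G j k x - (j != k)%:R * ((x ord0 k)%:C * f x).
have mE j k : bmf (E j k).
  apply: bmfB.
    by apply: bmfM; [exact: bmf_coord|apply: bmfB; apply: bmfM => //; exact: bmf_coord].
  by apply: bmfM; [exact: bmf_cst|apply: bmfM => //; exact: bmf_coord].
have E0 j k : cintegral sigma S (E j k) = 0.
  have [->|jk] := eqVneq j k.
    rewrite (@eq_cintegral _ _ _ _ _ _ (fun=> 0)).
      by rewrite /cintegral /Rintegral/= integral0.
    by move=> x _; rewrite /E /agrad eqxx/= subrr mulr0 mul0r subr0.
  rewrite -(@cintegral_agrad0 (fun x => (x ord0 j)%:C * f x)
    (fun l x => (x ord0 j)%:C * G l x + (l == j)%:R * f x) j k)//.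
  - have kj : (k == j) = false by rewrite eq_sym (negbTE jk).
    apply: eq_cintegral => x _; rewrite /E /agrad kj eqxx jk /= mulr1n mulr0n.
    by ring.
  - by apply: bmfM => //; exact: bmf_coord.
  - move=> i; apply: bmfD; apply: bmfM => //; [exact: bmf_coord|exact: bmf_cst].
  - by apply: sgradM => //; exact: sgrad_coord.
have mEj : forall k, bmf (fun x => \sum_j E j k x) by move=> k; exact: bmf_sum.
have mEE : bmf (fun x => \sum_k c k * \sum_j E j k x).
  by apply: bmf_sum => k; apply: bmfM => //; exact: bmf_cst.
have mzf : bmf (fun x => lin c x * f x) by apply: bmfM => //; exact: bmf_lin.
rewrite (@eq_cintegral _ _ _ _ _ _ (fun x => (n%:R - 1) * (lin c x * f x) + \sum_k c k * \sum_j E j k x)).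
  rewrite cintegralD//; last 2 first.
  - by apply: bmf_cintegrable; apply: bmfM => //; exact: bmf_cst.
  - exact: bmf_cintegrable.
  rewrite cintegralZ//; last exact: bmf_cintegrable.
  rewrite cintegral_sum//; last first.
    by move=> k; apply: bmf_cintegrable; apply: bmfM => //; exact: bmf_cst.
  rewrite big1 ?addr0// => k _; rewrite cintegralZ//; last exact: bmf_cintegrable.
  rewrite cintegral_sum//; last by move=> j; exact: bmf_cintegrable.
  by rewrite big1 ?mulr0.
move=> x Sx.
have Ek k : \sum_j E j k x = G k x - (x ord0 k)%:C * \sum_j (x ord0 j)%:C * G j x
    - (n%:R - 1) * ((x ord0 k)%:C * f x).
  rewrite sumrB; congr (_ - _).
    under eq_bigr do rewrite /agrad mulrBr mulrA.
    rewrite sumrB -mulr_suml sphere_sum_sqr// mul1r; congr (_ - _).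
    by rewrite mulr_sumr; apply: eq_bigr => j _; rewrite mulrCA.
  rewrite -mulr_suml; congr (_ * _).
  rewrite (bigD1 k)//= eqxx add0r (eq_bigr (fun=> 1)); last by move=> j ->.
  rewrite sumr_const cardC1 card_ord.
  by case: (n) k => [[]//|m] _ ; rewrite -natr1 addrK.
under eq_bigr do rewrite Ek.
have -> : tanD c G x = \sum_i c i * G i x - lin c x * \sum_i (x ord0 i)%:C * G i x.
  rewrite /tanD mulr_sumr -sumrB; apply: eq_bigr => i _.
  by rewrite mulrBl -mulrA.
under [in RHS]eq_bigr do rewrite !mulrBr.
rewrite !sumrB.
have -> : \sum_i c i * ((x ord0 i)%:C * (\sum_j (x ord0 j)%:C * G j x)) =
    lin c x * \sum_j (x ord0 j)%:C * G j x.
  by rewrite /lin mulr_suml; apply: eq_bigr => i _; rewrite mulrA.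
have -> : \sum_i c i * ((n%:R - 1) * ((x ord0 i)%:C * f x)) = (n%:R - 1) * (lin c x * f x).
  by rewrite /lin mulr_suml mulr_sumr; apply: eq_bigr => i _; ring.
ring.
Qed.

End sgrad.

Lemma open_neq0_rV (R : realType) n : open [set x : 'rV[R]_n | x != 0].
Proof.
rewrite (_ : mkset _ = ~` [set 0]).
  by rewrite openC; apply: accessible_closed_set1; apply: hausdorff_accessible; exact: norm_hausdorff.
by apply/seteqP; split => x /=; [move/eqP|move=> ?; apply/eqP].
Qed.

Lemma sphere_neq0 (R : realType) n (x : 'rV[R]_n) : sphere x -> x != 0.
Proof.
apply: contraPneq => -> /eqP; rewrite /enorm /dot big1 ?sqrtr0 => [|i _]; last by rewrite mxE mul0r.
by rewrite eq_sym oner_eq0.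
Qed.

(** * Chain rule along rotations for functions with continuous partial derivatives *)

Section chain_rule.
Variables (R : realType) (n : nat).
Local Notation e_ i := (delta_mx (ord0 : 'I_1) (i : 'I_n) : 'rV[R]_n).
Implicit Types (u : 'rV[R]_n -> R) (x y : 'rV[R]_n).

Lemma is_derive_line u y (k : 'I_n) (s : R) : derivable u (y + s *: e_ k) (e_ k) ->
  is_derive s (1 : R) (fun s => u (y + s *: e_ k)) (derive u (y + s *: e_ k) (e_ k)).
Proof.
move=> du.
have E : (fun h : R => h^-1 *: (((fun s => u (y + s *: e_ k)) \o shift s) (h *: (1 : R)) - u (y + s *: e_ k))) =
  (fun h : R => h^-1 *: ((u \o shift (y + s *: e_ k)) (h *: e_ k) - u (y + s *: e_ k))).
  apply/funext => h /=; congr (_ *: (u _ - _)).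
  by rewrite -[h *: (1 : R)]/(h * 1) mulr1 scalerDl addrCA.
by split; [rewrite /derivable E|rewrite /derive E].
Qed.

Lemma line_increment u y (k : 'I_n) (b : R) :
  (forall t : R, 0 <= t <= 1 -> derivable u (y + (t * b) *: e_ k) (e_ k)) ->
  exists2 t : R, 0 <= t <= 1 & u (y + b *: e_ k) - u y = b * derive u (y + (t * b) *: e_ k) (e_ k).
Proof.
move=> du.
have dv (t : R) : 0 <= t <= 1 -> is_derive t (1 : R) (fun t => u (y + (t * b) *: e_ k))
    (derive u (y + (t * b) *: e_ k) (e_ k) * b).
  move=> t01; have h1 := is_derive_line (du t t01).
  have h2 : is_derive t (1 : R) (fun t => t * b) b.
    by apply: is_derive_eq; rewrite /GRing.scale/= mulr0 mulr1 add0r.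
  exact: (@is_derive1_comp R (fun s => u (y + s *: e_ k)) (fun t => t * b) t _ _ h1 h2).
have [||t] := @MVT_segment R (fun t => u (y + (t * b) *: e_ k))
    (fun t => derive u (y + (t * b) *: e_ k) (e_ k) * b) 0 1 ler01.
- by move=> t; rewrite in_itv/= => /andP[t0 t1]; apply: dv; rewrite !ltW.
- apply: continuous_in_subspaceT => t; rewrite inE/= in_itv/= => t01.
  apply: differentiable_continuous; apply/derivable1_diffP.
  by have [] := dv t t01.
- rewrite in_itv/= => t01; rewrite mul1r mul0r scale0r addr0 subr0 mulr1 => ->.
  by exists t => //; rewrite mulrC.
Qed.

Lemma is_derive_small (psi : R -> R) : psi 0 = 0 ->
  (forall e, 0 < e -> \forall t \near (0 : R), `|psi t| <= e * `|t|) ->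
  is_derive (0 : R) (1 : R) psi 0.
Proof.
move=> p0 H.
have cv : h^-1 *: ((psi \o shift 0) (h *: (1 : R)) - psi 0) @[h --> (0 : R)^'] --> (0 : R).
  apply/cvgrPdist_le => e e0; near=> h.
  rewrite /= p0 !subr0 add0r normrN addr0 /GRing.scale/= mulr1 normrM normfV.
  have h0 : h != 0 by near: h; exact: nbhs_dnbhs_neq.
  rewrite mulrC ler_pdivrMr ?normr_gt0//.
  by near: h; apply: nbhs_dnbhs; exact: H.
by split; [apply/cvg_ex; exists 0|exact: (cvg_lim _ cv)].
Unshelve. all: by end_near. Qed.

Lemma derive_near_le (beta : R -> R) b : beta 0 = 0 -> is_derive (0 : R) (1 : R) beta b ->
  \forall t \near (0 : R), `|beta t| <= (`|b| + 1) * `|t|.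
Proof.
move=> b0 [d0 dE].
have /cvgrPdist_le /(_ 1 ltr01) : h^-1 *: ((beta \o shift 0) (h *: (1 : R)) - beta 0) @[h --> (0 : R)^'] --> b.
  by rewrite -dE; exact: d0.
rewrite near_withinE => H.
near=> t.
have [->|t0] := eqVneq t 0; first by rewrite b0 !normr0 mulr0.
have : `|b - t^-1 *: (beta (t *: (1 : R) + 0) - beta 0)| <= 1.
  by move: t0; near: t; exact: H.
rewrite b0 addr0 subr0 /GRing.scale/= mulr1 => Ht.
have : `|t^-1 * beta t| <= `|b| + 1.
  have -> : t^-1 * beta t = b - (b - t^-1 * beta t) by rewrite opprB addrCA subrr addr0.
  by rewrite (le_trans (ler_normB _ _))// lerD2l.
by rewrite normrM normfV mulrC ler_pdivrMr// normr_gt0.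
Unshelve. all: by end_near. Qed.

(** The regularity classes only provide partial derivatives, so the increment is split: the move
    along [e_ j] starts at [x] and obeys the one-variable chain rule, and the move along [e_ k] is
    handled by the mean value theorem, where continuity of the k-th partial derivative replaces the
    intermediate point by [x] up to o(t). *)
Lemma is_derive_two u x (j k : 'I_n) (al be : R -> R) (a b : R) :
  al 0 = 0 -> be 0 = 0 -> is_derive (0 : R) (1 : R) al a -> is_derive (0 : R) (1 : R) be b ->
  derivable u x (e_ j) ->
  (\forall y \near x, derivable u y (e_ k)) ->
  {for x, continuous (fun y => derive u y (e_ k))} ->
  is_derive (0 : R) (1 : R) (fun t => u (x + al t *: e_ j + be t *: e_ k))
    (a * derive u x (e_ j) + b * derive u x (e_ k)).
Proof.
move=> al0 be0 dal dbe dj dk ck.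
set D := derive u x (e_ k).
(* The error of the second move. It equals [be t] times a difference of two values of the k-th
   partial derivative; the first factor is at most (|b| + 1) |t| and the second at most e / (|b| +
   1), so [psi] has derivative 0. *)
pose psi t := u (x + al t *: e_ j + be t *: e_ k) - u (x + al t *: e_ j) - D * be t.
have dpsi : is_derive (0 : R) (1 : R) psi 0.
  apply: is_derive_small; first by rewrite /psi be0 scale0r addr0 subrr mulr0 subr0.
  move=> e e0.
  have b1 : 0 < `|b| + 1 by rewrite ltr_pwDr.
  have /cvgrPdist_le /(_ (e / (`|b| + 1))) := ck.
  rewrite divr_gt0// => /(_ isT); rewrite -/D => cke.
  have : nbhs x (fun y => derivable u y (e_ k) /\ `|D - derive u y (e_ k)| <= e / (`|b| + 1)).
    exact: filterI.
  move=> /nbhs_ballP[r /= r0 rP].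
  have near_small (g : R -> R) l : g 0 = 0 -> is_derive (0 : R) (1 : R) g l ->
      \forall t \near (0 : R), `|g t| < r / 2.
    move=> g0 dg.
    have cg : {for 0, continuous g}.
      by apply: differentiable_continuous; apply/derivable1_diffP; case: dg.
    have /cvgrPdist_lt /(_ (r / 2)) := cg.
    rewrite g0 divr_gt0// => /(_ isT); apply: filterS => t /=.
    by rewrite sub0r normrN.
  near=> t.
  have alt : `|al t| < r / 2 by near: t; exact: (near_small _ a).
  have bet : `|be t| < r / 2 by near: t; exact: (near_small _ b).
  have inball s : `|s| <= `|be t| -> ball x r (x + al t *: e_ j + s *: e_ k).
    move=> sb; split => // i l; rewrite (ord1 i) /ball/= !mxE /=.
    rewrite [X in `|X|](_ : _ = - (al t * (l == j)%:R + s * (l == k)%:R)); last by ring.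
    rewrite normrN (le_lt_trans (ler_normD _ _))// (splitr r).
    rewrite ler_ltD//.
      by rewrite normrM normr_nat; case: (l == j); rewrite ?mulr1 ?mulr0 ltW// divr_gt0.
    rewrite normrM normr_nat; case: (l == k); rewrite ?mulr1 ?mulr0 ?divr_gt0//.
    exact: le_lt_trans sb bet.
  have tb s : 0 <= s <= 1 -> `|s * be t| <= `|be t|.
    by move=> /andP[s0 s1]; rewrite normrM ger0_norm// ler_piMl.
  have [s s01 sE] := @line_increment u (x + al t *: e_ j) k (be t)
    (fun s s01 => (rP _ (inball _ (tb s s01))).1).
  have bt : `|be t| <= (`|b| + 1) * `|t| by near: t; exact: derive_near_le.
  rewrite /psi sE [D * _]mulrC -mulrBr normrM.
  have [_ rb] := rP _ (inball _ (tb s s01)).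
  apply: le_trans (ler_pM (normr_ge0 _) _ bt _) _; first exact: normr_ge0.
    by rewrite distrC; exact: rb.
  by rewrite mulrAC mulrCA mulfV ?mulr1 ?gt_eqF.
have h1 : is_derive (0 : R) (1 : R) (fun t => u (x + al t *: e_ j)) (derive u x (e_ j) * a).
  have h : is_derive (al 0) (1 : R) (fun s => u (x + s *: e_ j)) (derive u x (e_ j)).
    have := @is_derive_line u x j 0; rewrite al0 scale0r addr0; exact.
  exact: (is_derive1_comp h dal).
have h2 : is_derive (0 : R) (1 : R) (fun t => D * be t) (D * b).
  by apply: is_derive_eq.
have -> : (fun t => u (x + al t *: e_ j + be t *: e_ k)) =
    (fun t => psi t + (u (x + al t *: e_ j) + D * be t)).
  by apply/funext => t; rewrite /psi; ring.
apply: (is_derive_to (is_deriveD dpsi (is_deriveD h1 h2))).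
by rewrite add0r [a * _]mulrC [b * _]mulrC.
Unshelve. all: by end_near. Qed.

Lemma arotE (j k : 'I_n) t x : j != k -> arot j k t x =
  x + ((cos t - 1) * x ord0 j - sin t * x ord0 k) *: e_ j +
      (sin t * x ord0 j + (cos t - 1) * x ord0 k) *: e_ k.
Proof.
move=> jk; apply/rowP => i; rewrite !mxE !eqxx /=.
have [->|ij] := eqVneq i j; first by rewrite (negbTE jk) !mulr1 !mulr0 addr0; ring.
have [->|ik] := eqVneq i k; first by rewrite !mulr1 !mulr0 addr0; ring.
by rewrite !mulr0 !addr0.
Qed.

(** A plane rotation changes only two coordinates, so the two-direction chain rule is enough in any
    dimension. *)
Lemma is_derive_arot_C1 u (j k : 'I_n) x : j != k -> x != 0 -> Ck_on 1 [set x | x != 0] u ->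
  is_derive (0 : R) (1 : R) (fun t => u (arot j k t x))
    (x ord0 j * derive u x (e_ k) - x ord0 k * derive u x (e_ j)).
Proof.
move=> jk x0 uC.
have [_ /(_ isT) du] := uC [::] isT.
under eq_fun do rewrite arotE//.
have da : is_derive (0 : R) (1 : R) (fun t => (cos t - 1) * x ord0 j - sin t * x ord0 k) (- x ord0 k).
  by apply: is_derive_eq; rewrite /GRing.scale/= sin0 cos0; ring.
have db : is_derive (0 : R) (1 : R) (fun t => sin t * x ord0 j + (cos t - 1) * x ord0 k) (x ord0 j).
  by apply: is_derive_eq; rewrite /GRing.scale/= sin0 cos0; ring.
apply: (is_derive_to (@is_derive_two u x j k _ _ _ _ _ _ da db _ _ _)).
- by rewrite cos0 sin0; ring.
- by rewrite cos0 sin0; ring.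
- exact: du.
- have : nbhs x [set x : 'rV[R]_n | x != 0].
    by apply: open_nbhs_nbhs; split => //; exact: open_neq0_rV.
  by apply: filterS => y y0; exact: du.
- by have [+ _] := uC [:: k] isT; apply.
by ring.
Qed.

End chain_rule.

Section Ck_calculus.
Variables (R : realType) (n : nat).
Local Notation C := R[i].
Local Notation S := (@sphere R n).
Implicit Types (u : 'rV[R]_n -> R).
Local Notation U := [set x : 'rV[R]_n | x != 0].

(** In [partial] the head of the list is the outermost derivative. Inductions that replace [u] by
    one of its first derivatives need the innermost one, hence the last entry. *)
Lemma partial_rcons s (i : 'I_n) u : partial (rcons s i) u = partial s (partial [:: i] u).
Proof. by elim: s => [//|j s IH] /=; rewrite IH. Qed.

Lemma Ck_on_partial k u i : Ck_on k.+1 U u -> Ck_on k U (partial [:: i] u).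
Proof.
move=> uC s sk; have := uC (rcons s i); rewrite size_rcons ltnS => /(_ sk)[cu du].
by rewrite -partial_rcons; split => // sk'; exact: du.
Qed.

Lemma Ck_on_le k l u : (k <= l)%N -> Ck_on l U u -> Ck_on k U u.
Proof.
move=> kl uC s sk; have [cu du] := uC s (leq_trans sk kl); split => // sk'.
by apply: du; exact: leq_trans kl.
Qed.

Lemma Ck_on_measurable k u : Ck_on k U u -> measurable_fun S u.
Proof.
move=> /(_ [::] isT)[cu _]; apply: (@measurable_funS _ _ _ _ U).
- by apply: open_measurable_rV; exact: open_neq0_rV.
- by move=> x; exact: sphere_neq0.
- by apply: continuous_measurable_fun_rV => //; exact: open_neq0_rV.
Qed.

Lemma Ck_on_sgrad k u : Ck_on k.+1 U u ->
  sgrad (fun x => (u x)%:C) (fun i x => (partial [:: i] u x)%:C).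
Proof.
move=> uC j l x jl Sx; apply: is_cderive_eq.
  apply: is_cderiveR; apply: is_derive_arot_C1 => //; first exact: sphere_neq0.
  exact: Ck_on_le uC.
by rewrite /agrad rmorphB !rmorphM.
Qed.

End Ck_calculus.

(** * Quantitative bounds for iterated derivatives along one tangential field *)

Section iterated_derivative_bounds.
Variables (R : realType) (n : nat).
Local Notation C := R[i].
Local Notation S := (@sphere R n).
Implicit Types (c : 'I_n -> C) (f g : 'rV[R]_n -> C).

(** A C^k bound in the single direction Y, with the same [B] at every order. The gradient is
    existentially quantified because only its tangential part is determined; the coefficients c_i -
    z x_i of [tanD] are orthogonal to x on the sphere, so a radial part does not contribute. *)
Fixpoint tanCk c k (B : R) f : Prop := [/\ bmf f, (forall x, S x -> normc (f x) <= B) &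
  if k is k'.+1 then
    exists G, [/\ sgrad f G, forall i, bmf (G i) & tanCk c k' B (tanD c G)]
  else True].

Lemma tanCk_bmf c k B f : tanCk c k B f -> bmf f.
Proof. by case: k => [|k] []. Qed.

Lemma tanCk_bound c k B f : tanCk c k B f -> forall x, S x -> normc (f x) <= B.
Proof. by case: k => [|k] []. Qed.

Lemma eq_tanCk c k B f g : (forall x, S x -> f x = g x) -> tanCk c k B f -> tanCk c k B g.
Proof.
case: k => [|k] fg [bf fB H]; split => //; try exact: eq_bmf bf.
- by move=> x Sx; rewrite -fg//; exact: fB.
- by move=> x Sx; rewrite -fg//; exact: fB.
- by case: H => G [fG mG HG]; exists G; split => //; exact: eq_sgrad fG.
Qed.

Lemma tanCk_le c k B B' f : B <= B' -> tanCk c k B f -> tanCk c k B' f.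
Proof.
move=> BB'; elim: k => [|k IH] in f * => -[bf fB H]; split => //.
- by move=> x Sx; rewrite (le_trans _ BB')// fB.
- by move=> x Sx; rewrite (le_trans _ BB')// fB.
- by case: H => G [fG mG HG]; exists G; split => //; exact: IH.
Qed.

Lemma tanCkS c k B f : tanCk c k.+1 B f -> tanCk c k B f.
Proof.
elim: k => [|k IH] in f *; first by case.
by case=> bf fB [G [fG mG HG]]; split => //; exists G; split => //; exact: IH.
Qed.

Lemma tanCkD c k A B f g : tanCk c k A f -> tanCk c k B g -> tanCk c k (A + B) (fun x => f x + g x).
Proof.
elim: k => [|k IH] in f g * => -[bf fA Hf] [bg gB Hg].
  split => //; first exact: bmfD.
  by move=> x Sx; rewrite (le_trans (le_normcD _ _))// lerD ?fA ?gB.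
case: Hf Hg => G [fG mG HG] [H [gH mH HH]]; split.
- exact: bmfD.
- by move=> x Sx; rewrite (le_trans (le_normcD _ _))// lerD ?fA ?gB.
- exists (fun i x => G i x + H i x); split; first exact: sgradD.
    by move=> i; exact: bmfD.
  apply: eq_tanCk (IH _ _ HG HH) => x Sx; rewrite /tanD -big_split/=.
  by apply: eq_bigr => i _; rewrite mulrDr.
Qed.

(** By Leibniz every derivative doubles the number of products, whence the factor 2^k. *)
Lemma tanCkM c k A B f g : 0 <= A -> 0 <= B -> tanCk c k A f -> tanCk c k B g ->
  tanCk c k (2 ^+ k * A * B) (fun x => f x * g x).
Proof.
move=> A0 B0; elim: k => [|k IH] in f g *.
  move=> [bf fA _] [bg gB _]; split => //; first exact: bmfM.
  by move=> x Sx; rewrite expr0 mul1r normcM ler_pM ?normc_ge0 ?fA ?gB.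
move=> Hf Hg; have Hf' := tanCkS Hf; have Hg' := tanCkS Hg.
case: Hf Hg => bf fA [G [fG mG HG]] [bg gB [H [gH mH HH]]]; split.
- exact: bmfM.
- move=> x Sx; rewrite normcM -mulrA (@le_trans _ _ (A * B))//.
    by rewrite ler_pM ?normc_ge0 ?fA ?gB.
  by rewrite ler_peMl ?mulr_ge0// exprn_ege1// ler1n.
- exists (fun i x => f x * H i x + G i x * g x); split; first exact: sgradM.
    by move=> i; apply: bmfD; exact: bmfM.
  rewrite (_ : 2 ^+ k.+1 * A * B = 2 ^+ k * A * B + 2 ^+ k * A * B); last first.
    by rewrite exprS; ring.
  apply: eq_tanCk (tanCkD (IH _ _ Hf' HH) (IH _ _ HG Hg')) => x Sx.
  rewrite /tanD mulr_sumr mulr_suml -big_split/=.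
  by apply: eq_bigr => i _; ring.
Qed.

Lemma tanCk_cst c k (a : C) : tanCk c k (normc a) (fun=> a).
Proof.
have a0 := normc_ge0 a.
elim: k a a0 => [|k IH] a a0; first by split => //; exact: bmf_cst.
split => //; first exact: bmf_cst.
exists (fun _ _ => 0); split; first exact: sgrad_cst.
  by move=> i; exact: bmf_cst.
have := IH 0; rewrite normc0 lexx => /(_ isT) /(tanCk_le a0).
by apply: eq_tanCk => x _; rewrite /tanD big1// => i _; rewrite mulr0.
Qed.

Lemma tanCk_sum c k A m (F : 'I_m -> 'rV[R]_n -> C) : 0 <= A -> (forall i, tanCk c k A (F i)) ->
  tanCk c k (m%:R * A) (fun x => \sum_i F i x).
Proof.
move=> A0 FA.
elim: m => [|m IH] in F FA *.
  rewrite mul0r -(@normc0 R); apply: eq_tanCk (tanCk_cst c k 0) => x _.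
  by rewrite big_ord0.
rewrite -natr1 mulrDl mul1r.
apply: eq_tanCk (tanCkD (IH (fun i => F (widen_ord (leqnSn m) i)) _) (FA ord_max)) => //.
by move=> x _; rewrite big_ord_recr.
Qed.

End iterated_derivative_bounds.

(** * The oscillatory integral *)

Section oscillatory.
Variables (R : realType) (n : nat).
Local Notation C := R[i].
Local Notation S := (@sphere R n).
Local Notation sigma := (@surface_measure R n).
Local Notation U := [set x : 'rV[R]_n | x != 0].
Implicit Types (c : 'I_n -> C) (M : R) (x : 'rV[R]_n).

Definition unit_coef c := \sum_i normc (c i) ^+ 2 = 1.

Definition tau c : C := \sum_i c i * c i.

Definition defect c x : R := 1 - normc (lin c x) ^+ 2.

Definition weight c M x : R := (1 + M * defect c x)^-1.

Definition twist c M x : C := M%:C * ((weight c M x)%:C * (tau c - lin c x * lin c x)).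

(* The logarithmic derivative of the weight along [tanD c]. *)
Definition weight_rate c M x : C :=
  (1 - (weight c M x)%:C) * lin c x + (lin c x)^*%C * twist c M x.

Lemma tanDM c (a : 'rV[R]_n -> C) (G : 'I_n -> 'rV[R]_n -> C) x :
  tanD c (fun i x => a x * G i x) x = a x * tanD c G x.
Proof. by rewrite /tanD mulr_sumr; apply: eq_bigr => i _; rewrite mulrCA. Qed.

Lemma tanDD c (G H : 'I_n -> 'rV[R]_n -> C) x :
  tanD c (fun i x => G i x + H i x) x = tanD c G x + tanD c H x.
Proof. by rewrite /tanD -big_split; apply: eq_bigr => i _; rewrite mulrDr. Qed.

Lemma tanD_c c x : tanD c (fun i _ => c i) x = tau c - lin c x * lin c x.
Proof.
rewrite /tanD /tau {3}/lin mulr_sumr -sumrB; apply: eq_bigr => i _; ring.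
Qed.

Lemma conj_lin c x : (lin c x)^*%C = \sum_i (c i)^*%C * (x ord0 i)%:C.
Proof.
rewrite /lin rmorph_sum; apply: eq_bigr => i _.
by rewrite rmorphM /= oppr0.
Qed.

Lemma unit_coefE c : unit_coef c -> \sum_i c i * (c i)^*%C = 1.
Proof.
move=> uc; transitivity ((\sum_i normc (c i) ^+ 2)%:C : C); last by rewrite uc.
by rewrite rmorph_sum; apply: eq_bigr => i _; rewrite mulcJE.
Qed.

Lemma tanD_conjc c x : unit_coef c ->
  tanD c (fun i _ => (c i)^*%C) x = 1 - lin c x * (lin c x)^*%C.
Proof.
move=> uc; rewrite -(unit_coefE uc) /tanD [X in _ - _ * X]conj_lin mulr_sumr -sumrB.
by apply: eq_bigr => i _; ring.
Qed.

Lemma defectE c x : (defect c x)%:C = 1 - lin c x * (lin c x)^*%C.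
Proof. by rewrite /defect rmorphB mulcJE. Qed.

(** Pythagoras: the projection of the unit vector [c] off the direction x has squared length 1 -
    |z|^2. This makes the defect nonnegative. *)
Lemma sum_tan_normsqr c x : unit_coef c -> S x ->
  \sum_i normc (c i - lin c x * (x ord0 i)%:C) ^+ 2 = defect c x.
Proof.
move=> uc Sx; apply: (@complexI R); rewrite defectE.
transitivity (\sum_i (c i - lin c x * (x ord0 i)%:C) * ((c i)^*%C - (lin c x)^*%C * (x ord0 i)%:C)).
  rewrite rmorph_sum; apply: eq_bigr => i _.
  by rewrite [LHS](esym (mulcJE _)) rmorphB rmorphM /= oppr0.
transitivity (\sum_i c i * (c i)^*%C - (lin c x)^*%C * (\sum_i c i * (x ord0 i)%:C)
   - lin c x * (\sum_i (c i)^*%C * (x ord0 i)%:C)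
   + lin c x * (lin c x)^*%C * \sum_i (x ord0 i)%:C * (x ord0 i)%:C).
  move: (lin c x) => z.
  rewrite !mulr_sumr -!sumrB -big_split/=; apply: eq_bigr => i _; ring.
rewrite unit_coefE// sphere_sum_sqr// -conj_lin -/(lin c x); ring.
Qed.

Lemma sum_tan_sqr c x : S x ->
  \sum_i (c i - lin c x * (x ord0 i)%:C) * (c i - lin c x * (x ord0 i)%:C) =
  tau c - lin c x * lin c x.
Proof.
move=> Sx.
transitivity (\sum_i c i * c i - 2%:R * lin c x * (\sum_i c i * (x ord0 i)%:C)
   + lin c x * lin c x * \sum_i (x ord0 i)%:C * (x ord0 i)%:C).
  move: (lin c x) => z.
  rewrite !mulr_sumr -!sumrB -big_split/=; apply: eq_bigr => i _.
  by ring.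
rewrite sphere_sum_sqr// -/(lin c x) -/(tau c); ring.
Qed.

Lemma defect_ge0 c x : unit_coef c -> S x -> 0 <= defect c x.
Proof.
by move=> uc Sx; rewrite -sum_tan_normsqr//; apply: sumr_ge0 => i _; rewrite sqr_ge0.
Qed.

Lemma normc_lin_le1 c x : unit_coef c -> S x -> normc (lin c x) <= 1.
Proof.
move=> uc Sx; have := defect_ge0 uc Sx; rewrite subr_ge0 -[leRHS](expr1n _ 2).
by rewrite ler_pXn2r// nnegrE ?normc_ge0.
Qed.

(** The left side is the modulus of the bilinear square of the projected vector, the right side its
    Hermitian square; the triangle inequality compares them term by term. *)
Lemma normc_tan_sqr_le c x : unit_coef c -> S x ->
  normc (tau c - lin c x * lin c x) <= defect c x.
Proof.
move=> uc Sx; rewrite -sum_tan_sqr// -sum_tan_normsqr//.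
apply: (le_trans (le_normc_sum _ _ _)); apply: ler_sum => i _.
by rewrite normcM -expr2.
Qed.

Lemma unit_coef_le1 c i : unit_coef c -> normc (c i) <= 1.
Proof.
move=> uc; rewrite -(@ler_pXn2r _ 2)// ?nnegrE ?normc_ge0// expr1n -uc (bigD1 i)//=.
by rewrite lerDl; apply: sumr_ge0 => j _; rewrite sqr_ge0.
Qed.

Section fixed.
Variables (c : 'I_n -> C) (M : R).
Hypotheses (uc : unit_coef c) (M0 : 0 < M).

Lemma denom_gt0 x : S x -> 0 < 1 + M * defect c x.
Proof. by move=> Sx; rewrite ltr_pwDl// mulr_ge0 ?(ltW M0)// defect_ge0. Qed.

Lemma weight_gt0 x : S x -> 0 < weight c M x.
Proof. by move=> Sx; rewrite invr_gt0 denom_gt0. Qed.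

Lemma weight_le1 x : S x -> weight c M x <= 1.
Proof.
by move=> Sx; rewrite invf_le1 ?denom_gt0// lerDl mulr_ge0 ?(ltW M0)// defect_ge0.
Qed.

Lemma weightK x : S x -> (weight c M x)%:C * (1 + M%:C * (1 - lin c x * (lin c x)^*%C)) = 1.
Proof.
move=> Sx; rewrite -defectE -rmorphM -[X in X + _](rmorph1 (real_complex R)) -rmorphD -rmorphM.
by rewrite /weight mulVf ?rmorph1// gt_eqF// denom_gt0.
Qed.

(** [twist] is M w Y(z). Since |Y(z)| is at most the defect, its modulus is at most M defect / (1 +
    M defect), uniformly in [M]. *)
Lemma normc_twist_le1 x : S x -> normc (twist c M x) <= 1.
Proof.
move=> Sx; rewrite /twist mulrA -rmorphM normcM normcR ger0_norm; last first.
  by rewrite mulr_ge0 ?ltW ?weight_gt0.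
apply: (@le_trans _ _ (M * weight c M x * defect c x)).
  by rewrite ler_wpM2l ?normc_tan_sqr_le// mulr_ge0 ?ltW ?weight_gt0.
rewrite mulrAC /weight ler_pdivrMr ?denom_gt0// mul1r.
by rewrite lerDr.
Qed.

Lemma sgrad_lin c' : sgrad (lin c') (fun i _ => c' i).
Proof.
apply: eq_sgrad (sgrad_sum (fun i => sgradZ (c' i) (sgrad_coord i))) => //.
move=> i x _; rewrite (bigD1 i)//= eqxx mulr1 big1 ?addr0// => j ji.
by rewrite eq_sym (negbTE ji) mulr0.
Qed.

Lemma sgrad_conj_lin : sgrad (fun x => (lin c x)^*%C) (fun i _ => (c i)^*%C).
Proof. exact: sgradJ (sgrad_lin c). Qed.

Definition dweight i x : C :=
  (weight c M x ^+ 2 * M)%:C * (lin c x * (c i)^*%C + c i * (lin c x)^*%C).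

Lemma sgrad_weight : sgrad (fun x => (weight c M x)%:C) dweight.
Proof.
have h : sgrad (fun x => (1 + M * defect c x)%:C)
    (fun i x => - (M%:C * (lin c x * (c i)^*%C + c i * (lin c x)^*%C))).
  apply: eq_sgrad (sgradD (sgrad_cst 1) (sgradZ M%:C
    (sgradD (sgrad_cst 1) (sgradN (sgradM (sgrad_lin c) sgrad_conj_lin))))) => [x|i x] _.
    by rewrite -defectE; apply: complex_eqP => /=; ring.
  ring.
apply: eq_sgrad (sgrad_Rinv denom_gt0 h) => // i x Sx.
by rewrite /dweight rmorphM -/(weight c M x); ring.
Qed.

(** Differentiation gives w^2 M (z (1 - |z|^2) + conj z (tau - z^2)). The factor M disappears from
    the first term through M w (1 - |z|^2) = 1 - w and is absorbed by [twist] in the second, so a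
    factor w is kept and the quotient is bounded. *)
Lemma tanD_dweight x : S x -> tanD c dweight x = (weight c M x)%:C * weight_rate c M x.
Proof.
move=> Sx; rewrite tanDM.
have -> : tanD c (fun i x => lin c x * (c i)^*%C + c i * (lin c x)^*%C) x =
   lin c x * (1 - lin c x * (lin c x)^*%C) + (lin c x)^*%C * (tau c - lin c x * lin c x).
  rewrite tanDD tanDM tanD_conjc//; congr (_ + _).
  by under eq_fun do under eq_fun do rewrite mulrC; rewrite tanDM tanD_c.
rewrite /weight_rate /twist -{2}(weightK Sx) rmorphM rmorphXn.
set w := (weight c M x)%:C; ring.
Qed.

Definition dtwist i x : C :=
  M%:C * ((weight c M x)%:C * (- 2%:R * lin c x * c i) + dweight i x * (tau c - lin c x * lin c x)).

Lemma sgrad_twist : sgrad (twist c M) dtwist.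
Proof.
apply: eq_sgrad (sgradZ M%:C (sgradM sgrad_weight (sgradD (sgrad_cst (tau c))
  (sgradN (sgradM (sgrad_lin c) (sgrad_lin c)))))) => // i x _.
rewrite /dtwist; ring.
Qed.

(** Both factors of [twist] reproduce themselves: Y w = w times [weight_rate], and Y (tau - z^2) = -
    2 z (tau - z^2) because Y z = tau - z^2. *)
Lemma tanD_dtwist x : S x -> tanD c dtwist x = weight_rate c M x * twist c M x - 2%:R * lin c x * twist c M x.
Proof.
move=> Sx.
transitivity (M%:C * ((weight c M x)%:C * (- 2%:R * lin c x) * tanD c (fun i _ => c i) x +
    (tau c - lin c x * lin c x) * tanD c dweight x)).
  transitivity (tanD c (fun i x => M%:C * ((weight c M x)%:C * (- 2%:R * lin c x) * c i +
    (tau c - lin c x * lin c x) * dweight i x)) x).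
    by rewrite /tanD; apply: eq_bigr => i _; rewrite /dtwist; ring.
  rewrite tanDM tanDD.
  rewrite (tanDM _ (fun x => (weight c M x)%:C * (- 2%:R * lin c x)) (fun i _ => c i)).
  by rewrite (tanDM _ (fun x => tau c - lin c x * lin c x)).
by rewrite tanD_c tanD_dweight// /twist; ring.
Qed.

Lemma bmf_conj_lin : bmf (fun x => (lin c x)^*%C).
Proof. exact: bmfJ (bmf_lin c). Qed.

Lemma bmf_weight : bmf (fun x => (weight c M x)%:C).
Proof.
split; last first.
  exists 1 => x Sx; rewrite normcR ger0_norm ?weight_le1// ltW// weight_gt0//.
have [[m1 m2] _] : bmf (fun x => 1 + M%:C * (1 - lin c x * (lin c x)^*%C)).
  apply: bmfD; first exact: bmf_cst.
  apply: bmfM; first exact: bmf_cst.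
  apply: bmfB; first exact: bmf_cst.
  by apply: bmfM; [exact: bmf_lin|exact: bmf_conj_lin].
apply: cmeasurable_funR.
have mden : measurable_fun S (fun x => 1 + M * defect c x).
  apply: eq_measurable_fun m1 => x _.
  by rewrite -defectE -rmorphM.
rewrite (_ : weight c M = fun x => (1 + M * defect c x) ^-1); last by [].
apply: (@eq_measurable_fun _ _ _ _ _ (fun x => (1 + M * defect c x) `^ (-1))).
  by move=> x; rewrite inE => Sx; rewrite powR_inv1// ltW// denom_gt0.
exact: (measurableT_comp (measurable_powR _)) mden.
Qed.

Lemma bmf_twist : bmf (twist c M).
Proof.
apply: bmfM; first exact: bmf_cst.
apply: bmfM; first exact: bmf_weight.
apply: bmfB; first exact: bmf_cst.
by apply: bmfM; exact: bmf_lin.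
Qed.

Lemma bmf_dweight i : bmf (dweight i).
Proof.
apply: bmfM.
  apply: (@eq_bmf _ _ (fun x => (weight c M x)%:C ^+ 2 * M%:C)).
    by move=> x _; rewrite rmorphM rmorphXn.
  apply: bmfM; last exact: bmf_cst.
  exact: bmfX bmf_weight.
apply: bmfD; apply: bmfM => //; try exact: bmf_cst; try exact: bmf_lin.
exact: bmf_conj_lin.
Qed.

Lemma bmf_dtwist i : bmf (dtwist i).
Proof.
apply: bmfM; first exact: bmf_cst.
apply: bmfD; apply: bmfM; first exact: bmf_weight; last 2 first.
- exact: bmf_dweight.
- apply: bmfB; first exact: bmf_cst.
  by apply: bmfM; exact: bmf_lin.
apply: bmfM; last exact: bmf_cst.
by apply: bmfM; [exact: bmf_cst|exact: bmf_lin].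
Qed.

End fixed.

(** The [u] stands for uniform: the constant is chosen before [c] and [M]. *)
Definition utanCk k (F : ('I_n -> C) -> R -> 'rV[R]_n -> C) :=
  exists2 A : R, 0 <= A & forall c M, unit_coef c -> 0 < M -> tanCk c k A (F c M).

Lemma utanCkD k F G : utanCk k F -> utanCk k G -> utanCk k (fun c M x => F c M x + G c M x).
Proof.
move=> [A A0 HA] [B B0 HB]; exists (A + B); first exact: addr_ge0.
by move=> c M uc M0; apply: tanCkD; [exact: HA|exact: HB].
Qed.

Lemma utanCkM k F G : utanCk k F -> utanCk k G -> utanCk k (fun c M x => F c M x * G c M x).
Proof.
move=> [A A0 HA] [B B0 HB]; exists (2 ^+ k * A * B); first by rewrite !mulr_ge0.
by move=> c M uc M0; apply: tanCkM => //; [exact: HA|exact: HB].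
Qed.

Lemma utanCk_cst k (a : ('I_n -> C) -> C) (A : R) :
  (forall c, unit_coef c -> normc (a c) <= A) -> utanCk k (fun c M x => a c).
Proof.
move=> aA; exists `|A|; first exact: normr_ge0.
move=> c M uc _; apply: tanCk_le (tanCk_cst c k (a c)).
exact: le_trans (aA c uc) (ler_norm _).
Qed.

Lemma utanCkN k F : utanCk k F -> utanCk k (fun c M x => - F c M x).
Proof.
move=> HF; have H1 c : unit_coef c -> normc (-1 : C) <= 1 by rewrite normcN normc1.
have [A A0 HA] := utanCkM (@utanCk_cst k (fun=> -1) 1 H1) HF.
by exists A => // c M uc M0; apply: eq_tanCk (HA c M uc M0) => x _; rewrite mulN1r.
Qed.

Lemma eq_utanCk k F G : (forall c M x, unit_coef c -> 0 < M -> S x -> F c M x = G c M x) ->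
  utanCk k F -> utanCk k G.
Proof.
move=> FG [A A0 HA]; exists A => // c M uc M0.
by apply: eq_tanCk (HA c M uc M0) => x Sx; exact: FG.
Qed.

Lemma utanCkS k (F : ('I_n -> C) -> R -> 'rV[R]_n -> C) G (B : R) :
  (forall c M, unit_coef c -> 0 < M -> [/\ bmf (F c M), forall x, S x -> normc (F c M x) <= B,
    sgrad (F c M) (G c M) & forall i, bmf (G c M i)]) ->
  utanCk k (fun c M => tanD c (G c M)) -> utanCk k.+1 F.
Proof.
move=> H [A A0 HA]; exists (`|B| + A); first by rewrite addr_ge0.
move=> c M uc M0; have [bF FB FG bG] := H c M uc M0; split => //.
- by move=> x Sx; rewrite (le_trans (FB x Sx))// (le_trans (ler_norm _))// lerDl.
- by exists (G c M); split => //; apply: tanCk_le (HA c M uc M0); rewrite lerDr.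
Qed.

Lemma utanCk0 (F : ('I_n -> C) -> R -> 'rV[R]_n -> C) (B : R) :
  (forall c M, unit_coef c -> 0 < M -> bmf (F c M) /\ forall x, S x -> normc (F c M x) <= B) ->
  utanCk 0 F.
Proof.
move=> H; exists `|B|; first exact: normr_ge0.
move=> c M uc M0; have [bF FB] := H c M uc M0; split => //.
by move=> x Sx; rewrite (le_trans (FB x Sx))// ler_norm.
Qed.

Lemma utanCk_tau k : utanCk k (fun c M x => tau c).
Proof.
apply: (@utanCk_cst _ _ 1) => c uc.
apply: (le_trans (le_normc_sum _ _ _)); rewrite -uc; apply: ler_sum => i _.
by rewrite normcM.
Qed.

Lemma utanCk_one k : utanCk k (fun c M x => 1).
Proof. by apply: (@utanCk_cst _ _ 1) => c uc; rewrite normc1. Qed.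

(** The four bounds must be proved by one induction, because the derivative of each generator is a
    polynomial in all of them: Y z = tau - z^2, Y (conj z) = 1 - |z|^2, and the two
    logarithmic-derivative formulas for the weight and [twist]. All coefficients are bounded
    independently of [c] and [M]. *)
Lemma utanCk_generators k :
  [/\ utanCk k (fun c M => lin c), utanCk k (fun c M x => (lin c x)^*%C),
      utanCk k (fun c M x => (weight c M x)%:C) & utanCk k twist].
Proof.
have linB c (M : R) : unit_coef c -> 0 < M -> bmf (lin c) /\ forall x, S x -> normc (lin c x) <= 1.
  by move=> uc M0; split; [exact: bmf_lin|move=> x; exact: normc_lin_le1].
have conjB c (M : R) : unit_coef c -> 0 < M -> bmf (fun x => (lin c x)^*%C) /\
    forall x, S x -> normc (lin c x)^*%C <= 1.
  by move=> uc M0; split; [exact: bmf_conj_lin|move=> x Sx; rewrite normcJ normc_lin_le1].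
have weightB c M : unit_coef c -> 0 < M -> bmf (fun x => (weight c M x)%:C) /\
    forall x, S x -> normc (weight c M x)%:C <= 1.
  move=> uc M0; split; first exact: bmf_weight.
  by move=> x Sx; rewrite normcR ger0_norm ?weight_le1// ltW// weight_gt0.
have twistB c M : unit_coef c -> 0 < M -> bmf (twist c M) /\
    forall x, S x -> normc (twist c M x) <= 1.
  by move=> uc M0; split; [exact: bmf_twist|move=> x; exact: normc_twist_le1].
elim: k => [|k [IHl IHc IHw IHt]].
  by split; [exact: (utanCk0 linB)|exact: (utanCk0 conjB)|exact: (utanCk0 weightB)|exact: (utanCk0 twistB)].
have IHh : utanCk k (fun c M => weight_rate c M).
  apply: utanCkD; apply: utanCkM => //.
  by apply: utanCkD; [exact: utanCk_one|exact: utanCkN].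
split.
- apply: (@utanCkS _ _ (fun c M i _ => c i) 1) => [c M uc M0|].
    have [b1 b2] := linB c M uc M0; split => //; first exact: sgrad_lin.
    by move=> i; exact: bmf_cst.
  apply: (@eq_utanCk _ (fun c M x => tau c - lin c x * lin c x)) => [c M x _ _ _|].
    by rewrite tanD_c.
  by apply: utanCkD; [exact: utanCk_tau|apply: utanCkN; exact: utanCkM].
- apply: (@utanCkS _ _ (fun c M i _ => (c i)^*%C) 1) => [c M uc M0|].
    have [b1 b2] := conjB c M uc M0; split => //; first exact: sgrad_conj_lin.
    by move=> i; exact: bmf_cst.
  apply: (@eq_utanCk _ (fun c M x => 1 - lin c x * (lin c x)^*%C)) => [c M x uc _ _|].
    by rewrite tanD_conjc.
  by apply: utanCkD; [exact: utanCk_one|apply: utanCkN; exact: utanCkM].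
- apply: (@utanCkS _ _ (fun c M => dweight c M) 1) => [c M uc M0|].
    have [b1 b2] := weightB c M uc M0; split => //; first exact: sgrad_weight.
    by move=> i; exact: bmf_dweight.
  apply: (@eq_utanCk _ (fun c M x => (weight c M x)%:C * weight_rate c M x)) => [c M x uc M0 Sx|].
    by rewrite tanD_dweight.
  exact: utanCkM.
- apply: (@utanCkS _ _ (fun c M => dtwist c M) 1) => [c M uc M0|].
    have [b1 b2] := twistB c M uc M0; split => //; first exact: sgrad_twist.
    by move=> i; exact: bmf_dtwist.
  apply: (@eq_utanCk _ (fun c M x => weight_rate c M x * twist c M x - 2%:R * lin c x * twist c M x)) => [c M x uc M0 Sx|].
    by rewrite tanD_dtwist.
  apply: utanCkD; first exact: utanCkM.
  apply: utanCkN; apply: utanCkM => //; apply: utanCkM => //.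
  by apply: (@utanCk_cst _ _ 2) => c uc; rewrite normc_nat.
Qed.

Lemma utanCk_weight_rate k : utanCk k weight_rate.
Proof.
have [IHl IHc IHw IHt] := utanCk_generators k.
apply: utanCkD; apply: utanCkM => //.
by apply: utanCkD; [exact: utanCk_one|exact: utanCkN].
Qed.

Lemma utanCk_coord k i : utanCk k (fun c M x => (x ord0 i)%:C).
Proof.
elim: k => [|k IH].
  apply: (@utanCk0 _ 1) => c M _ _; split; first exact: bmf_coord.
  by move=> x Sx; rewrite normcR (le_trans (coord_le_enorm x i))// Sx.
apply: (@utanCkS _ _ (fun c M l _ => (l == i)%:R) 1) => [c M _ _|].
  split.
  - exact: bmf_coord.
  - by move=> x Sx; rewrite normcR (le_trans (coord_le_enorm x i))// Sx.
  - exact: sgrad_coord.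
  - by move=> l; exact: bmf_cst.
apply: (@eq_utanCk _ (fun c M x => c i - lin c x * (x ord0 i)%:C)) => [c M x _ _ _|].
  rewrite /tanD (bigD1 i)//= eqxx mulr1 big1 ?addr0// => l li.
  by rewrite (negbTE li) mulr0.
apply: utanCkD; first by apply: (@utanCk_cst _ (fun c => c i) 1) => c; exact: unit_coef_le1.
apply: utanCkN; apply: utanCkM => //.
by have [] := utanCk_generators k.
Qed.

(** Converts ordinary C^k bounds into bounds along Y. By definition Y u is the sum over i of (c_i -
    z x_i) times the i-th partial derivative; the coefficients are uniformly bounded at every order,
    and the partial derivative has one order less. *)
Lemma tanCk_Ck k : exists2 A : R, 0 <= A & forall c, unit_coef c ->
  forall (u : 'rV[R]_n -> R) (B : R), 0 <= B -> Ck_on k U u ->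
  (forall s, (size s <= k)%N -> forall x, S x -> `|partial s u x| <= B) ->
  tanCk c k (A * B) (fun x => (u x)%:C).
Proof.
have bm k' u B : Ck_on k' U u -> (forall x, S x -> `|u x| <= B) -> bmf (fun x => (u x)%:C).
  move=> uC uB; split; first by apply: cmeasurable_funR; exact: Ck_on_measurable uC.
  by exists B => x Sx; rewrite normcR; exact: uB.
elim: k => [|k [A A0 IH]].
  exists 1 => // c uc u B B0 uC uB; rewrite mul1r; split => //.
    by apply: (bm 0%N u B) => // x Sx; exact: (uB [::]).
  by move=> x Sx; rewrite normcR; exact: (uB [::]).
have [V V0 HV] : exists2 V : R, 0 <= V & forall i c, unit_coef c ->
    tanCk c k V (fun x => c i - lin c x * (x ord0 i)%:C).
  have VV i : utanCk k (fun c M x => c i - lin c x * (x ord0 i)%:C).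
    apply: utanCkD; first by apply: (@utanCk_cst _ (fun c => c i) 1) => c; exact: unit_coef_le1.
    apply: utanCkN; apply: utanCkM; last exact: utanCk_coord.
    by have [] := utanCk_generators k.
  have /choice[f fP] : forall i, exists A : R, 0 <= A /\ forall c, unit_coef c ->
      tanCk c k A (fun x => c i - lin c x * (x ord0 i)%:C).
    (* The coefficient does not involve [M], so the value 1 serves. *)
    by move=> i; have [X X0 HX] := VV i; exists X; split => // c uc; exact: (HX c 1 uc ltr01).
  exists (\sum_i f i); first by apply: sumr_ge0 => i _; have [] := fP i.
  move=> i c uc; have [_ /(_ c uc)] := fP i; apply: tanCk_le.
  by rewrite (bigD1 i)//= lerDl; apply: sumr_ge0 => j _; have [] := fP j.
exists (1 + n%:R * (2 ^+ k * V * A)); first by rewrite addr_ge0// !mulr_ge0.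
move=> c uc u B B0 uC uB.
have le1 : B <= (1 + n%:R * (2 ^+ k * V * A)) * B.
  by rewrite ler_peMl// lerDl !mulr_ge0.
split.
- by apply: (bm k.+1 u B) => // x Sx; exact: (uB [::]).
- by move=> x Sx; rewrite normcR (le_trans _ le1)//; exact: (uB [::]).
exists (fun i x => (partial [:: i] u x)%:C); split.
- exact: Ck_on_sgrad uC.
- move=> i; apply: (bm k _ B); first exact: Ck_on_partial.
  by move=> x Sx; exact: (uB [:: i]).
apply: (@tanCk_le _ _ _ _ (n%:R * (2 ^+ k * V * (A * B)))).
  by rewrite mulrDl mul1r -!mulrA ler_wpDl.
apply: tanCk_sum; first by rewrite !mulr_ge0.
move=> i; apply: tanCkM => //; [by rewrite mulr_ge0|exact: HV|].
apply: IH => //; first exact: Ck_on_partial.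
by move=> s sk x Sx; rewrite -partial_rcons; apply: uB => //; rewrite size_rcons.
Qed.

Definition phase c M x : C := M%:C * (lin c x)^*%C.

Lemma bmf_cexp f : bmf f -> bmf (fun x => cexp (f x)).
Proof.
move=> [mf [B fB]]; split; first exact: cmeasurable_cexp.
exists (expR B) => x Sx; rewrite normc_cexp ler_expR.
by rewrite (le_trans (ler_norm _))// (le_trans (normr_Re _))// fB.
Qed.

Lemma sgradX (f : 'rV[R]_n -> C) G m : sgrad f G ->
  sgrad (fun x => f x ^+ m.+1) (fun i x => m.+1%:R * f x ^+ m * G i x).
Proof.
move=> fG; elim: m => [|m IH].
  by apply: eq_sgrad fG => [x|i x] _; rewrite ?expr1// expr0 !mul1r.
apply: eq_sgrad (sgradM fG IH) => [x|i x] _; first by rewrite -exprS.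
by rewrite -[m.+2%:R]natr1 exprS; ring.
Qed.

Lemma tanCkN c k B f : tanCk c k B f -> tanCk c k B (fun x => - f x).
Proof.
elim: k => [|k IH] in f * => -[bf fB Hf].
  by split => //; [exact: bmfN|move=> x Sx; rewrite normcN fB].
case: Hf => G [fG mG HG]; split; first exact: bmfN.
  by move=> x Sx; rewrite normcN fB.
exists (fun i x => - G i x); split; first exact: sgradN.
  by move=> i; exact: bmfN.
apply: eq_tanCk (IH _ HG) => x _; rewrite /tanD -sumrN.
by apply: eq_bigr => i _; rewrite mulrN.
Qed.

(** Take F = e^phase w^(m+1) b. Differentiating the phase in Y F produces M (1 - |z|^2) F, and
    adding F itself turns w^(m+1) into w^m, because w (1 + M (1 - |z|^2)) = 1. Hence e^phase w^m b
    equals Y F plus e^phase w^(m+1) times b - Y b - (m+1) [weight_rate] b. The integral of Y F is (n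
    - 1) times that of z F, which joins the new amplitude. *)
Lemma oscillatory_step k m : exists2 A : R, 0 <= A & forall c M, unit_coef c -> 0 < M ->
  forall b (B : R), 0 <= B -> tanCk c k.+1 B b -> exists b', tanCk c k (A * B) b' /\
  cintegral sigma S (fun x => cexp (phase c M x) * ((weight c M x)%:C ^+ m * b x)) =
  cintegral sigma S (fun x => cexp (phase c M x) * ((weight c M x)%:C ^+ m.+1 * b' x)).
Proof.
have [A A0 HA] : utanCk k (fun c M x => 1 + (n%:R - 1) * lin c x - m.+1%:R * weight_rate c M x).
  have [IHl _ _ _] := utanCk_generators k.
  apply: utanCkD; last first.
    apply: utanCkN; apply: utanCkM; last exact: utanCk_weight_rate.
    by apply: (@utanCk_cst _ _ m.+1%:R) => c uc; rewrite normc_nat.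
  apply: utanCkD; first exact: utanCk_one.
  apply: utanCkM => //.
  exact: (@utanCk_cst _ (fun=> n%:R - 1) (normc (n%:R - 1))).
(* The first term bounds the multiplier times b by the product rule, the summand 1 bounds Y b; one
   order of regularity of b is spent on the latter. *)
exists (2 ^+ k * A + 1); first by rewrite addr_ge0// mulr_ge0.
move=> c M uc M0 b B B0 Hb; have Hb' := tanCkS Hb.
have bb := tanCk_bmf Hb.
case: Hb => _ bB [G [bG mG HG]].
pose b' x := (1 + (n%:R - 1) * lin c x - m.+1%:R * weight_rate c M x) * b x - tanD c G x.
have mE : bmf (fun x => cexp (phase c M x)).
  by apply: bmf_cexp; apply: bmfM; [exact: bmf_cst|exact: bmf_conj_lin].
have mw := bmf_weight uc M0.
have Hb'' : tanCk c k ((2 ^+ k * A + 1) * B) b'.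
  rewrite mulrDl mul1r; apply: tanCkD; first by apply: tanCkM => //; exact: HA.
  exact: tanCkN.
exists b'; split => //.
pose F x := cexp (phase c M x) * ((weight c M x)%:C ^+ m.+1 * b x).
pose GF i x := cexp (phase c M x) * ((weight c M x)%:C ^+ m.+1 * G i x +
    m.+1%:R * (weight c M x)%:C ^+ m * dweight c M i x * b x) +
   cexp (phase c M x) * (M%:C * (c i)^*%C) * ((weight c M x)%:C ^+ m.+1 * b x).
have mF : bmf F by apply: bmfM => //; apply: bmfM => //; exact: bmfX.
have mGF i : bmf (GF i).
  apply: bmfD.
    apply: bmfM => //; apply: bmfD; first by apply: bmfM => //; exact: bmfX.
    apply: bmfM => //; apply: bmfM; last exact: bmf_dweight.
    by apply: bmfM; [exact: bmf_cst|exact: bmfX].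
  apply: bmfM; first by apply: bmfM => //; exact: bmf_cst.
  by apply: bmfM => //; exact: bmfX.
have gF : sgrad F GF.
  apply: sgradM; first by apply: sgrad_cexp; apply: sgradZ; exact: sgrad_conj_lin.
  apply: eq_sgrad (sgradM (sgradX m (sgrad_weight uc M0)) bG) => // i x _.
have ibp := cintegral_tanD c mF mGF gF.
have mlF : bmf (fun x => lin c x * F x) by apply: bmfM => //; exact: bmf_lin.
have mtF : bmf (tanD c GF) by exact: bmf_tanD.
have mb' : bmf b' by exact: tanCk_bmf Hb''.
have mEb : bmf (fun x => cexp (phase c M x) * ((weight c M x)%:C ^+ m.+1 * b' x)).
  by apply: bmfM => //; apply: bmfM => //; exact: bmfX.
have mS := @measurable_sphere R n.
rewrite (@eq_cintegral _ _ _ _ _ _ (fun x => (cexp (phase c M x) * ((weight c M x)%:C ^+ m.+1 * b' x)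
   + tanD c GF x) + (- (n%:R - 1)) * (lin c x * F x))).
  rewrite cintegralD//; last 2 first.
  - by apply: bmf_cintegrable; exact: bmfD.
  - by apply: bmf_cintegrable; apply: bmfM => //; exact: bmf_cst.
  rewrite cintegralD//; try exact: bmf_cintegrable.
  rewrite cintegralZ//; last exact: bmf_cintegrable.
  by rewrite ibp mulNr addrK.
move=> x Sx.
have -> : tanD c GF x = cexp (phase c M x) * ((weight c M x)%:C ^+ m.+1 * tanD c G x +
   m.+1%:R * (weight c M x)%:C ^+ m * b x * ((weight c M x)%:C * weight_rate c M x)) +
   cexp (phase c M x) * M%:C * ((weight c M x)%:C ^+ m.+1 * b x) * (1 - lin c x * (lin c x)^*%C).
  transitivity (tanD c (fun i x => cexp (phase c M x) * (weight c M x)%:C ^+ m.+1 * G i x +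
     (cexp (phase c M x) * m.+1%:R * (weight c M x)%:C ^+ m * b x * dweight c M i x +
      cexp (phase c M x) * M%:C * ((weight c M x)%:C ^+ m.+1 * b x) * (c i)^*%C)) x).
    by rewrite /tanD; apply: eq_bigr => i _; rewrite /GF; ring.
  rewrite !tanDD tanDM (tanDM _ (fun x => cexp (phase c M x) * m.+1%:R * (weight c M x)%:C ^+ m * b x)).
  rewrite (tanDM _ (fun x => cexp (phase c M x) * M%:C * ((weight c M x)%:C ^+ m.+1 * b x))).
  rewrite tanD_dweight// tanD_conjc//; ring.
rewrite /b' /F exprS.
transitivity (cexp (phase c M x) * ((weight c M x)%:C ^+ m * b x) *
  ((weight c M x)%:C * (1 + M%:C * (1 - lin c x * (lin c x)^*%C)))).
  by rewrite weightK// mulr1.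
ring.
Qed.

End oscillatory.

(** * The integral of the weight over the sphere *)

Section weight_integral.
Variables (R : realType) (n : nat).
Local Notation C := R[i].
Local Notation S := (@sphere R n).
Local Notation sigma := (@surface_measure R n).
Local Notation leb := (@lebesgue_rV R n).
Local Notation e_ i := (delta_mx (ord0 : 'I_1) (i : 'I_n) : 'rV[R]_n).

(** Lagrange's identity writes the right side as half the sum of the squared 2 x 2 minors over all
    ordered pairs. The pairs (i, j) and (j, i) alone contribute the left side. *)
Lemma lagrange_ge (m x : 'I_n -> R) i j : i != j ->
  (m i * x j - m j * x i) ^+ 2 <=
  (\sum_k m k ^+ 2) * (\sum_k x k ^+ 2) - (\sum_k m k * x k) ^+ 2.
Proof.
move=> ij.
pose F k l := (m k * x l - m l * x k) ^+ 2.
have F0 k l : 0 <= F k l by exact: sqr_ge0.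
have E : \sum_k \sum_l F k l =
    2 * ((\sum_k m k ^+ 2) * (\sum_k x k ^+ 2) - (\sum_k m k * x k) ^+ 2).
  transitivity (\sum_k \sum_l (m k ^+ 2 * x l ^+ 2) + \sum_k \sum_l (x k ^+ 2 * m l ^+ 2)
      - 2 * \sum_k \sum_l (m k * x k) * (m l * x l)).
    rewrite mulr_sumr -sumrN -!big_split/=; apply: eq_bigr => k _.
    rewrite mulr_sumr -sumrN -!big_split/=; apply: eq_bigr => l _.
    by rewrite /F; ring.
  have D (f g : 'I_n -> R) : \sum_k \sum_l f k * g l = (\sum_k f k) * \sum_l g l.
    by rewrite mulr_suml; apply: eq_bigr => k _; rewrite mulr_sumr.
  by rewrite (D (fun k => m k ^+ 2) (fun k => x k ^+ 2)) (D (fun k => x k ^+ 2) (fun k => m k ^+ 2))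
    (D (fun k => m k * x k) (fun k => m k * x k)); ring.
have S0 k : 0 <= \sum_l F k l by apply: sumr_ge0.
have : F i j + F j i <= \sum_k \sum_l F k l.
  pose T k := \sum_l F k l.
  have Tij k l : F k l <= T k by rewrite /T (bigD1 l)//= ler_wpDr// sumr_ge0.
  rewrite -[leRHS]/(\sum_k T k) (bigD1 i)//= (bigD1 j)/=; last by rewrite eq_sym.
  by rewrite addrA ler_wpDr ?lerD// sumr_ge0// => k _; exact: S0.
rewrite E -/(F i j) (_ : F j i = F i j); last by rewrite /F; ring.
by move: (F i j) (_ - _) => f g; lra.
Qed.

Lemma cauchy_schwarz_sum (m x : 'I_n -> R) :
  0 <= (\sum_k m k ^+ 2) * (\sum_k x k ^+ 2) - (\sum_k m k * x k) ^+ 2.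
Proof.
have [/existsP[i /existsP[j ij]]|/existsPn H] := boolP [exists i : 'I_n, exists j : 'I_n, i != j].
  by apply: le_trans (lagrange_ge m x ij); exact: sqr_ge0.
have H' (i j : 'I_n) : i = j by have /existsPn /(_ j) := H i; rewrite negbK => /eqP.
clear H; case: n m x H' => [|n'] m x H'.
  by rewrite !big_ord0 mul0r expr0n subr0.
have E (f : 'I_n'.+1 -> R) : \sum_k f k = f ord0.
  by rewrite (bigD1 ord0)//= big1 ?addr0// => k; rewrite (H' k ord0) eqxx.
by rewrite !E; rewrite exprMn subrr.
Qed.

Lemma ge0_integral_shears i (kap : 'I_n -> R) (l : seq 'I_n) (f : 'rV[R]_n -> \bar R) :
  i \notin l -> measurable_fun setT f -> (forall x, 0 <= f x)%E ->
  (\int[leb]_y f (y + (y : 'rV[R]_n) ord0 i *: \sum_(j <- l) kap j *: e_ j)%R = \int[leb]_y f y)%E.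
Proof.
elim: l f => [|j l IH] f.
  by move=> _ mf f0; apply: eq_integral => y _; rewrite big_nil scaler0 addr0.
rewrite in_cons negb_or => /andP[ij il] mf f0.
pose v : 'rV[R]_n := \sum_(j <- l) kap j *: e_ j.
pose f1 y := f (y + (y : 'rV[R]_n) ord0 i *: v).
have mf1 : measurable_fun setT f1.
  apply: (measurableT_comp mf); apply: measurable_fun_rVP => k.
  rewrite (_ : _ \o _ = fun x : 'rV[R]_n => x ord0 k + x ord0 i * v ord0 k); last first.
    by apply/funext => x; rewrite /rV_coord /= !mxE.
  by apply: measurable_funD; [|apply: measurable_funM => //]; exact: measurable_rV_coord.
rewrite -[RHS](IH f)//.
rewrite -[RHS](@ge0_integral_shear _ _ j i (kap j) f1)//; last 2 first.
- by rewrite eq_sym.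
- by move=> y; exact: f0.
apply: eq_integral => y _; rewrite /f1; congr f.
rewrite !mxE eqxx (negbTE ij)/= mulr0 addr0 big_cons -/v scalerDr addrA scalerA.
by rewrite [kap j * _]mulrC.
Qed.

(** A product majorant for w^(n-1), with one Cauchy-type factor for each of the n - 1 coordinates
    other than [i]. *)
Definition cone_weight (i : 'I_n) (kap : 'I_n -> R) (K : R) (x : 'rV[R]_n) : R :=
  \prod_(j | j != i) (1 + (K * (x ord0 j - kap j * x ord0 i)) ^+ 2)^-1.

Lemma cone_weight_ge0 i kap K x : 0 <= cone_weight i kap K x.
Proof. by apply: prodr_ge0 => j _; rewrite invr_ge0 addr_ge0// sqr_ge0. Qed.

Lemma continuous_bump (K : R) : continuous (fun t : R => (1 + (K * t) ^+ 2)^-1).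
Proof.
move=> t; apply: cvgV; first by rewrite gt_eqF// ltr_pwDl// sqr_ge0.
apply: cvgD; first exact: cvg_cst.
rewrite (_ : (fun t => (K * t) ^+ 2) = (fun t => (K * t) * (K * t))); last first.
  by apply/funext => s; rewrite expr2.
by apply: cvgM; apply: cvgM; try exact: cvg_cst; exact: cvg_id.
Qed.

Lemma measurable_cone_weight i kap K : measurable_fun setT (cone_weight i kap K).
Proof.
pose bump t : R := (1 + (K * t) ^+ 2)^-1.
have mbump : measurable_fun setT bump by apply: continuous_measurable_fun; exact: continuous_bump.
rewrite (_ : cone_weight i kap K = fun x : 'rV[R]_n => \prod_(j < n)
   (if j != i then bump (x ord0 j - kap j * x ord0 i) else 1)); last first.
  by apply/funext => x; rewrite /cone_weight big_mkcond.
apply: measurable_prod => j _; case: (j != i) => //.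
apply: (measurableT_comp mbump); apply: measurable_funB; first exact: measurable_rV_coord.
by apply: measurable_funM => //; exact: measurable_rV_coord.
Qed.

(** In polar coordinates the integrand is evaluated at y / |y| with |y| <= 1. Replacing y / |y| by y
    shrinks every x_j - kap_j x_i and so enlarges each factor. Then y_i is confined to [-1, 1],
    which gives 2, the shears remove the [kap] terms, and each other coordinate gives pi / K. The
    factor n comes from the polar formula. The bound depends on neither [i] nor [kap]. *)
Lemma integral_cone_weight i kap K : 0 < K ->
  (\int[sigma]_x (cone_weight i kap K x)%:E <= (n%:R * 2 * (pi / K) ^+ n.-1)%:E)%E.
Proof.
move=> K0.
pose bump t : R := (1 + (K * t) ^+ 2)^-1.
have mbump : measurable_fun setT bump by apply: continuous_measurable_fun; exact: continuous_bump.
have bump0 t : 0 <= bump t by rewrite invr_ge0 addr_ge0// sqr_ge0.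
pose I1 : set R := `[-1, 1]%classic.
have mI1 : measurable I1 by exact: measurable_itv.
pose g (j : 'I_n) (t : R) : R := if j == i then \1_I1 t else bump t.
have mg j : measurable_fun setT (g j).
  by rewrite /g; case: (j == i) => //; exact: measurable_indic.
have g0 j t : 0 <= g j t by rewrite /g; case: ifP.
pose G (y : 'rV[R]_n) : \bar R := (\prod_j g j (y ord0 j))%:E.
have mG : measurable_fun setT G.
  apply/measurable_EFinP; apply: measurable_prod => j _.
  exact: (measurableT_comp (mg j) (measurable_rV_coord j)).
have G0 y : (0 <= G y)%E by rewrite lee_fin prodr_ge0.
pose l := [seq j <- enum 'I_n | j != i].
have il : i \notin l by rewrite mem_filter eqxx.
have shE (y : 'rV[R]_n) j : (y + y ord0 i *: \sum_(j <- l) (- kap j) *: e_ j) ord0 j =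
    if j == i then y ord0 i else y ord0 j - kap j * y ord0 i.
  rewrite !mxE summxE big_filter big_enum_cond/=.
  have [->|ji] := eqVneq j i.
    rewrite big1 ?mulr0 ?addr0// => k /negbTE ki.
    by rewrite !mxE eq_sym ki andbF mulr0.
  rewrite (bigD1 j)//= big1 ?addr0 => [|k /andP[_ kj]].
    by rewrite !mxE !eqxx mulr1 mulrN mulrC.
  by rewrite !mxE eq_sym (negbTE kj) andbF mulr0.
have mcw := measurable_cone_weight i kap K.
have mcwE : measurable_fun setT (fun x => (cone_weight i kap K x)%:E) by exact/measurable_EFinP.
rewrite ge0_integral_surface//; last by move=> x; rewrite lee_fin cone_weight_ge0.
rewrite -mulrA EFinM; apply: lee_wpmul2l => //.
apply: (@le_trans _ _ (\int[leb]_y G (y + (y : 'rV[R]_n) ord0 i *: \sum_(j <- l) (- kap j) *: e_ j)%R)%E).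
  rewrite integral_mkcond; apply: ge0_le_integral => //.
  - by move=> x _; rewrite patchE; case: ifP => // _; rewrite lee_fin cone_weight_ge0.
  - apply/(measurable_restrictT _ _).1; first exact: measurable_punctured_ball.
    apply: measurable_funTS; exact: (measurableT_comp mcwE (@measurable_unit_dir R n)).
  - apply: (measurableT_comp mG); apply: measurable_fun_rVP => k.
    rewrite (_ : _ \o _ = fun x : 'rV[R]_n => x ord0 k +
        x ord0 i * (\sum_(j <- l) (- kap j) *: e_ j : 'rV[R]_n) ord0 k); last first.
      by apply/funext => x; rewrite /rV_coord /= !mxE.
    by apply: measurable_funD; [|apply: measurable_funM => //]; exact: measurable_rV_coord.
  move=> y _; rewrite patchE; case: ifPn => [|_]; last exact: G0.
  rewrite inE/= => /andP[y0 y1]; rewrite lee_fin /cone_weight.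
  rewrite [leRHS](bigD1 i)//= [X in _ <= X * _](_ : _ = 1) ?mul1r; last first.
    rewrite shE /g eqxx indicE mem_set//.
    by rewrite /I1/= in_itv/= -ler_norml (le_trans (coord_le_enorm y i)).
  apply: ler_prod => j ji; rewrite -/(bump _) bump0/= /g (negbTE ji) shE (negbTE ji).
  rewrite /bump /unit_dir !mxE.
  rewrite lef_pV2 ?posrE; try by rewrite ltr_pwDl// sqr_ge0.
  rewrite lerD2l.
  rewrite (_ : K * ((enorm y)^-1 * y ord0 j - kap j * ((enorm y)^-1 * y ord0 i)) =
     (enorm y)^-1 * (K * (y ord0 j - kap j * y ord0 i))); last by ring.
  rewrite [leRHS]exprMn ler_peMl ?sqr_ge0//.
  by rewrite exprVn invf_ge1 ?exprn_gt0// exprn_ile1// ltW.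
rewrite (ge0_integral_shears _ il)//.
rewrite (ge0_integral_prod_rV mg g0) (bigD1 i)//= {1}/g eqxx.
rewrite integral_indic// setIT.
rewrite [X in (X * _ <= _)%E](_ : _ = 2%:E); last first.
  by rewrite [LHS]lebesgue_measure_itv/= lte_fin gtrN// -EFinB opprK.
rewrite (eq_bigr (fun=> (pi / K)%:E)); last first.
  move=> j ji; rewrite -(integral_oneDsqr_scale K0).
  by apply: eq_integral => t _; rewrite /g (negbTE ji).
rewrite -(big_morph (@EFin R) (@EFinM R) (erefl : 1%:E = 1%E)).
by rewrite prodr_const cardC1 card_ord -EFinM.
Qed.

Lemma normc_lin_sqr (c : 'I_n -> C) (x : 'rV[R]_n) : normc (lin c x) ^+ 2 =
  (\sum_k complex.Re (c k) * x ord0 k) ^+ 2 + (\sum_k complex.Im (c k) * x ord0 k) ^+ 2.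
Proof.
rewrite sqr_normcE; congr (_ ^+ 2 + _ ^+ 2).
  rewrite /lin (big_morph (@complex.Re R) (@ReD R) (erefl : complex.Re (0 : C) = 0)).
  by apply: eq_bigr => k _; rewrite ReM /= mulr0 subr0.
rewrite /lin (big_morph (@complex.Im R) (@ImD R) (erefl : complex.Im (0 : C) = 0)).
by apply: eq_bigr => k _; rewrite ImM /= mulr0 add0r.
Qed.

(** With c = r + i s, the defect is the sum of the Cauchy-Schwarz deficits of (r, x) and (s, x). One
    of them is discarded, and Lagrange's identity bounds the other below by a single minor, divided
    through by its largest guaranteed coefficient. *)
Lemma defect_ge (c : 'I_n -> C) : (0 < n)%N -> unit_coef c ->
  exists (i : 'I_n) (kap : 'I_n -> R), forall x j, S x -> j != i ->
  (2 * n%:R)^-1 * (x ord0 j - kap j * x ord0 i) ^+ 2 <= defect c x.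
Proof.
move=> n0 uc.
pose r i := complex.Re (c i); pose s i := complex.Im (c i).
have rs1 : \sum_k r k ^+ 2 + \sum_k s k ^+ 2 = 1.
  by rewrite -uc -big_split; apply: eq_bigr => k _; rewrite sqr_normcE.
have nR : 0 < n%:R :> R by rewrite ltr0n.
(* Pigeonhole: the n numbers |c_i|^2 sum to 1. One of r_i^2, s_i^2 is then at least 1 / (2n), and
   that part of [c] is the one retained. *)
have [i iP] : exists i, (n%:R)^-1 <= r i ^+ 2 + s i ^+ 2.
  apply/not_existsP => H.
  have : \sum_(i < n) (r i ^+ 2 + s i ^+ 2) < \sum_(i < n) (n%:R)^-1.
    apply: ltr_sum; last by move=> i _; rewrite ltNge; apply/negP; exact: H.
    by apply/hasP; exists (Ordinal n0); rewrite ?mem_index_enum.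
  rewrite big_split/= rs1 [X in _ < X](_ : _ = 1) ?ltxx//.
  by rewrite sumr_const card_ord -[LHS]mulr_natr mulVf// gt_eqF.
have main (m o : 'I_n -> R) : (2 * n%:R)^-1 <= m i ^+ 2 ->
    (forall x, S x -> defect c x =
      ((\sum_k m k ^+ 2) * (\sum_k x ord0 k ^+ 2) - (\sum_k m k * x ord0 k) ^+ 2) +
      ((\sum_k o k ^+ 2) * (\sum_k x ord0 k ^+ 2) - (\sum_k o k * x ord0 k) ^+ 2)) ->
    exists (i : 'I_n) (kap : 'I_n -> R), forall x j, S x -> j != i ->
    (2 * n%:R)^-1 * (x ord0 j - kap j * x ord0 i) ^+ 2 <= defect c x.
  move=> mi dE; exists i, (fun j => m j / m i) => x j Sx ji.
  have mi0 : m i != 0.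
    by apply: contraTneq mi => ->; rewrite expr0n/= -ltNge invr_gt0 mulr_gt0.
  rewrite dE// ler_wpDr ?cauchy_schwarz_sum//.
  have ij : i != j by rewrite eq_sym.
  apply: le_trans (lagrange_ge m (fun k => x ord0 k) ij).
  apply: (@le_trans _ _ (m i ^+ 2 * (x ord0 j - m j / m i * x ord0 i) ^+ 2)).
    by rewrite ler_wpM2r// sqr_ge0.
  rewrite -exprMn (_ : m i * (x ord0 j - m j / m i * x ord0 i) = m i * x ord0 j - m j * x ord0 i)//.
  by rewrite mulrBr [m j / m i]mulrC !mulrA mulfV// mul1r.
have xE x : S x -> \sum_k x ord0 k ^+ 2 = 1.
  move=> Sx; transitivity (dot x x); last by rewrite -enorm_sqr Sx expr1n.
  by apply: eq_bigr => k _; rewrite expr2.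
have [ri|si] := lerP (2 * n%:R)^-1 (r i ^+ 2).
  apply: (main r s) => // x Sx.
  by rewrite /defect normc_lin_sqr -rs1 (xE x Sx) !mulr1 /r /s; ring.
apply: (main s r) => [|x Sx].
  have h : (n%:R)^-1 = (2 * n%:R)^-1 + (2 * n%:R)^-1 :> R by field; rewrite gt_eqF.
  by move: iP si; rewrite h; lra.
by rewrite /defect normc_lin_sqr -rs1 (xE x Sx) !mulr1 /r /s; ring.
Qed.

Lemma Rintegral_weight : (0 < n)%N -> exists2 A : R, 0 <= A &
  forall (c : 'I_n -> C) (M : R), unit_coef c -> 0 < M ->
  \int[sigma]_(x in S) (weight c M x ^+ n.-1) <= A * (Num.sqrt M)^-1 ^+ n.-1.
Proof.
move=> n0; have nR : 0 < n%:R :> R by rewrite ltr0n.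
pose K0 : R := Num.sqrt (2 * n%:R)^-1.
have K00 : 0 < K0 by rewrite sqrtr_gt0 invr_gt0 mulr_gt0.
exists (n%:R * 2 * (pi / K0) ^+ n.-1).
  by rewrite !mulr_ge0// exprn_ge0// divr_ge0 ?pi_ge0// ltW.
(* The pivot [i] and the slopes [kap] vary with [c], but the bound on the integral of [cone_weight]
   does not, so the constant is uniform. The scale K below is chosen so that K^2 = M / (2n). *)
move=> c M uc M0; have [i [kap H]] := defect_ge n0 uc.
pose K := K0 * Num.sqrt M.
have K_gt0 : 0 < K by rewrite mulr_gt0// sqrtr_gt0.
have K2 : K ^+ 2 = M * (2 * n%:R)^-1.
  by rewrite exprMn !sqr_sqrtr ?invr_ge0 ?mulr_ge0 ?ltW// mulrC.
have le1 x : S x -> weight c M x ^+ n.-1 <= cone_weight i kap K x.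
  move=> Sx; rewrite (_ : weight c M x ^+ n.-1 = \prod_(j | j != i) weight c M x); last first.
    by rewrite prodr_const cardC1 card_ord.
  apply: ler_prod => j ji; rewrite (ltW (weight_gt0 uc M0 Sx))/= /weight.
  rewrite lef_pV2 ?posrE ?denom_gt0//; last by rewrite ltr_pwDl// sqr_ge0.
  by rewrite lerD2l exprMn K2 -mulrA ler_pM2l// H.
have [[mw _] _] := bmf_weight uc M0.
have iw : sigma.-integrable S (EFin \o (fun x => weight c M x ^+ n.-1)).
  apply: (@integrable_sphere _ _ _ 1); first exact: measurable_funX.
  move=> x Sx; rewrite ger0_norm ?exprn_ge0 ?(ltW (weight_gt0 uc M0 Sx))//.
  by rewrite exprn_ile1 ?weight_le1// (ltW (weight_gt0 uc M0 Sx)).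
have mS := @measurable_sphere R n.
rewrite /Rintegral -lee_fin fineK ?integral_fune_fin_num//.
have -> : n%:R * 2 * (pi / K0) ^+ n.-1 * (Num.sqrt M)^-1 ^+ n.-1 = n%:R * 2 * (pi / K) ^+ n.-1.
  have -> : pi / K = pi / K0 / Num.sqrt M by rewrite /K invfM mulrA.
  by rewrite [in RHS]exprMn mulrA.
apply: le_trans (integral_cone_weight i kap K_gt0).
rewrite integral_mkcond; apply: ge0_le_integral => //.
- move=> x _; rewrite patchE; case: ifP => //; rewrite inE => Sx.
  by rewrite lee_fin exprn_ge0// (ltW (weight_gt0 uc M0 Sx)).
- by apply/(measurable_restrictT _ _).1 => //; apply: measurable_int iw.
- by apply/measurable_EFinP; exact: measurable_cone_weight.
- move=> x _; rewrite patchE; case: ifP; last by rewrite lee_fin cone_weight_ge0.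
  by rewrite inE => Sx; rewrite lee_fin le1.
Qed.

End weight_integral.

(** * Decay of the oscillatory integral for an arbitrary complex vector *)

Section oscillatory_bound.
Variables (R : realType) (n : nat).
Local Notation C := R[i].
Local Notation S := (@sphere R n).
Local Notation sigma := (@surface_measure R n).

Lemma oscillatory_iter k m : exists2 A : R, 0 <= A & forall (c : 'I_n -> C) M, unit_coef c -> 0 < M ->
  forall b (B : R), 0 <= B -> tanCk c k B b -> exists b', [/\ bmf b', forall x, S x -> normc (b' x) <= A * B &
  cintegral sigma S (fun x => cexp (phase c M x) * ((weight c M x)%:C ^+ m * b x)) =
  cintegral sigma S (fun x => cexp (phase c M x) * ((weight c M x)%:C ^+ (m + k) * b' x))].
Proof.
elim: k m => [|k IH] m.
  exists 1 => // c M uc M0 b B B0 [bb bB _]; exists b; split => //.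
    by move=> x Sx; rewrite mul1r bB.
  by rewrite addn0.
have [A A0 HA] := @oscillatory_step R n k m.
have [A' A'0 HA'] := IH m.+1.
exists (A' * A) => [|c M uc M0 b B B0 Hb]; first exact: mulr_ge0.
have [b1 [Hb1 E1]] := HA c M uc M0 b B B0 Hb.
have [b2 [bb2 b2B E2]] := HA' c M uc M0 b1 (A * B) (mulr_ge0 A0 B0) Hb1.
exists b2; split => //; first by move=> x Sx; rewrite -mulrA b2B.
by rewrite E1 E2 addSnnS.
Qed.

Lemma sqrt_decay (M : R) : (0 < n)%N -> 1 <= M ->
  (Num.sqrt M)^-1 ^+ n.-1 <= 2 `^ ((n%:R - 1) / 2) * (1 + M) `^ (- ((n%:R - 1) / 2)).
Proof.
move=> n0 M1; have M0 : 0 < M by exact: lt_le_trans ltr01 M1.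
set al := (n%:R - 1) / 2.
have al0 : 0 <= al by rewrite divr_ge0// subr_ge0 ler1n.
have -> : (Num.sqrt M)^-1 ^+ n.-1 = (M `^ al)^-1.
  rewrite exprVn; congr (_^-1).
  rewrite -powR12_sqrt ?ltW// -powR_mulrn ?powR_ge0// -powRrM; congr (_ `^ _).
  have E1 : n%:R = n.-1%:R + 1 :> R by rewrite natr1 prednK.
  by rewrite /al E1 addrK mulrC.
rewrite powRN ler_pdivlMr ?powR_gt0 ?addr_gt0// mulrC ler_pdivrMr ?powR_gt0//.
have -> : 2 `^ al * M `^ al = (2 * M) `^ al by rewrite powRM// ltW.
apply: ge0_ler_powR => //; rewrite ?nnegrE ?addr_ge0 ?mulr_ge0 ?(ltW M0)//.
by rewrite mulr_natl mulr2n lerD2r.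
Qed.

(** The amplitude bound is required for every unit [c] because the direction of Y is dictated by
    [v]: it is c = conj v / M with M the length of [v]. After n - 1 steps the exponential is
    estimated by its maximum [expR rho] and the weight is integrated. *)
Lemma oscillatory_bound : (0 < n)%N -> exists2 A : R, 0 <= A &
  forall (v : 'I_n -> C) (rho B : R) b, 0 <= B -> (forall c, unit_coef c -> tanCk c n.-1 B b) ->
  (forall x, S x -> complex.Re (lin v x) <= rho) ->
  normc (cintegral sigma S (fun x => cexp (lin v x) * b x)) <=
  A * B * expR rho * (1 + Num.sqrt (\sum_i normc (v i) ^+ 2)) `^ (- ((n%:R - 1) / 2)).
Proof.
move=> n0; have mS := @measurable_sphere R n.
set al := (n%:R - 1) / 2.
have al0 : 0 <= al by rewrite divr_ge0// subr_ge0 ler1n.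
have [A1 A10 HA1] := @oscillatory_iter n.-1 0.
have [A2 A20 HA2] := @Rintegral_weight R n n0.
pose s := fine (sigma S).
have s0 : 0 <= s by rewrite fine_ge0// measure_ge0.
pose A : R := 2 `^ al * (2 * s + 2 * A1 * A2).
have t0 : 0 <= (2 : R) `^ al by exact: powR_ge0.
exists A; first by rewrite mulr_ge0// addr_ge0 ?mulr_ge0.
move=> v rho B b B0 Hb vrho.
(* Any unit vector serves here: it only extracts boundedness and measurability of b from the
   hypothesis. *)
have uc0 : unit_coef (fun i : 'I_n => (i == Ordinal n0)%:R : C).
  rewrite /unit_coef (bigD1 (Ordinal n0))// big1.
    by rewrite eqxx normc_nat expr1n [LHS]addr0.
  by move=> i /negbTE ->; rewrite normc_nat expr0n.
have bb := tanCk_bmf (Hb _ uc0); have bB := tanCk_bound (Hb _ uc0).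
have e0 := expR_ge0 rho.
pose M := Num.sqrt (\sum_i normc (v i) ^+ 2).
(* For M <= 1, including v = 0 where [c] is undefined, the trivial estimate suffices because (1 + M)
   [^ al <= 2]^ al. The constant [A] adds the contributions of the two cases. *)
rewrite -/M; have [M1|M1] := lerP M 1.
  have b1 : normc (cintegral sigma S (fun x => cexp (lin v x) * b x)) <= 2 * (expR rho * B * s).
    have cE : bmf (fun x => cexp (lin v x) * b x).
      by apply: bmfM => //; apply: bmf_cexp; exact: bmf_lin.
    rewrite /s -Rintegral_cst//; apply: normc_cintegral_le => //.
    - exact: bmf_cintegrable.
    - by apply: (@integrable_sphere _ _ _ `|expR rho * B|) => //; exact: measurable_cst.
    - move=> x Sx; rewrite normcM normc_cexp ler_pM ?expR_ge0 ?normc_ge0 ?bB//.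
      by rewrite ler_expR vrho.
  apply: (le_trans b1).
  have h : 1 <= 2 `^ al * (1 + M) `^ (- al).
    rewrite powRN ler_pdivlMr ?mul1r ?powR_gt0 ?ltr_pwDl ?sqrtr_ge0//.
    apply: ge0_ler_powR => //; rewrite ?nnegrE ?addr_ge0 ?sqrtr_ge0//.
    by rewrite (_ : 2 = 1 + 1)// lerD2l.
  rewrite (_ : A * B * expR rho * _ = (2 * (expR rho * B * (s + A1 * A2))) * (2 `^ al * (1 + M) `^ (- al))); last first.
    by rewrite /A; ring.
  apply: (@le_trans _ _ (2 * (expR rho * B * (s + A1 * A2)))).
    by rewrite !ler_wpM2l ?mulr_ge0// lerDl mulr_ge0.
  by rewrite ler_peMr// !mulr_ge0// addr_ge0// mulr_ge0.
have M0 : 0 < M by exact: lt_trans ltr01 M1.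
pose c i := (v i)^*%C * (M^-1)%:C.
have uc : unit_coef c.
  rewrite /unit_coef; under eq_bigr do rewrite /c normcM normcJ normcR exprMn.
  rewrite -mulr_suml ger0_norm ?invr_ge0 ?ltW// exprVn /M sqr_sqrtr.
    rewrite mulfV//; apply: contraTneq M0 => E; rewrite /M E sqrtr0 ltxx//.
  by apply: sumr_ge0 => i _; rewrite sqr_ge0.
have phE x : phase c M x = lin v x.
  rewrite /phase conj_lin mulr_sumr; apply: eq_bigr => i _.
  rewrite /c rmorphM /= conjcK oppr0 -[_ +i* 0]/((M^-1)%:C) mulrA.
  by rewrite mulrCA -rmorphM mulfV ?gt_eqF// rmorph1 mulr1.
have [b' [bb' b'B E]] := HA1 c M uc M0 b B B0 (Hb c uc).
have -> : cintegral sigma S (fun x => cexp (lin v x) * b x) =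
   cintegral sigma S (fun x => cexp (phase c M x) * ((weight c M x)%:C ^+ (0 + n.-1) * b' x)).
  by rewrite -E; apply: eq_cintegral => x _; rewrite expr0 mul1r phE.
rewrite add0n.
have mw := bmf_weight uc M0.
have w0 x : S x -> 0 <= weight c M x by move=> Sx; rewrite ltW// weight_gt0.
have mEb : bmf (fun x => cexp (phase c M x) * ((weight c M x)%:C ^+ n.-1 * b' x)).
  apply: bmfM; last by apply: bmfM => //; exact: bmfX.
  by apply: bmf_cexp; apply: bmfM; [exact: bmf_cst|exact: bmf_conj_lin].
have [[mw1 _] _] := mw.
have iw : sigma.-integrable S (EFin \o (fun x => weight c M x ^+ n.-1)).
  apply: (@integrable_sphere _ _ _ 1); first exact: measurable_funX.
  move=> x Sx; rewrite ger0_norm ?exprn_ge0 ?w0//.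
  by rewrite exprn_ile1 ?weight_le1// w0.
apply: (@le_trans _ _ (2 * \int[sigma]_(x in S) (expR rho * (A1 * B) * weight c M x ^+ n.-1))).
  apply: normc_cintegral_le => //.
  - exact: bmf_cintegrable.
  - by apply: eq_integrable (integrableZl mS (expR rho * (A1 * B)) iw).
  - move=> x Sx; rewrite normcM normc_cexp normcM phE -rmorphXn normcR ger0_norm ?exprn_ge0 ?w0//.
    rewrite mulrA mulrAC -!mulrA ler_pM ?expR_ge0 ?mulr_ge0 ?normc_ge0 ?exprn_ge0 ?w0//.
      by rewrite ler_expR vrho.
    by rewrite mulrA ler_wpM2r ?exprn_ge0 ?w0// b'B.
rewrite RintegralZl//.
apply: (@le_trans _ _ (2 * (expR rho * (A1 * B) * (A2 * (2 `^ al * (1 + M) `^ (- al)))))).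
  rewrite !ler_wpM2l ?mulr_ge0//; apply: le_trans (HA2 c M uc M0) _.
  by rewrite ler_wpM2l// sqrt_decay// ltW.
rewrite [leRHS](_ : _ = 2 * (expR rho * B * (s + A1 * A2)) * (2 `^ al * (1 + M) `^ (- al))); last first.
  by rewrite /A; ring.
rewrite [leLHS](_ : _ = 2 * (expR rho * B * (A1 * A2)) * (2 `^ al * (1 + M) `^ (- al))); last by ring.
by rewrite ler_wpM2r ?mulr_ge0 ?powR_ge0// !ler_wpM2l ?mulr_ge0// lerDr.
Qed.

End oscillatory_bound.

(** * The Schwartz kernel *)

Section fubini_dominated.
Context d1 d2 (T1 : measurableType d1) (T2 : measurableType d2) (R : realType).
Variables (m1 : {sigma_finite_measure set T1 -> \bar R})
  (m2 : {sigma_finite_measure set T2 -> \bar R}).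
Local Notation C := R[i].
Variables (h1 : T1 -> R) (h2 : T2 -> R).
Hypotheses (ih1 : m1.-integrable setT (EFin \o h1)) (ih2 : m2.-integrable setT (EFin \o h2)).

(** Domination by a product of integrable functions gives integrability on the product and of every
    section, not just almost every one, so the iterated real integrals contain no default values. *)
Lemma integrable_prod_dominated (f : T1 * T2 -> R) : measurable_fun setT f ->
  (forall p, `|f p| <= h1 p.1 * h2 p.2) -> (m1 \x m2)%E.-integrable setT (EFin \o f).
Proof.
move=> mf fh.
have mh1 : measurable_fun setT h1 by apply/measurable_EFinP; exact: measurable_int ih1.
have mh2 : measurable_fun setT h2 by apply/measurable_EFinP; exact: measurable_int ih2.
have n1 := integrable_norm ih1; have n2 := integrable_norm ih2.
pose H (p : T1 * T2) : R := `|h1 p.1| * `|h2 p.2|.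
have mH : measurable_fun setT H.
  apply: measurable_funM.
    by apply: measurableT_comp => //; exact: (measurableT_comp mh1 measurable_fst).
  by apply: measurableT_comp => //; exact: (measurableT_comp mh2 measurable_snd).
apply: (le_integrable measurableT (g := EFin \o H)).
- exact/measurable_EFinP.
- move=> p _; rewrite /= lee_fin normrM !normr_id (le_trans (fh p))//.
  by rewrite (le_trans (ler_norm _))// normrM.
apply/integrable12ltyP; first exact/measurable_EFinP.
have E x : (\int[m2]_y `|(EFin \o H) (x, y)| = `|h1 x|%:E * \int[m2]_y `|h2 y|%:E)%E.
  rewrite -ge0_integralZl//; last exact/measurable_EFinP/measurableT_comp.
  by apply: eq_integral => y _; rewrite /= normrM !normr_id EFinM.
rewrite (eq_integral _ _ (fun x _ => E x)) ge0_integralZr//.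
- apply: lte_mul_pinfty; first exact: integral_ge0.
    rewrite ge0_fin_numE; last exact: integral_ge0.
    by have /integrableP[_] := n1; under eq_integral do rewrite /= normr_id.
  by have /integrableP[_] := n2; under eq_integral do rewrite /= normr_id.
- exact/measurable_EFinP/measurableT_comp.
- exact: integral_ge0.
Qed.

Lemma integrable_section1 (f : T1 * T2 -> R) s : measurable_fun setT f ->
  (forall p, `|f p| <= h1 p.1 * h2 p.2) -> m2.-integrable setT (EFin \o (fun t => f (s, t))).
Proof.
move=> mf fh; apply: (le_integrable measurableT _ _ (integrableZl measurableT (h1 s) ih2)).
  by apply/measurable_EFinP; exact: (measurableT_comp mf (pair1_measurable s)).
by move=> t _; rewrite /= lee_fin (le_trans (fh (s, t)))// ler_norm.
Qed.

Lemma integrable_section2 (f : T1 * T2 -> R) t : measurable_fun setT f ->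
  (forall p, `|f p| <= h1 p.1 * h2 p.2) -> m1.-integrable setT (EFin \o (fun s => f (s, t))).
Proof.
move=> mf fh; apply: (le_integrable measurableT _ _ (integrableZl measurableT (h2 t) ih1)).
  by apply/measurable_EFinP; exact: (measurableT_comp mf (pair2_measurable t)).
by move=> s _; rewrite /= lee_fin (le_trans (fh (s, t)))// mulrC ler_norm.
Qed.

Lemma Rintegral_prod1 (f : T1 * T2 -> R) : measurable_fun setT f ->
  (forall p, `|f p| <= h1 p.1 * h2 p.2) ->
  \int[(m1 \x m2)%E]_p f p = \int[m1]_s \int[m2]_t f (s, t).
Proof.
move=> mf fh; have fi := integrable_prod_dominated mf fh.
rewrite /Rintegral; congr fine; rewrite -(integral12_prod_meas1 fi).
apply: eq_integral => s _; rewrite /fubini_F fineK//.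
exact: (integral_fune_fin_num measurableT (integrable_section1 s mf fh)).
Qed.

Lemma Rintegral_prod2 (f : T1 * T2 -> R) : measurable_fun setT f ->
  (forall p, `|f p| <= h1 p.1 * h2 p.2) ->
  \int[(m1 \x m2)%E]_p f p = \int[m2]_t \int[m1]_s f (s, t).
Proof.
move=> mf fh; have fi := integrable_prod_dominated mf fh.
rewrite /Rintegral; congr fine; rewrite -(integral21_prod_meas1 fi).
apply: eq_integral => t _; rewrite /fubini_G fineK//.
exact: (integral_fune_fin_num measurableT (integrable_section2 t mf fh)).
Qed.

Variable f : T1 * T2 -> C.
Hypotheses (mf : cmeasurable_fun setT f) (fh : forall p, normc (f p) <= h1 p.1 * h2 p.2).

Let fRe p : `|complex.Re (f p)| <= h1 p.1 * h2 p.2.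
Proof. exact: le_trans (normr_Re _) (fh p). Qed.

Let fIm p : `|complex.Im (f p)| <= h1 p.1 * h2 p.2.
Proof. exact: le_trans (normr_Im _) (fh p). Qed.

Lemma cintegral_prod1 : cintegral (m1 \x m2)%E setT f =
  cintegral m1 setT (fun s => cintegral m2 setT (fun t => f (s, t))).
Proof.
case: mf => mf1 mf2; rewrite /cintegral; congr (_ +i* _).
  exact: (Rintegral_prod1 mf1).
exact: (Rintegral_prod1 mf2).
Qed.

Lemma cintegral_prod2 : cintegral (m1 \x m2)%E setT f =
  cintegral m2 setT (fun t => cintegral m1 setT (fun s => f (s, t))).
Proof.
case: mf => mf1 mf2; rewrite /cintegral; congr (_ +i* _).
  exact: (Rintegral_prod2 mf1).
exact: (Rintegral_prod2 mf2).
Qed.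

End fubini_dominated.

Section cmeasurable_integral.
Context d1 d2 (T1 : measurableType d1) (T2 : measurableType d2) (R : realType).
Variable (m2 : {sigma_finite_measure set T2 -> \bar R}).
Local Notation C := R[i].

(** The real integral is [fine] of a difference of two Tonelli integrals, each measurable in s. *)
Lemma measurable_Rintegral (f : T1 * T2 -> R) : measurable_fun setT f ->
  measurable_fun setT (fun s => \int[m2]_t f (s, t)).
Proof.
move=> mf; apply: (measurableT_comp (fine_measurable measurableT)).
rewrite (_ : (fun s => _) = (fun s => fubini_F m2 (EFin \o f)^\+%E s - fubini_F m2 (EFin \o f)^\-%E s)%E).
  apply: emeasurable_funB; apply: measurable_fun_fubini_tonelli_F => //.
    by apply: measurable_funepos; exact/measurable_EFinP.
  by apply: measurable_funeneg; exact/measurable_EFinP.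
apply/funext => s; rewrite integralE /fubini_F.
have pc := @funepos_comp _ _ R (EFin \o f) (fun t => (s, t)).
have nc := @funeneg_comp _ _ R (EFin \o f) (fun t => (s, t)).
by congr (_ - _)%E; apply: eq_integral => t _; [exact: (congr1 (fun f => f t) pc)|exact: (congr1 (fun f => f t) nc)].
Qed.

Lemma cmeasurable_cintegral (f : T1 * T2 -> C) : cmeasurable_fun setT f ->
  cmeasurable_fun setT (fun s => cintegral m2 setT (fun t => f (s, t))).
Proof.
by move=> [mf1 mf2]; split; [exact: (measurable_Rintegral mf1)|exact: (measurable_Rintegral mf2)].
Qed.

End cmeasurable_integral.

Section cintegral_support.
Context d (T : measurableType d) (R : realType).
Variable mu : {measure set T -> \bar R}.
Local Notation C := R[i].

Lemma cintegral_support (D : set T) (f : T -> C) : (forall x, ~ D x -> f x = 0) ->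
  cintegral mu D f = cintegral mu setT f.
Proof.
move=> f0; rewrite /cintegral; congr (_ +i* _); rewrite Rintegral_mkcond;
  apply: eq_Rintegral => x _; rewrite patchE; case: ifPn => //;
  by rewrite notin_setE => /f0 ->.
Qed.

Lemma ae_eq_cintegral (D N : set T) (f g : T -> C) : measurable D -> measurable N -> mu N = 0%E ->
  cmeasurable_fun D f -> cmeasurable_fun D g -> (forall x, ~ N x -> f x = g x) ->
  cintegral mu D f = cintegral mu D g.
Proof.
move=> mD mN N0 [f1 f2] [g1 g2] fg.
rewrite /cintegral /Rintegral; congr (fine _ +i* fine _); apply: ae_eq_integral => //.
- exact/measurable_EFinP.
- exact/measurable_EFinP.
- by exists N; split => // x /=; apply: contra_notP => Nx _; rewrite fg.
- exact/measurable_EFinP.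
- exact/measurable_EFinP.
- by exists N; split => // x /=; apply: contra_notP => Nx _; rewrite fg.
Qed.

Lemma cintegrable_ae_bounded (D N : set T) (f : T -> C) (B : R) : measurable D -> measurable N ->
  mu N = 0%E -> (mu D < +oo)%E -> cmeasurable_fun D f ->
  (forall x, D x -> ~ N x -> normc (f x) <= B) -> cintegrable mu D f.
Proof.
move=> mD mN N0 Df [f1 f2] fB.
have mDN : measurable (D `\` N) by exact: measurableD.
have DNf : (mu (D `\` N) < +oo)%E by apply: le_lt_trans Df; apply: le_measure; rewrite ?inE.
have H (u : T -> R) : measurable_fun D u -> (forall x, D x -> ~ N x -> `|u x| <= B) ->
    mu.-integrable D (EFin \o u).
  move=> mu' uB; apply/(negligible_integrable mN mD _ N0); first exact/measurable_EFinP.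
  apply: measurable_bounded_integrable => //.
    by apply: measurable_funS mu' => //; exact: subDsetl.
  exists B; split; first exact: num_real.
  by move=> M BM x [Dx Nx] /=; rewrite (le_trans (uB x Dx Nx))// ltW.
split; apply: H => // x Dx Nx; rewrite (le_trans _ (fB x Dx Nx))//.
  exact: normr_Re.
exact: normr_Im.
Qed.

End cintegral_support.

(** * Boundedness and domination for test functions *)

Section test_functions.
Variables (R : realType) (n : nat).
Local Notation C := R[i].
Local Notation leb := (@lebesgue_rV R n).

Lemma compact_box (r : R) : compact [set v : 'rV[R]_n | forall i, `[- r, r]%classic (v ord0 i)].
Proof. by apply: (@rV_compact _ _ (fun=> `[- r, r]%classic)) => i; exact: segment_compact. Qed.

Lemma test_real_bounded (u : 'rV[R]_n -> R) (r : R) : continuous u ->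
  (forall x, r < enorm x -> u x = 0) -> exists B : R, forall x, `|u x| <= B.
Proof.
move=> cu u0.
have : compact (u @` [set v : 'rV[R]_n | forall i, `[- r, r]%classic (v ord0 i)]).
  by apply: continuous_compact; [exact: continuous_subspaceT|exact: compact_box].
move=> /compact_bounded [M [_ HM]].
exists (Num.max (M + 1) 0) => x; have [xr|rx] := lerP (enorm x) r.
  rewrite le_max; apply/orP; left; apply: (HM (M + 1)); first by rewrite ltrDl.
  exists x => // i /=; rewrite in_itv/= -ler_norml.
  exact: le_trans (coord_le_enorm x i) xr.
by rewrite u0// normr0 le_max lexx orbT.
Qed.

Lemma test_function_measurable (phi : 'rV[R]_n -> C) : test_function phi -> cmeasurable_fun setT phi.
Proof.
move=> [/(_ 0%N)[h1 h2] _]; split.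
  apply: continuous_measurable_fun_rV; first exact: openT.
  by have [] := h1 [::] isT.
apply: continuous_measurable_fun_rV; first exact: openT.
by have [] := h2 [::] isT.
Qed.

(** For complex frequencies the plane waves grow exponentially in space; compact support of [phi]
    absorbs this. The majorant feeds all uses of Fubini below. *)
Lemma test_function_dom (phi : 'rV[R]_n -> C) (L : R) : test_function phi -> 0 <= L ->
  exists2 h : 'rV[R]_n -> R, leb.-integrable setT (EFin \o h) &
    forall y, expR (L * enorm y) * normc (phi y) <= h y.
Proof.
move=> [/(_ 0%N)[h1 h2] [r phi0]] L0.
have c1 : continuous (fun x => complex.Re (phi x)).
  by move=> x; have [+ _] := h1 [::] isT; apply.
have c2 : continuous (fun x => complex.Im (phi x)).
  by move=> x; have [+ _] := h2 [::] isT; apply.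
have [B1 b1] := test_real_bounded c1 (fun x rx => congr1 (@complex.Re R) (phi0 x rx)).
have [B2 b2] := test_real_bounded c2 (fun x rx => congr1 (@complex.Im R) (phi0 x rx)).
pose D : set 'rV[R]_n := [set x | enorm x <= r].
have mD : measurable D by exact: measurable_enorm_le.
pose c : R := expR (L * `|r|) * (B1 + B2).
exists (fun y => c * \1_D y).
  have i1 : leb.-integrable setT (EFin \o (\1_D : 'rV[R]_n -> R)).
    apply/integrableP; split; first by apply/measurable_EFinP; exact: measurable_indic.
    under eq_integral do rewrite /= ger0_norm//.
    by rewrite integral_indic// setIT; exact: lebesgue_rV_enorm_le_lty.
  exact: (integrableZl measurableT c i1).
move=> y; rewrite indicE; case: (boolP (y \in D)).
  rewrite inE /D/= => yr; rewrite mulr1 ler_pM ?expR_ge0 ?normc_ge0//.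
    by rewrite ler_expR ler_wpM2l// (le_trans yr)// ler_norm.
  by rewrite (le_trans (normc_le_ReIm _))// lerD.
rewrite notin_setE /D/= => /negP; rewrite -ltNge => ry.
by rewrite phi0// normc0 mulr0 mulr0.
Qed.

End test_functions.

Lemma cmeasurable_comp d1 d2 (T1 : measurableType d1) (T2 : measurableType d2) (R : realType)
    (f : T2 -> R[i]) (g : T1 -> T2) :
  cmeasurable_fun setT f -> measurable_fun setT g -> cmeasurable_fun setT (fun x => f (g x)).
Proof. by move=> [f1 f2] mg; split; [exact: (measurableT_comp f1)|exact: (measurableT_comp f2)]. Qed.

(** * Construction of the kernel and verification of its distributional identity *)

Section kernel.
Variables (R : realType) (n : nat).
Local Notation C := R[i].
Local Notation rV := ('rV[R]_n).
Local Notation S := (@sphere R n).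
Local Notation sigma := (@surface_measure R n).
Local Notation leb := (@lebesgue_rV R n).

Lemma dot_le (x xi : rV) : S xi -> `|dot x xi| <= enorm x.
Proof.
move=> Sxi; rewrite -sqrtr_sqr /enorm ler_wsqrtr//.
have := cauchy_schwarz_sum (fun k => x ord0 k) (fun k => xi ord0 k).
have -> : \sum_k xi ord0 k ^+ 2 = 1.
  transitivity (dot xi xi); last by rewrite -enorm_sqr Sxi expr1n.
  by apply: eq_bigr => k _; rewrite expr2.
rewrite mulr1 subr_ge0 => h; apply: (le_trans h).
by rewrite /dot; under eq_bigr do rewrite expr2.
Qed.

Definition osc (lam : C) (p : rV * rV) : C := cexp (imag_unit R * lam * (dot p.1 p.2)%:C).

Lemma measurable_osc lam : cmeasurable_fun setT (osc lam).
Proof.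
apply: cmeasurable_cexp; apply: cmeasurable_funM; first exact: cmeasurable_cst.
apply: cmeasurable_funR; apply: measurable_sum => i.
apply: measurable_funM.
  exact: (measurableT_comp (measurable_rV_coord i) measurable_fst).
exact: (measurableT_comp (measurable_rV_coord i) measurable_snd).
Qed.

Lemma normc_osc_le lam (p : rV * rV) : S p.2 -> normc (osc lam p) <= expR (`|complex.Im lam| * enorm p.1).
Proof.
move=> Sp; rewrite normc_cexp ler_expR (le_trans (ler_norm _))//.
have -> : complex.Re (imag_unit R * lam * (dot p.1 p.2)%:C) = - complex.Im lam * dot p.1 p.2.
  by rewrite !ReM !ImM /=; ring.
by rewrite normrM normrN ler_wpM2l// dot_le.
Qed.

Variables (a : rV -> rV -> C) (A : set rV).
Hypotheses (ma : cmeasurable_fun (setT `*` S) (fun p => a p.1 p.2))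
  (mA : measurable A) (A0 : leb A = 0%E)
  (aA : forall x xi, ~ A x -> S xi -> normc (a x xi) <= 1).

(** The amplitude is measurable only over the sphere and bounded only off the null set [A]. Setting
    it to zero elsewhere gives a function that is measurable and bounded by 1 everywhere. *)
Definition cut (p : rV * rV) : C :=
  if (p.1 \in ~` A) && (p.2 \in S) then a p.1 p.2 else 0.

Lemma cutE x xi : ~ A x -> S xi -> cut (x, xi) = a x xi.
Proof. by move=> Ax Sxi; rewrite /cut !mem_set. Qed.

Lemma cut_off x xi : ~ S xi -> cut (x, xi) = 0.
Proof. by move=> Sxi; rewrite /cut /= [X in _ && X]memNset// andbF. Qed.

Lemma cut_null x xi : A x -> cut (x, xi) = 0.
Proof. by move=> Ax; rewrite /cut /= memNset. Qed.

Lemma measurable_cut : cmeasurable_fun setT cut.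
Proof.
have mS := @measurable_sphere R n.
have mAS : measurable (~` A `*` S) by apply: measurableX => //; exact: measurableC.
have mTS : measurable ([set: rV] `*` S) by exact: measurableX.
have E (p : rV * rV) : (p \in ~` A `*` S) = (p.1 \in ~` A) && (p.2 \in S).
  apply/idP/andP => [/set_mem[h1 h2]|[/set_mem h1 /set_mem h2]].
    by split; exact: mem_set.
  exact: mem_set.
case: ma => m1 m2; split.
  rewrite (_ : (fun _ => _) = (fun p => complex.Re (a p.1 p.2)) \_ (~` A `*` S)).
    by apply/(measurable_restrictT _ _).1 => //; apply: measurable_funS m1 => // p [].
  by apply/funext => p; rewrite patchE E /cut; case: ifP.
rewrite (_ : (fun _ => _) = (fun p => complex.Im (a p.1 p.2)) \_ (~` A `*` S)).
  by apply/(measurable_restrictT _ _).1 => //; apply: measurable_funS m2 => // p [].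
by apply/funext => p; rewrite patchE E /cut; case: ifP.
Qed.

Lemma normc_cut p : normc (cut p) <= 1.
Proof.
by rewrite /cut; case: ifP => [/andP[]|_]; rewrite ?normc0// !inE; exact: aA.
Qed.

Definition symb lam p : C := osc lam p * cut p.

Lemma measurable_symb lam : cmeasurable_fun setT (symb lam).
Proof. by apply: cmeasurable_funM; [exact: measurable_osc|exact: measurable_cut]. Qed.

Lemma normc_symb lam p : normc (symb lam p) <= expR (`|complex.Im lam| * enorm p.1).
Proof.
have [Sp|Sp] := pselect (S p.2).
  rewrite normcM -[leRHS]mulr1 ler_pM ?normc_ge0 ?normc_osc_le//; exact: normc_cut.
by case: p Sp => x xi /= Sp; rewrite /symb cut_off// mulr0 normc0 expR_ge0.
Qed.

Variables (lam mu : C).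

(** Built from the cut amplitudes, so that it vanishes when x or y lies in [A]; integrating over the
    whole space is harmless since the cut also vanishes off the sphere. *)
Definition kern x y : C :=
  cintegral sigma setT (fun xi => symb lam (x, xi) * (symb mu (y, xi))^*%C).

Let l := `|complex.Im lam|.
Let m := `|complex.Im mu|.
Let l0 : 0 <= l. Proof. exact: normr_ge0. Qed.
Let m0 : 0 <= m. Proof. exact: normr_ge0. Qed.

Let p13 (q : (rV * rV) * rV) : rV * rV := (q.1.1, q.2).
Let p23 (q : (rV * rV) * rV) : rV * rV := (q.1.2, q.2).

Let mp13 : measurable_fun setT p13.
Proof.
apply: measurable_fun_pair; last exact: measurable_snd.
exact: (measurableT_comp measurable_fst measurable_fst).
Qed.

Let mp23 : measurable_fun setT p23.
Proof.
apply: measurable_fun_pair; last exact: measurable_snd.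
exact: (measurableT_comp measurable_snd measurable_fst).
Qed.

Lemma measurable_kern : cmeasurable_fun setT (fun p => kern p.1 p.2).
Proof.
pose F (q : (rV * rV) * rV) : C := symb lam (p13 q) * (symb mu (p23 q))^*%C.
have mF : cmeasurable_fun setT F.
  apply: cmeasurable_funM; first exact: cmeasurable_comp (measurable_symb lam) mp13.
  by apply: cmeasurable_funJ; exact: cmeasurable_comp (measurable_symb mu) mp23.
exact: (@cmeasurable_cintegral _ _ _ _ R sigma F mF).
Qed.

Let s := fine (sigma setT).

Lemma normc_kern x y : normc (kern x y) <= 2 * (expR (l * enorm x) * expR (m * enorm y) * s).
Proof.
rewrite /s -Rintegral_cst//.
have ic : sigma.-integrable setT (EFin \o cst (expR (l * enorm x) * expR (m * enorm y))).
  exact: finite_measure_integrable_cst.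
have mE lam' z : cmeasurable_fun setT (fun xi => symb lam' (z, xi)).
  exact: cmeasurable_comp (measurable_symb lam') (pair1_measurable z).
have le1 xi : normc (symb lam (x, xi) * (symb mu (y, xi))^*%C) <= expR (l * enorm x) * expR (m * enorm y).
  rewrite normcM normcJ ler_pM ?normc_ge0//.
    exact: (normc_symb lam (x, xi)).
  exact: (normc_symb mu (y, xi)).
apply: normc_cintegral_le => //.
apply: (cintegrable_le measurableT _ (fun xi _ => le1 xi) ic).
by apply: cmeasurable_funM => //; exact: cmeasurable_funJ.
Qed.

Lemma locally_integrable_kern : clocally_integrable2 kern.
Proof.
move=> r.
pose D : set rV := [set x | enorm x <= r].
have mD : measurable D by exact: measurable_enorm_le.
have Df : (leb D < +oo)%E by exact: lebesgue_rV_enorm_le_lty.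
have -> : [set p : rV * rV | enorm p.1 <= r /\ enorm p.2 <= r] = D `*` D by [].
have mDD : measurable (D `*` D) by exact: measurableX.
apply: (@cintegrable_ae_bounded _ _ _ _ _ set0 _ (2 * (expR (l * r) * expR (m * r) * s))) => //.
- rewrite [ltLHS](@product_measure1E _ _ _ _ R leb leb)//.
  by rewrite lte_mul_pinfty// ge0_fin_numE.
- case: measurable_kern => k1 k2; split; exact: measurable_funTS.
- move=> [x y] [/= Dx Dy] _; apply: (le_trans (normc_kern x y)).
  have s0 : 0 <= s by rewrite fine_ge0// measure_ge0.
  rewrite ler_wpM2l// ler_wpM2r// ler_pM ?expR_ge0// ler_expR ler_wpM2l//.
Qed.

Section action.
Variable phi : rV -> C.
Hypothesis tphi : test_function phi.

Let mphi := test_function_measurable tphi.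

Definition cut_adj xi : C := cintegral leb setT (fun y => (symb mu (y, xi))^*%C * phi y).

Let G (q : rV * rV) : C := (symb mu (q.2, q.1))^*%C * phi q.2.

Let mG : cmeasurable_fun setT G.
Proof.
apply: cmeasurable_funM; last exact: cmeasurable_comp mphi measurable_snd.
apply: cmeasurable_funJ; apply: cmeasurable_comp (measurable_symb mu) _.
by apply: measurable_fun_pair; [exact: measurable_snd|exact: measurable_fst].
Qed.

Lemma measurable_cut_adj : cmeasurable_fun setT cut_adj.
Proof. exact: (@cmeasurable_cintegral _ _ _ _ R leb G mG). Qed.

Let dom := test_function_dom tphi m0.

Lemma extension_op_adjE xi : S xi -> extension_op_adj a mu phi xi = cut_adj xi.
Proof.
move=> Sxi; apply: (@ae_eq_cintegral _ _ _ leb setT A) => //.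
- apply: cmeasurable_funM => //; apply: cmeasurable_funJ; apply: cmeasurable_funM.
    exact: (cmeasurable_comp (measurable_osc mu) (pair2_measurable xi)).
  have mS := @measurable_sphere R n.
  case: ma => m1 m2; split.
    apply: (@measurable_comp _ _ _ _ _ _ (setT `*` S) (fun p => complex.Re (a p.1 p.2)) setT (fun y => (y, xi))) => //.
    - exact: measurableX.
    - by move=> _ [y _ <-].
  apply: (@measurable_comp _ _ _ _ _ _ (setT `*` S) (fun p => complex.Im (a p.1 p.2)) setT (fun y => (y, xi))) => //.
  - exact: measurableX.
  - by move=> _ [y _ <-].
- exact: (cmeasurable_comp mG (pair1_measurable xi)).
- by move=> y Ay; rewrite /symb cutE.
Qed.

Definition composed x : C := extension_op a lam (extension_op_adj a mu phi) x.

Lemma measurable_composed : cmeasurable_fun setT composed.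
Proof.
have mS := @measurable_sphere R n.
have mTS : measurable ([set: rV] `*` S) by exact: measurableX.
(* At points x of [A] the operator still uses the original values of [a], so only the angular
   variable may be cut here. *)
pose b (p : rV * rV) : C := if p.2 \in S then a p.1 p.2 else 0.
have mb : cmeasurable_fun setT b.
  have E (p : rV * rV) : (p \in [set: rV] `*` S) = (p.2 \in S).
    apply/idP/idP => [/set_mem[h1 h2]|/set_mem h2]; exact: mem_set.
  case: ma => m1 m2; split.
    rewrite (_ : (fun _ => _) = (fun p => complex.Re (a p.1 p.2)) \_ (setT `*` S)).
      exact/(measurable_restrictT _ _).1.
    by apply/funext => p; rewrite patchE E /b; case: ifP.
  rewrite (_ : (fun _ => _) = (fun p => complex.Im (a p.1 p.2)) \_ (setT `*` S)).
    exact/(measurable_restrictT _ _).1.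
  by apply/funext => p; rewrite patchE E /b; case: ifP.
pose H (p : rV * rV) : C := osc lam p * b p * cut_adj p.2.
have mH : cmeasurable_fun setT H.
  apply: cmeasurable_funM; last exact: cmeasurable_comp measurable_cut_adj measurable_snd.
  by apply: cmeasurable_funM => //; exact: measurable_osc.
rewrite (_ : composed = fun x => cintegral sigma setT (fun xi => H (x, xi))).
  exact: (@cmeasurable_cintegral _ _ _ _ R sigma H mH).
apply/funext => x; rewrite -(@cintegral_support _ _ _ sigma S); last first.
  by move=> xi Sxi; rewrite /H /b memNset// mulr0 mul0r.
apply: eq_cintegral => xi Sxi; rewrite /H /b mem_set//.
by rewrite extension_op_adjE.
Qed.

(** Fubini in (xi, y), dominated by a constant in xi times the majorant of [phi] in y. Outside [A]
    the cut amplitude at x is the original one; in the y-integral the difference lies on a null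
    set. *)
Lemma composedE x : ~ A x -> composed x = cintegral leb setT (fun y => kern x y * phi y).
Proof.
move=> Ax; have [h ih hP] := dom.
pose F (q : rV * rV) : C := symb lam (x, q.1) * G q.
have mF : cmeasurable_fun setT F.
  apply: cmeasurable_funM => //; apply: cmeasurable_comp (measurable_symb lam) _.
  by apply: measurable_fun_pair; [exact: measurable_cst|exact: measurable_fst].
have ic : sigma.-integrable setT (EFin \o cst (expR (l * enorm x))).
  exact: finite_measure_integrable_cst.
have Fh q : normc (F q) <= cst (expR (l * enorm x)) q.1 * h q.2.
  rewrite /F normcM ler_pM ?normc_ge0//.
    exact: (normc_symb lam (x, q.1)).
  rewrite /G normcM normcJ; apply: le_trans (hP q.2); rewrite ler_wpM2r ?normc_ge0//.
  exact: (normc_symb mu (q.2, q.1)).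
have iG xi : cintegrable leb setT (fun y => G (xi, y)).
  apply: (cintegrable_le measurableT _ _ ih).
    exact: (cmeasurable_comp mG (pair1_measurable xi)).
  move=> y _; rewrite /G normcM normcJ; apply: le_trans (hP y); rewrite ler_wpM2r ?normc_ge0//.
  exact: (normc_symb mu (y, xi)).
transitivity (cintegral sigma setT (fun xi => cintegral leb setT (fun y => F (xi, y)))).
  rewrite -(@cintegral_support _ _ _ sigma S); last first.
    move=> xi Sxi; rewrite /F /symb /=; under eq_fun do rewrite cut_off// mulr0 mul0r.
    by rewrite /cintegral /Rintegral/= integral0.
  apply: eq_cintegral => xi Sxi; rewrite extension_op_adjE//.
  have -> := cintegralZ measurableT (symb lam (x, xi)) (iG xi).
  by rewrite /symb cutE.
rewrite -(cintegral_prod1 ic ih mF Fh) (cintegral_prod2 ic ih mF Fh).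
apply: eq_cintegral => y _; rewrite /F /G /kern.
have mE lam' z : cmeasurable_fun setT (fun xi => symb lam' (z, xi)).
  exact: cmeasurable_comp (measurable_symb lam') (pair1_measurable z).
rewrite [RHS]mulrC -cintegralZ//.
  by apply: eq_cintegral => xi _ /=; ring.
apply: (@cintegrable_le _ _ _ _ _ measurableT _ (cst (expR (l * enorm x) * expR (m * enorm y)))).
- by apply: cmeasurable_funM => //; exact: cmeasurable_funJ.
- move=> xi _; rewrite normcM normcJ ler_pM ?normc_ge0//.
    exact: (normc_symb lam (x, xi)).
  exact: (normc_symb mu (y, xi)).
- exact: finite_measure_integrable_cst.
Qed.

Lemma locally_integrable_composed : clocally_integrable composed.
Proof.
move=> r; have [h ih hP] := dom.
have s0 : 0 <= s by rewrite fine_ge0// measure_ge0.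
apply: (@cintegrable_ae_bounded _ _ _ _ _ A _ (2 * \int[leb]_y (2 * expR (l * r) * s * h y))) => //.
- exact: measurable_enorm_le.
- exact: lebesgue_rV_enorm_le_lty.
- case: measurable_composed => k1 k2; split; exact: measurable_funTS.
move=> x xr Ax; rewrite composedE//.
have ih' : leb.-integrable setT (EFin \o (fun y => 2 * expR (l * r) * s * h y)).
  exact: (integrableZl measurableT (2 * expR (l * r) * s) ih).
have le1 y : normc (kern x y * phi y) <= 2 * expR (l * r) * s * h y.
  rewrite normcM (@le_trans _ _ (2 * (expR (l * enorm x) * expR (m * enorm y) * s) * normc (phi y)))//.
    by rewrite ler_wpM2r ?normc_ge0// normc_kern.
  rewrite (_ : _ * normc (phi y) = 2 * expR (l * enorm x) * s * (expR (m * enorm y) * normc (phi y))); last by ring.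
  rewrite ler_pM ?mulr_ge0 ?expR_ge0 ?normc_ge0//.
  by rewrite ler_wpM2r// ler_wpM2l// ler_expR ler_wpM2l.
apply: normc_cintegral_le => //.
apply: (cintegrable_le measurableT _ (fun y _ => le1 y) ih').
apply: cmeasurable_funM => //.
exact: (cmeasurable_comp measurable_kern (pair1_measurable x)).
Qed.

Lemma composed_pairing (psi : rV -> C) : test_function psi ->
  cintegral leb setT (fun x => composed x * psi x) =
  cintegral (leb \x leb)%E setT (fun p => kern p.1 p.2 * phi p.2 * psi p.1).
Proof.
move=> tpsi; have mpsi := test_function_measurable tpsi.
have [h2 ih2 hP2] := dom.
have [h1 ih1 hP1] := test_function_dom tpsi l0.
have s0 : 0 <= s by rewrite fine_ge0// measure_ge0.
pose F (p : rV * rV) : C := kern p.1 p.2 * phi p.2 * psi p.1.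
have mkp : cmeasurable_fun setT (fun p : rV * rV => kern p.1 p.2 * phi p.2).
  apply: cmeasurable_funM; first exact: measurable_kern.
  exact: cmeasurable_comp mphi measurable_snd.
have mF : cmeasurable_fun setT F.
  by apply: cmeasurable_funM => //; exact: cmeasurable_comp mpsi measurable_fst.
have ih1' : leb.-integrable setT (EFin \o (fun x => 2 * s * h1 x)).
  exact: (integrableZl measurableT (2 * s) ih1).
have Fh p : normc (F p) <= 2 * s * h1 p.1 * h2 p.2.
  rewrite /F normcM normcM.
  apply: (@le_trans _ _ (2 * (expR (l * enorm p.1) * expR (m * enorm p.2) * s) * normc (phi p.2) * normc (psi p.1))).
    by rewrite !ler_wpM2r ?normc_ge0// normc_kern.
  rewrite (_ : _ * normc (psi p.1) = 2 * s * ((expR (l * enorm p.1) * normc (psi p.1)) *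
    (expR (m * enorm p.2) * normc (phi p.2)))); last by ring.
  rewrite -[leRHS]mulrA ler_wpM2l ?mulr_ge0//.
  by rewrite ler_pM ?mulr_ge0 ?expR_ge0 ?normc_ge0.
rewrite (cintegral_prod1 ih1' ih2 mF Fh).
apply: (@ae_eq_cintegral _ _ _ leb setT A) => //.
- by apply: cmeasurable_funM => //; exact: measurable_composed.
- exact: (@cmeasurable_cintegral _ _ _ _ R leb F mF).
move=> x Ax; rewrite composedE// mulrC -cintegralZ//.
  by apply: eq_cintegral => y _; rewrite /F /= mulrC.
have ih' : leb.-integrable setT (EFin \o (fun y => 2 * expR (l * enorm x) * s * h2 y)).
  exact: (integrableZl measurableT (2 * expR (l * enorm x) * s) ih2).
apply: (cintegrable_le measurableT _ _ ih').
  exact: (cmeasurable_comp mkp (pair1_measurable x)).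
move=> y _; rewrite normcM (@le_trans _ _ (2 * (expR (l * enorm x) * expR (m * enorm y) * s) * normc (phi y)))//.
  by rewrite ler_wpM2r ?normc_ge0// normc_kern.
rewrite (_ : _ * normc (phi y) = 2 * expR (l * enorm x) * s * (expR (m * enorm y) * normc (phi y))); last by ring.
by rewrite ler_wpM2l ?mulr_ge0 ?expR_ge0.
Qed.

End action.

Lemma schwartz_kernel_kern :
  is_schwartz_kernel (fun f => extension_op a lam (extension_op_adj a mu f)) kern.
Proof.
split; first exact: locally_integrable_kern.
move=> phi tphi; split; first exact: locally_integrable_composed.
by move=> psi tpsi; exact: composed_pairing.
Qed.

End kernel.

(** * Pointwise bounds for the kernel and the final theorem *)

Section kernel_bound.
Variables (R : realType) (n : nat).
Local Notation C := R[i].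
Local Notation rV := ('rV[R]_n).
Local Notation S := (@sphere R n).
Local Notation sigma := (@surface_measure R n).
Local Notation leb := (@lebesgue_rV R n).
Local Notation U := [set x : rV | x != 0].

Lemma complex_split (z : C) : z = (complex.Re z)%:C + imag_unit R * (complex.Im z)%:C.
Proof. by case: z => x y; apply: complex_eqP => /=; ring. Qed.

Lemma normc_imag_unit : normc (imag_unit R) = 1.
Proof. by rewrite /= expr0n/= add0r expr1n sqrtr1. Qed.

Lemma tanCk_cCk k : exists2 A : R, 0 <= A & forall c, unit_coef c ->
  forall f : rV -> C, cCk_on k U f ->
  (forall s x, (size s <= k)%N -> S x -> normc (cpartial s f x) <= 1) ->
  tanCk c k A f /\ tanCk c k A (fun x => (f x)^*%C).
Proof.
have [A A0 HA] := @tanCk_Ck R n k.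
exists (A + 2 ^+ k * 1 * A); first by rewrite addr_ge0// !mulr_ge0.
move=> c uc f [f1 f2] fB.
have hr : tanCk c k A (fun x => (complex.Re (f x))%:C).
  rewrite -[A]mulr1; apply: HA => // s sk x Sx.
  exact: le_trans (normr_Re (cpartial s f x)) (fB s x sk Sx).
have hi : tanCk c k A (fun x => (complex.Im (f x))%:C).
  rewrite -[A]mulr1; apply: HA => // s sk x Sx.
  exact: le_trans (normr_Im (cpartial s f x)) (fB s x sk Sx).
have hI : tanCk c k 1 (fun=> imag_unit R) by rewrite -normc_imag_unit; exact: tanCk_cst.
have him := tanCkM ler01 A0 hI hi.
split.
  by apply: eq_tanCk (tanCkD hr him) => x _; rewrite [RHS]complex_split.
apply: eq_tanCk (tanCkD hr (tanCkN him)) => x _.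
by rewrite [in RHS](complex_split (f x)); apply: complex_eqP => /=; ring.
Qed.

Lemma Linfty_CN_good N (a : rV -> rV -> C) : Linfty_CN_unit_ball N a ->
  exists A : set rV, [/\ measurable A, leb A = 0%E & forall x, ~ A x ->
    cCk_on N U (a x \o @unit_dir R n) /\
    forall s xi, (size s <= N)%N -> S xi -> normc (cpartial s (a x \o @unit_dir R n) xi) <= 1].
Proof.
move=> [_ aC /ess_supP a1]; have [A [mA A0 HA]] := filterI aC a1.
exists A; split => // x Ax.
have [c1 c2] : CN_sphere N (a x) /\ (CN_norm N (a x) <= 1)%E by apply: contrapT => /HA.
split => // s xi sN Sxi; rewrite -lee_fin; apply: le_trans c2.
by apply: ereal_sup_ubound; exists (s, xi).
Qed.

(** One estimate for an arbitrary pair of frequencies. The conjugate in the adjoint turns the two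
    exponentials into a single one with exponent vector [v], and [rho] is left free so that each
    kernel can insert its own growth rate. The null set depends on [a] alone. *)
Lemma kern_bound : (0 < n)%N -> exists2 C0 : R, 0 <= C0 & forall N, (n.-1 <= N)%N ->
  forall a : rV -> rV -> C, Linfty_CN_unit_ball N a -> exists A : set rV,
  (forall lam mu : C, is_schwartz_kernel (fun f => extension_op a lam (extension_op_adj a mu f))
    (kern a A lam mu)) /\
  forall (lam mu : C) (x y : rV) (rho : R) (v : 'I_n -> C),
  (forall i, v i = imag_unit R * lam * (x ord0 i)%:C + (imag_unit R * mu)^*%C * (y ord0 i)%:C) ->
  (forall xi, S xi -> complex.Re (lin v xi) <= rho) ->
  normc (kern a A lam mu x y) <=
    C0 * expR rho * (1 + Num.sqrt (\sum_i normc (v i) ^+ 2)) `^ (- ((n%:R - 1) / 2)).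
Proof.
move=> n0.
have [A0 A00 HA0] := @oscillatory_bound R n n0.
have [A1 A10 HA1] := tanCk_cCk n.-1.
exists (A0 * (2 ^+ n.-1 * A1 * A1)); first by rewrite !mulr_ge0.
move=> N nN a aN; have [A [mA leb0 good]] := Linfty_CN_good aN.
have [ma _ _] := aN.
have aE x xi : S xi -> a x xi = (a x \o @unit_dir R n) xi by move=> Sxi /=; rewrite unit_dir_sphere.
have a1 x xi : ~ A x -> S xi -> normc (a x xi) <= 1.
  move=> Ax Sxi; have [_ /(_ [::] xi isT Sxi)] := good x Ax.
  by rewrite /cpartial /= unit_dir_sphere//; case: (a x xi).
exists A; split; first by move=> lam mu; exact: schwartz_kernel_kern.
move=> lam mu x y rho v vE vrho.
have rhs0 : 0 <= A0 * (2 ^+ n.-1 * A1 * A1) * expR rho *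
    (1 + Num.sqrt (\sum_i normc (v i) ^+ 2)) `^ (- ((n%:R - 1) / 2)).
  by rewrite !mulr_ge0 ?expR_ge0 ?powR_ge0.
have kern0 : A x \/ A y -> kern a A lam mu x y = 0.
  move=> Axy; rewrite /kern (_ : (fun _ => _) = fun=> 0); last first.
    apply/funext => xi; rewrite /symb; case: Axy => Az.
      by rewrite (cut_null a xi Az) mulr0 mul0r.
    by rewrite (cut_null a xi Az) mulr0 conjc0 mulr0.
  by rewrite /cintegral /Rintegral/= integral0.
have [Ax|Ax] := pselect (A x); first by rewrite kern0 ?normc0//; left.
have [Ay|Ay] := pselect (A y); first by rewrite kern0 ?normc0//; right.
have [[x1 x2] x3] := good x Ax; have [[y1 y2] y3] := good y Ay.
pose b xi := a x xi * (a y xi)^*%C.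
have Hb c : unit_coef c -> tanCk c n.-1 (2 ^+ n.-1 * A1 * A1) b.
  move=> uc.
  have [hx _] := HA1 c uc (a x \o @unit_dir R n) (conj (Ck_on_le nN x1) (Ck_on_le nN x2))
    (fun s z sk => x3 s z (leq_trans sk nN)).
  have [_ hy] := HA1 c uc (a y \o @unit_dir R n) (conj (Ck_on_le nN y1) (Ck_on_le nN y2))
    (fun s z sk => y3 s z (leq_trans sk nN)).
  apply: eq_tanCk (tanCkM A10 A10 hx hy) => xi Sxi.
  by rewrite /b !aE.
have conjM (z w : C) : (z * w)^*%C = z^*%C * w^*%C by exact: rmorphM.
have -> : kern a A lam mu x y = cintegral sigma S (fun xi => cexp (lin v xi) * b xi).
  rewrite /kern -(@cintegral_support _ _ _ sigma S); last first.
    by move=> xi Sxi; rewrite /symb cut_off// mulr0 mul0r.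
  apply: eq_cintegral => xi Sxi; rewrite /symb !cutE// conjM [osc mu _]/osc cexpJ.
  rewrite (_ : lin v xi = imag_unit R * lam * (dot x xi)%:C +
      (imag_unit R * mu * (dot y xi)%:C)^*%C); last first.
    rewrite rmorphM /= oppr0 -[_ +i* 0]/((dot y xi)%:C) /dot !rmorph_sum /= !mulr_sumr -big_split.
    by apply: eq_bigr => i _; rewrite vE !rmorphM /=; ring.
  by rewrite cexpD /osc /b; ring.
apply: HA0 => //; by rewrite !mulr_ge0.
Qed.

(** With al = Re lambda and be = Im lambda, the first kernel has P = Q = x - y, since v = i lambda
    (x - y); the second has P = x + y and Q = x - y, since v = i (lambda x - conj lambda y). Only
    the real part of [v] governs growth, while both parts enter its length. *)
Lemma phase_vector (v : 'I_n -> C) (al be : R) (P Q : rV) :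
  (forall i, v i = (- be * P ord0 i) +i* (al * Q ord0 i)) ->
  (forall xi, S xi -> complex.Re (lin v xi) <= `|be| * enorm P) /\
  \sum_i normc (v i) ^+ 2 = (`|be| * enorm P) ^+ 2 + (`|al| * enorm Q) ^+ 2.
Proof.
move=> vE; split.
  move=> xi Sxi.
  have -> : complex.Re (lin v xi) = - be * dot P xi.
    rewrite /lin (big_morph (@complex.Re R) (@ReD R) (erefl : complex.Re (0 : C) = 0)).
    rewrite /dot mulr_sumr; apply: eq_bigr => i _.
    by rewrite vE /=; ring.
  by rewrite (le_trans (ler_norm _))// normrM normrN ler_wpM2l// dot_le.
rewrite !exprMn !real_normK ?num_real// !enorm_sqr /dot !mulr_sumr -big_split.
by apply: eq_bigr => i _; rewrite sqr_normcE vE /=; ring.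
Qed.

End kernel_bound.

Theorem lemma4p2 (R : realType) (d : nat) (hd : (2 <= d)%N) :
  exists (N0 : nat) (C : R), 0 < C /\
  forall (N : nat), (N0 <= N)%N ->
  forall (a : 'rV[R]_d -> 'rV[R]_d -> R[i]), Linfty_CN_unit_ball N a ->
  forall lambda : R[i],
  (exists K : 'rV[R]_d -> 'rV[R]_d -> R[i],
    is_schwartz_kernel
      (fun f => extension_op a lambda (extension_op_adj a (conjc lambda) f)) K /\
    forall x y : 'rV[R]_d,
      normc (K x y) <=
      C * expR (`|complex.Im lambda| * enorm (x - y)) *
      (1 + normc lambda * enorm (x - y)) `^ (- ((d%:R - 1) / 2))) /\
  (exists K : 'rV[R]_d -> 'rV[R]_d -> R[i],
    is_schwartz_kernel
      (fun f => extension_op a lambda (extension_op_adj a lambda f)) K /\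
    forall x y : 'rV[R]_d,
      normc (K x y) <=
      C * expR (`|complex.Im lambda| * enorm (x + y)) *
      (1 + `|complex.Re lambda| * enorm (x - y)
         + `|complex.Im lambda| * enorm (x + y)) `^ (- ((d%:R - 1) / 2))).
Proof.
have d0 : (0 < d)%N by exact: ltn_trans hd.
have [C0 C00 HC0] := @kern_bound R d d0.
set al : R := (d%:R - 1) / 2.
have al0 : 0 <= al by rewrite divr_ge0// subr_ge0 ler1n.
pose c2 : R := 2 `^ al.
have c21 : 1 <= c2 by rewrite -[leLHS](powRr0 2) ler_powR// ler1n.
(* One derivative is spent per integration by parts, hence d - 1. The factor [c2] is used for the
   second kernel, and the summand 1 makes the constant strictly positive, as [C0] is only
   nonnegative. *)
exists d.-1, (c2 * C0 + 1); split; first by rewrite ltr_wpDl// mulr_ge0 ?powR_ge0.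
move=> N dN a aN lam; have [A [HK Hb]] := HC0 N dN a aN.
have E0 := @expR_ge0 R; have P0 := @powR_ge0 R.
have C0le : C0 <= c2 * C0 + 1 by rewrite (@le_trans _ _ (c2 * C0)) ?ler_peMl// lerDl.
split.
  exists (kern a A lam (conjc lam)); split; first exact: HK.
  move=> x y.
  pose v i : R[i] := (- complex.Im lam * (x - y) ord0 i) +i* (complex.Re lam * (x - y) ord0 i).
  have [vr vs] := @phase_vector R d v (complex.Re lam) (complex.Im lam) (x - y) (x - y) (fun=> erefl).
  have vE i : v i = imag_unit R * lam * (x ord0 i)%:C + (imag_unit R * conjc lam)^*%C * (y ord0 i)%:C.
    by rewrite /v !mxE; case: (lam) => l1 l2; apply: complex_eqP => /=; ring.
  have := Hb lam (conjc lam) x y _ v vE vr; rewrite vs.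
  have -> : (`|complex.Im lam| * enorm (x - y)) ^+ 2 + (`|complex.Re lam| * enorm (x - y)) ^+ 2 =
      (normc lam * enorm (x - y)) ^+ 2.
    by rewrite !exprMn !real_normK ?num_real// sqr_normcE; ring.
  rewrite sqrtr_sqr (ger0_norm (mulr_ge0 (normc_ge0 lam) (enorm_ge0 (x - y)))) => h.
  by apply: (le_trans h); rewrite !ler_wpM2r.
exists (kern a A lam lam); split; first exact: HK.
move=> x y.
pose v i : R[i] := (- complex.Im lam * (x + y) ord0 i) +i* (complex.Re lam * (x - y) ord0 i).
have [vr vs] := @phase_vector R d v (complex.Re lam) (complex.Im lam) (x + y) (x - y) (fun=> erefl).
have vE i : v i = imag_unit R * lam * (x ord0 i)%:C + (imag_unit R * lam)^*%C * (y ord0 i)%:C.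
  by rewrite /v !mxE; case: (lam) => l1 l2; apply: complex_eqP => /=; ring.
have := Hb lam lam x y _ v vE vr; rewrite vs => h; apply: (le_trans h).
set p : R := `|complex.Im lam| * enorm (x + y); set q : R := `|complex.Re lam| * enorm (x - y).
have p0 : 0 <= p by rewrite mulr_ge0 ?enorm_ge0.
have q0 : 0 <= q by rewrite mulr_ge0 ?enorm_ge0.
pose r : R := Num.sqrt (p ^+ 2 + q ^+ 2); rewrite -/r.
have r2 : r ^+ 2 = p ^+ 2 + q ^+ 2 by rewrite sqr_sqrtr// addr_ge0// sqr_ge0.
have r0 : 0 <= r by exact: sqrtr_ge0.
have pr : p <= r by rewrite -(@ler_pXn2r _ 2)// ?nnegrE// r2 lerDl sqr_ge0.
have qr : q <= r by rewrite -(@ler_pXn2r _ 2)// ?nnegrE// r2 lerDr sqr_ge0.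
have decay : (1 + r) `^ (- al) <= c2 * (1 + q + p) `^ (- al).
  have r1 : 0 < 1 + r by lra.
  have pq1 : 0 < 1 + q + p by lra.
  rewrite !powRN ler_pdivlMr ?powR_gt0// mulrC ler_pdivrMr ?powR_gt0//.
  have -> : c2 * (1 + r) `^ al = (2 * (1 + r)) `^ al by rewrite powRM// addr_ge0.
  by apply: ge0_ler_powR => //; rewrite ?nnegrE; lra.
apply: (@le_trans _ _ (C0 * expR p * (c2 * (1 + q + p) `^ (- al)))).
  by rewrite ler_wpM2l// mulr_ge0.
rewrite (_ : C0 * expR p * _ = c2 * C0 * expR p * (1 + q + p) `^ (- al)); last by ring.
by rewrite !ler_wpM2r// lerDl.
Qed.
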